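(* Consider any one of the six cases (CP), (CH), (T), (A$+$), (A$-$), (iA) described in the context, with its coordinate domain $\mathbb D$, its class of special surfaces, its smooth functions $\omega, Q$ (and $R$ in the cases (T), (iA)) on $\mathbb D$, its family of matrix-valued $1$-forms $\alpha^\lambda$ and its parameter set $\Lambda_0$ ($\Lambda_0=S^1$ in the cases (CP), (CH), (A$\pm$), and $\Lambda_0=\mathbb R^+=\{\lambda\in\mathbb R : \lambda>0\}$ in the cases (T), (iA)). Then the family $\alpha^\lambda$ is the family of extended Maurer-Cartan forms of a surface in the special class (that is, $\alpha^\lambda$ belongs to the associated family of a surface of the class, in the sense defined in the context) if and only if the connection $d+\alpha^\lambda$ is flat, i.e. $d\alpha^\lambda+\alpha^\lambda\wedge\alpha^\lambda=0$, for all $\lambda\in\Lambda_0$.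
   Context: **Domain and coordinates.** $\mathbb D$ is a simply connected open set, in $\mathbb C$ with coordinate $z=x+iy$ in the conformal cases (CP), (CH), (A$\pm$), and in $\mathbb R^2$ with coordinates $(u,v)$ in the asymptotic line cases (T), (iA). Subscripts denote partial derivatives, $f_z=\frac12(f_x-if_y)$, $f_{\bar z}=\frac12(f_x+if_y)$. All maps are smooth. $\omega:\mathbb D\to\mathbb R$. $Q:\mathbb D\to\mathbb C$ in the conformal cases; $Q,R:\mathbb D\to i\mathbb R$ in case (T); $Q,R:\mathbb D\to\mathbb R$ in case (iA). $e_3=(0,0,1)^T$. **The surface classes and their frames.** (CP) Minimal Lagrangian conformal immersions $f:\mathbb D\to\mathbb{CP}^2$. Let $\langle\cdot,\cdot\rangle$ be the standard Hermitian product on $\mathbb C^3$ (antilinear in the second variable), $S^5$ its unit sphere and $\pi:S^5\to\mathbb{CP}^2$ the Hopf fibration. A horizontal lift is $\mathfrak f:\mathbb D\to S^5$ with $\pi\circ\mathfrak f=f$ and $\langle d\mathfrak f,\mathfrak f\rangle=0$. The induced metric is $ds^2=\mathrm{Re}\langle d\mathfrak f,d\mathfrak f\rangle=2e^{\omega}dz\,d\bar z$, where $\langle\mathfrak f_z,\mathfrak f_z\rangle=\langle\mathfrak f_{\bar z},\mathfrak f_{\bar z}\rangle=e^\omega$, $\langle\mathfrak f_z,\mathfrak f_{\bar z}\rangle=0$, and $Q=\langle\mathfrak f_{zzz},\mathfrak f\rangle$. The frame is $\mathcal F=(e^{-\omega/2}\mathfrak f_z,e^{-\omega/2}\mathfrak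 f_{\bar z},\mathfrak f)$; the lift is scaled by a constant in $S^1$ so that $\mathcal F\in \mathrm{SU}_3$. (CH) Minimal Lagrangian conformal immersions $f:\mathbb D\to\mathbb{CH}^2$. Same as (CP) with $\langle a,b\rangle=a_1\bar b_1+a_2\bar b_2-a_3\bar b_3$ and $S^5$ replaced by $H^5_1=\{a\in\mathbb C^3:\langle a,a\rangle=-1\}$, with projection $\pi:H^5_1\to\mathbb{CH}^2$ onto the space of negative complex lines; again $Q=\langle\mathfrak f_{zzz},\mathfrak f\rangle$, $\mathcal F=(e^{-\omega/2}\mathfrak f_z,e^{-\omega/2}\mathfrak f_{\bar z},\mathfrak f)$, and the lift is scaled so that $\mathcal F\in\mathrm{SU}_{2,1}$. (T) Timelike minimal Lagrangian immersions $f:\mathbb D\to\mathbb{CH}^2_1$ in null coordinates. Here $\langle a,b\rangle=a_1\overline{b_2}+a_2\overline{b_1}-a_3\overline{b_3}$ on $\mathbb C^3$, $H^5_3=\{a:\langle a,a\rangle=-1\}$, $\mathbb{CH}^2_1$ is the space of complex lines spanned by $a$ with $\langle a,a\rangle<0$, $\pi:H^5_3\to\mathbb{CH}^2_1$ is the projection. The metric induced by $\mathrm{Re}\langle\cdot,\cdot\rangle$ is Lorentzian. A horizontal lift $\mathfrak f:\mathbb D\to H^5_3$ satisfies $\pi\circ\mathfrak f=f$, $\langle d\mathfrak f,\mathfrak f\rangle=0$, and in null coordinates $\langle\mathfrak f_u,\mathfrak f_u\rangle=\langle\mathfrak f_v,\mathfrak f_v\rangle=0$, $\langle\mathfrak f_u,\mathfrak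 f_v\rangle=e^\omega$ (with the convention $\mathrm{Re}\langle\mathfrak f_u,\mathfrak f_v\rangle>0$). $Q=\langle\mathfrak f_{uuu},\mathfrak f\rangle$ and $R=\langle\mathfrak f_{vvv},\mathfrak f\rangle$ (purely imaginary). The frame is $\mathcal F=(e^{-\omega/2}\mathfrak f_u,e^{-\omega/2}\mathfrak f_v,\mathfrak f)$, with the lift scaled by a constant in $S^1$ so that $\det\mathcal F=1$. (A$\pm$) Definite proper affine spheres $f:\mathbb D\to\mathbb R^3$ with affine mean curvature $H=1$ (elliptic, case A$+$) or $H=-1$ (hyperbolic, case A$-$), center $0$, in affine-conformal coordinates: $\det[f_z,f_{\bar z},f_{zz}]=0=\det[f_z,f_{\bar z},f_{\bar z\bar z}]$, $\det[f_z,f_{\bar z},f_{z\bar z}]=ie^{2\omega}$; the affine metric is $2e^\omega|dz|^2$, the affine normal is $\xi=e^{-\omega}f_{z\bar z}$, and $\xi=-Hf$. $Q$ is defined by $f_{zz}=\omega_zf_z+Qe^{-\omega}f_{\bar z}$. The frame is $\mathcal F=(e^{-\omega/2}f_z,e^{-\omega/2}f_{\bar z},\xi)$. (iA) Indefinite proper affine spheres $f:\mathbb D\to\mathbb R^3$ with affine mean curvature $-1$ and center $0$, in null coordinates: $\det[f_u,f_v,f_{uu}]=0=\det[f_u,f_v,f_{vv}]$, $\det[f_u,f_v,f_{uv}]=e^{2\omega}$; the Blaschke metric is $2e^\omega du\,dv$, the affine normal is $\xi=e^{-\omega}f_{uv}$, and $\xi=f$. $Q,R$ are the functions with $f_{uu}=\omega_uf_u+Qe^{-\omega}f_v$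 and $f_{vv}=\omega_vf_v+Re^{-\omega}f_u$. The frame is $\mathcal F=(e^{-\omega/2}f_u,e^{-\omega/2}f_v,\xi)$. **The $1$-forms.** For $\lambda\in\mathbb C^\times$ put $\alpha^\lambda=U^\lambda da+V^\lambda db$ with $(a,b)=(z,\bar z)$ in the conformal cases and $(a,b)=(u,v)$ in the asymptotic line cases, where $$U^\lambda=\begin{pmatrix}\frac12\omega_a&0&\lambda^{-1}p\,e^{\omega/2}\\ \lambda^{-1}q\,e^{-\omega}&-\frac12\omega_a&0\\0&\lambda^{-1}r\,e^{\omega/2}&0\end{pmatrix},\qquad V^\lambda=\begin{pmatrix}-\frac12\omega_b&\lambda s\,e^{-\omega}&0\\0&\frac12\omega_b&\lambda p'\,e^{\omega/2}\\ \lambda r'\,e^{\omega/2}&0&0\end{pmatrix}$$ and - (CP): $p=p'=1$, $r=r'=-1$, $q=-Q$, $s=\overline Q$; - (CH): $p=p'=r=r'=1$, $q=-Q$, $s=\overline Q$; - (T): $p=p'=r=r'=1$, $q=-Q$, $s=-R$; - (A$+$): $p=p'=r=r'=i$, $q=Q$, $s=\overline Q$; - (A$-$): $p=p'=r=r'=1$, $q=Q$, $s=\overline Q$; - (iA): $p=p'=r=r'=1$, $q=Q$, $s=R$. **Associated family.** $\alpha^\lambda$ belongs to the associated family of a surface $f$ of the class if there is a family $\{f^\lambda\}_{\lambda\in\Lambda_0}$ of surfaces of the class with $f^1=f$ such that $f^\lambda$ has the same metric function $\omega$ and has cubic coefficients $\lambda^{-3}Q$ in place of $Q$ (and $\lambda^3R$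 in place of $R$ in the cases (T), (iA)), and such that, $\hat{\mathcal F}^\lambda$ being the frame of $f^\lambda$ (namely, $\hat{\mathcal F}^\lambda=(e^{-\omega/2}\mathfrak f^\lambda_z,e^{-\omega/2}\mathfrak f^\lambda_{\bar z},\mathfrak f^\lambda)$ in the cases (CP), (CH) and $\hat{\mathcal F}^\lambda=(e^{-\omega/2}\mathfrak f^\lambda_u,e^{-\omega/2}\mathfrak f^\lambda_v,\mathfrak f^\lambda)$ in the case (T), where $\mathfrak f^\lambda$ is a horizontal lift of $f^\lambda$ scaled by a constant in $S^1$ so that $\det\hat{\mathcal F}^\lambda=1$; $\hat{\mathcal F}^\lambda=(e^{-\omega/2}f^\lambda_z,e^{-\omega/2}f^\lambda_{\bar z},e^{-\omega}f^\lambda_{z\bar z})$ in the cases (A$\pm$); and $\hat{\mathcal F}^\lambda=(e^{-\omega/2}f^\lambda_u,e^{-\omega/2}f^\lambda_v,e^{-\omega}f^\lambda_{uv})$ in the case (iA)), $F^\lambda=\hat{\mathcal F}^\lambda G^\lambda$ satisfies $(F^\lambda)^{-1}dF^\lambda=\alpha^\lambda$ for all $\lambda\in\Lambda_0$. Here $G^\lambda=\mathrm{diag}(\lambda,\lambda^{-1},1)$ in all cases except (A$+$), where $G^\lambda=\mathrm{diag}(i\lambda,i\lambda^{-1},1)$. *)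

(* Defs.v *)
From mathcomp Require Import all_boot all_order all_algebra.
From mathcomp Require Import all_classical all_reals all_analysis.
From mathcomp Require Import complex.

Set Implicit Arguments.
Unset Strict Implicit.
Unset Printing Implicit Defensive.

Import Order.TTheory GRing.Theory Num.Theory.
Import numFieldNormedType.Exports.

Local Open Scope classical_set_scope.
Local Open Scope complex_scope.
Local Open Scope ring_scope.

(* The coordinate domain is a subset of 'rV[R]_2.  The two coordinates (indices
   0 and 1 of 'I_2) are (x, y) with z = x + i y in the conformal cases, and
   (u, v) in the asymptotic line cases. *)

Inductive surface_case := CP | CH | T | Aplus | Aminus | IA.

Definition conformal (c : surface_case) : bool :=
  match c with T | IA => false | _ => true end.

(** Topology of the domain *)

Definition is_path (R : realType) (D : set 'rV[R]_2) (x y : 'rV[R]_2)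
    (g : R -> 'rV[R]_2) : Prop :=
  [/\ {within `[0, 1], continuous g}, g 0 = x, g 1 = y
    & forall t : R, t \in `[0, 1] -> D (g t)].

Definition null_homotopic (R : realType) (D : set 'rV[R]_2) (x : 'rV[R]_2)
    (g : R -> 'rV[R]_2) : Prop :=
  exists H : R * R -> 'rV[R]_2,
    [/\ {within `[0, 1] `*` `[0, 1], continuous H},
        forall t : R, t \in `[0, 1] -> H (0, t) = g t /\ H (1, t) = x
      & forall s : R, s \in `[0, 1] -> is_path D x x (fun t => H (s, t))].

Definition simply_connected (R : realType) (D : set 'rV[R]_2) : Prop :=
  [/\ D !=set0,
      forall x y, D x -> D y -> exists g, is_path D x y g
    & forall x g, D x -> is_path D x x g -> null_homotopic D x g].

(** Partial derivatives and smoothness *)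

Definition pd (R : realType) (j : 'I_2) (f : 'rV[R]_2 -> R) (p : 'rV[R]_2) : R :=
  'D_(delta_mx 0 j) f p.

Fixpoint Ck_on (R : realType) (n : nat) (D : set 'rV[R]_2)
    (f : 'rV[R]_2 -> R) : Prop :=
  match n with
  | 0 => forall p, D p -> {for p, continuous f}
  | m.+1 => forall j : 'I_2,
      (forall p, D p -> derivable f p (delta_mx 0 j)) /\ Ck_on m D (pd j f)
  end.

Definition smooth_on (R : realType) (D : set 'rV[R]_2) (f : 'rV[R]_2 -> R) : Prop :=
  forall n, Ck_on n D f.

Definition csmooth_on (R : realType) (D : set 'rV[R]_2)
    (f : 'rV[R]_2 -> R[i]) : Prop :=
  smooth_on D (fun q => complex.Re (f q)) /\ smooth_on D (fun q => complex.Im (f q)).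

Definition mxsmooth_on (R : realType) (m n : nat) (D : set 'rV[R]_2)
    (F : 'rV[R]_2 -> 'M[R[i]]_(m, n)) : Prop :=
  forall i j, csmooth_on D (fun q => F q i j).

Definition rmxsmooth_on (R : realType) (m n : nat) (D : set 'rV[R]_2)
    (F : 'rV[R]_2 -> 'M[R]_(m, n)) : Prop :=
  forall i j, smooth_on D (fun q => F q i j).

Definition cpd (R : realType) (j : 'I_2) (f : 'rV[R]_2 -> R[i])
    (p : 'rV[R]_2) : R[i] :=
  pd j (fun q => complex.Re (f q)) p +i* pd j (fun q => complex.Im (f q)) p.

Definition mxpd (R : realType) (m n : nat) (j : 'I_2)
    (F : 'rV[R]_2 -> 'M[R[i]]_(m, n)) (p : 'rV[R]_2) : 'M[R[i]]_(m, n) :=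
  \matrix_(i, k) cpd j (fun q => F q i k) p.

Definition rmxpd (R : realType) (m n : nat) (j : 'I_2)
    (F : 'rV[R]_2 -> 'M[R]_(m, n)) (p : 'rV[R]_2) : 'M[R]_(m, n) :=
  \matrix_(i, k) pd j (fun q => F q i k) p.

(* The derivatives f_a and f_b, where (a, b) is (z, zbar) or (u, v). *)

Definition dela (R : realType) (c : surface_case) (f : 'rV[R]_2 -> R[i])
    (p : 'rV[R]_2) : R[i] :=
  if conformal c then 2^-1 * (cpd 0 f p - 'i * cpd 1 f p) else cpd 0 f p.

Definition delb (R : realType) (c : surface_case) (f : 'rV[R]_2 -> R[i])
    (p : 'rV[R]_2) : R[i] :=
  if conformal c then 2^-1 * (cpd 0 f p + 'i * cpd 1 f p) else cpd 1 f p.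

Definition mxdela (R : realType) (m n : nat) (c : surface_case)
    (F : 'rV[R]_2 -> 'M[R[i]]_(m, n)) (p : 'rV[R]_2) : 'M[R[i]]_(m, n) :=
  \matrix_(i, j) dela c (fun q => F q i j) p.

Definition mxdelb (R : realType) (m n : nat) (c : surface_case)
    (F : 'rV[R]_2 -> 'M[R[i]]_(m, n)) (p : 'rV[R]_2) : 'M[R[i]]_(m, n) :=
  \matrix_(i, j) delb c (fun q => F q i j) p.

Definition col3 (K : Type) (a b d : 'cV[K]_3) : 'M[K]_3 :=
  \matrix_(i, j) nth a [:: a; b; d] j i 0.

Definition mx3 (K : nmodType) (rows : seq (seq K)) : 'M[K]_3 :=
  \matrix_(i, j) nth 0 (nth [::] rows i) j.

(** Matrix-valued 1-forms *)

(* A 'M_3-valued 1-form is given by its two coefficients with respect to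
   (dx, dy), resp. (du, dv). *)
Definition mx_form (R : realType) := 'I_2 -> 'rV[R]_2 -> 'M[R[i]]_3.

(* Coefficients of the 1-forms da and db: dz = dx + i dy and dzbar = dx - i dy. *)
Definition form_da (R : realType) (c : surface_case) (j : 'I_2) : R[i] :=
  if conformal c then (if j == 0 then 1 else 'i) else (j == 0)%:R.

Definition form_db (R : realType) (c : surface_case) (j : 'I_2) : R[i] :=
  if conformal c then (if j == 0 then 1 else - 'i) else (j == 1)%:R.

(* The coefficient of d alpha + alpha /\ alpha vanishes on D. *)
Definition flat_on (R : realType) (D : set 'rV[R]_2) (A : mx_form R) : Prop :=
  forall p, D p ->
    mxpd 0 (A 1) p - mxpd 1 (A 0) p + (A 0 p *m A 1 p - A 1 p *m A 0 p) = 0.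

Definition maurer_cartan_form (R : realType) (D : set 'rV[R]_2)
    (F : 'rV[R]_2 -> 'M[R[i]]_3) (A : mx_form R) : Prop :=
  forall p, D p -> F p \in unitmx /\ forall j, invmx (F p) *m mxpd j F p = A j p.

(** The 1-forms alpha^lambda *)

(* p = p' in all the cases *)
Definition coef_p (R : realType) (c : surface_case) : R[i] :=
  match c with Aplus => 'i | _ => 1 end.

(* r = r' in all the cases *)
Definition coef_r (R : realType) (c : surface_case) : R[i] :=
  match c with CP => - 1 | Aplus => 'i | _ => 1 end.

Definition coef_q (R : realType) (c : surface_case) (Q : R[i]) : R[i] :=
  match c with CP | CH | T => - Q | Aplus | Aminus | IA => Q end.

Definition coef_s (R : realType) (c : surface_case) (Q Q2 : R[i]) : R[i] :=
  match c with
  | CP | CH | Aplus | Aminus => Q^*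
  | T => - Q2
  | IA => Q2
  end.

Definition Umx (R : realType) (c : surface_case) (omega : 'rV[R]_2 -> R)
    (Q : 'rV[R]_2 -> R[i]) (lam : R[i]) (x : 'rV[R]_2) : 'M[R[i]]_3 :=
  let w := dela c (fun y => (omega y)%:C) x in
  let e := (expR (omega x / 2))%:C in
  let e' := (expR (- omega x))%:C in
  mx3 [:: [:: w / 2; 0; lam^-1 * coef_p R c * e];
          [:: lam^-1 * coef_q c (Q x) * e'; - (w / 2); 0];
          [:: 0; lam^-1 * coef_r R c * e; 0]].

Definition Vmx (R : realType) (c : surface_case) (omega : 'rV[R]_2 -> R)
    (Q Q2 : 'rV[R]_2 -> R[i]) (lam : R[i]) (x : 'rV[R]_2) : 'M[R[i]]_3 :=
  let w := delb c (fun y => (omega y)%:C) x in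
  let e := (expR (omega x / 2))%:C in
  let e' := (expR (- omega x))%:C in
  mx3 [:: [:: - (w / 2); lam * coef_s c (Q x) (Q2 x) * e'; 0];
          [:: 0; w / 2; lam * coef_p R c * e];
          [:: lam * coef_r R c * e; 0; 0]].

Definition alpha (R : realType) (c : surface_case) (omega : 'rV[R]_2 -> R)
    (Q Q2 : 'rV[R]_2 -> R[i]) (lam : R[i]) : mx_form R :=
  fun j x => form_da R c j *: Umx c omega Q lam x
           + form_db R c j *: Vmx c omega Q Q2 lam x.

(* In the order of R[i], 0 < lam says that lam is a positive real. *)
Definition Lambda0 (R : realType) (c : surface_case) : set R[i] :=
  if conformal c then [set lam | `|lam| = 1] else [set lam | 0 < lam].

Definition Gmx (R : realType) (c : surface_case) (lam : R[i]) : 'M[R[i]]_3 :=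
  let k := match c with Aplus => 'i | _ => 1 end in
  mx3 [:: [:: k * lam; 0; 0]; [:: 0; k * lam^-1; 0]; [:: 0; 0; 1]].

(* Q2 stands for the second cubic coefficient, which exists only in the cases
   T and IA; it is unconstrained and irrelevant in the other cases. *)
Definition cubic_coefficients (R : realType) (c : surface_case)
    (D : set 'rV[R]_2) (Q Q2 : 'rV[R]_2 -> R[i]) : Prop :=
  match c with
  | T => [/\ csmooth_on D Q, csmooth_on D Q2
           & forall p, D p -> complex.Re (Q p) = 0 /\ complex.Re (Q2 p) = 0]
  | IA => [/\ csmooth_on D Q, csmooth_on D Q2
           & forall p, D p -> complex.Im (Q p) = 0 /\ complex.Im (Q2 p) = 0]
  | _ => csmooth_on D Q
  end.

(** Minimal Lagrangian surfaces: the cases CP, CH, T *)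

Definition herm (R : realType) (c : surface_case) (a b : 'cV[R[i]]_3) : R[i] :=
  match c with
  | CP => a 0 0 * (b 0 0)^* + a 1 0 * (b 1 0)^* + a 2 0 * (b 2 0)^*
  | T  => a 0 0 * (b 1 0)^* + a 1 0 * (b 0 0)^* - a 2 0 * (b 2 0)^*
  | _  => a 0 0 * (b 0 0)^* + a 1 0 * (b 1 0)^* - a 2 0 * (b 2 0)^*
  end.

(* <a, a> = quadric_level for a in S^5, H^5_1, H^5_3 respectively. *)
Definition quadric_level (R : realType) (c : surface_case) : R[i] :=
  match c with CP => 1 | _ => - 1 end.

(* CP^2, CH^2, CH^2_1 are sets of complex lines in C^3, so that a map into one
   of them is a map f to {vspace 'cV_3}, and the projection sends a to the line
   <[a]>.  [is_lift] says that F is a smooth lift of f on U to S^5, H^5_1, H^5_3. *)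
Definition is_lift (R : realType) (c : surface_case) (U : set 'rV[R]_2)
    (f : 'rV[R]_2 -> {vspace 'cV[R[i]]_3}) (F : 'rV[R]_2 -> 'cV[R[i]]_3) : Prop :=
  mxsmooth_on U F /\
  forall p, U p -> herm c (F p) (F p) = quadric_level R c /\ f p = <[F p]>%VS.

(* Component of w orthogonal to the line spanned by F p. *)
Definition hor (R : realType) (c : surface_case) (F : 'rV[R]_2 -> 'cV[R[i]]_3)
    (p : 'rV[R]_2) (w : 'cV[R[i]]_3) : 'cV[R[i]]_3 :=
  w - (herm c w (F p) / herm c (F p) (F p)) *: F p.

(* Horizontal vector at F p that projects to the coordinate tangent vector
   d_j f of f = <[F]>. *)
Definition tangent (R : realType) (c : surface_case) (F : 'rV[R]_2 -> 'cV[R[i]]_3)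
    (j : 'I_2) (p : 'rV[R]_2) : 'cV[R[i]]_3 :=
  hor c F p (mxpd j F p).

Definition induced_metric (R : realType) (c : surface_case)
    (F : 'rV[R]_2 -> 'cV[R[i]]_3) (p : 'rV[R]_2) : 'M[R]_2 :=
  \matrix_(i, j) complex.Re (herm c (tangent c F i p) (tangent c F j p)).

(* Covariant derivative along f, in the direction d_j and for the Levi-Civita
   connection of the projective space, of the vector field along f represented
   by the F-horizontal field W.  The second term corrects for the vertical part
   of d_j F; it makes the result compatible with F -> e^{i theta} F. *)
Definition covd (R : realType) (c : surface_case) (F : 'rV[R]_2 -> 'cV[R[i]]_3)
    (j : 'I_2) (W : 'rV[R]_2 -> 'cV[R[i]]_3) (p : 'rV[R]_2) : 'cV[R[i]]_3 :=
  hor c F p (mxpd j W p)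
  - (herm c (mxpd j F p) (F p) / herm c (F p) (F p)) *: W p.

Definition normal_vector (R : realType) (c : surface_case)
    (F : 'rV[R]_2 -> 'cV[R[i]]_3) (p : 'rV[R]_2) (w : 'cV[R[i]]_3) : Prop :=
  herm c w (F p) = 0 /\ forall j, complex.Re (herm c w (tangent c F j p)) = 0.

(* Component along w of the second fundamental form. *)
Definition second_form (R : realType) (c : surface_case)
    (F : 'rV[R]_2 -> 'cV[R[i]]_3) (p : 'rV[R]_2) (w : 'cV[R[i]]_3) : 'M[R]_2 :=
  \matrix_(i, j) complex.Re (herm c (covd c F i (tangent c F j) p) w).

(* Pull-back of the Kaehler form vanishes. *)
Definition lagrangian_at (R : realType) (c : surface_case)
    (F : 'rV[R]_2 -> 'cV[R[i]]_3) (p : 'rV[R]_2) : Prop :=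
  complex.Im (herm c (tangent c F 0 p) (tangent c F 1 p)) = 0.

(* The mean curvature vector, i.e. half the trace of the second fundamental
   form with respect to the induced metric, vanishes. *)
Definition minimal_at (R : realType) (c : surface_case)
    (F : 'rV[R]_2 -> 'cV[R[i]]_3) (p : 'rV[R]_2) : Prop :=
  forall w, normal_vector c F p w ->
    \tr (invmx (induced_metric c F p) *m second_form c F p w) = 0.

(* Conformal coordinates (with a positive definite induced metric), resp. null
   coordinates (with a Lorentzian one); in particular f is an immersion. *)
Definition special_coordinates_at (R : realType) (c : surface_case)
    (F : 'rV[R]_2 -> 'cV[R[i]]_3) (p : 'rV[R]_2) : Prop :=
  let g := induced_metric c F p in
  if conformal c then [/\ 0 < g 0 0, g 0 0 = g 1 1 & g 0 1 = 0]
  else [/\ g 0 0 = 0, g 1 1 = 0 & 0 < g 0 1].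

Definition minimal_lagrangian (R : realType) (c : surface_case)
    (D : set 'rV[R]_2) (f : 'rV[R]_2 -> {vspace 'cV[R[i]]_3}) : Prop :=
  forall p, D p -> exists (U : set 'rV[R]_2) (F : 'rV[R]_2 -> 'cV[R[i]]_3),
    [/\ open U, U p, U `<=` D, is_lift c U f F
      & forall q, U q -> [/\ special_coordinates_at c F q, lagrangian_at c F q
                           & minimal_at c F q]].

Definition horizontal_lift (R : realType) (c : surface_case) (D : set 'rV[R]_2)
    (f : 'rV[R]_2 -> {vspace 'cV[R[i]]_3}) (F : 'rV[R]_2 -> 'cV[R[i]]_3) : Prop :=
  is_lift c D f F /\ forall p j, D p -> herm c (mxpd j F p) (F p) = 0.

Definition lift_metric_function (R : realType) (c : surface_case)
    (D : set 'rV[R]_2) (F : 'rV[R]_2 -> 'cV[R[i]]_3) (omega : 'rV[R]_2 -> R) : Prop :=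
  forall p, D p ->
    let Fa := mxdela c F p in
    let Fb := mxdelb c F p in
    let e := (expR (omega p))%:C in
    if conformal c then
      [/\ herm c Fa Fa = e, herm c Fb Fb = e & herm c Fa Fb = 0]
    else [/\ herm c Fa Fa = 0, herm c Fb Fb = 0 & herm c Fa Fb = e].

Definition lift_cubic (R : realType) (c : surface_case) (D : set 'rV[R]_2)
    (F : 'rV[R]_2 -> 'cV[R[i]]_3) (Q Q2 : 'rV[R]_2 -> R[i]) : Prop :=
  forall p, D p ->
    herm c (iter 3 (mxdela c) F p) (F p) = Q p /\
    (~~ conformal c -> herm c (iter 3 (mxdelb c) F p) (F p) = Q2 p).

Definition lift_frame (R : realType) (c : surface_case) (omega : 'rV[R]_2 -> R)
    (F : 'rV[R]_2 -> 'cV[R[i]]_3) (p : 'rV[R]_2) : 'M[R[i]]_3 :=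
  let e := (expR (- (omega p / 2)))%:C in
  col3 (e *: mxdela c F p) (e *: mxdelb c F p) (F p).

Definition lagrangian_associated_family (R : realType) (c : surface_case)
    (D : set 'rV[R]_2) (omega : 'rV[R]_2 -> R) (Q Q2 : 'rV[R]_2 -> R[i])
    (f : 'rV[R]_2 -> {vspace 'cV[R[i]]_3}) : Prop :=
  exists fam : R[i] -> 'rV[R]_2 -> {vspace 'cV[R[i]]_3}, fam 1 = f /\
    forall lam, Lambda0 c lam -> minimal_lagrangian c D (fam lam) /\
      exists F : 'rV[R]_2 -> 'cV[R[i]]_3,
        [/\ horizontal_lift c D (fam lam) F,
            lift_metric_function c D F omega,
            lift_cubic c D F (fun p => lam ^- 3 * Q p) (fun p => lam ^+ 3 * Q2 p),
            forall p, D p -> \det (lift_frame c omega F p) = 1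
          & maurer_cartan_form D (fun p => lift_frame c omega F p *m Gmx c lam)
              (alpha c omega Q Q2 lam)].

(** Proper affine spheres: the cases A+, A-, iA *)

Definition mean_curvature (R : realType) (c : surface_case) : R :=
  match c with Aplus => 1 | _ => - 1 end.

(* xi is the affine (Blaschke) normal of the immersion f, with affine metric h:
   f_ij = (tangential part) + h_ij xi, the derivatives of xi are tangential,
   and the volume of h is det[., ., xi].  Tangency of v is written as
   det[f_0, f_1, v] = 0, where det[f_0, f_1, xi] <> 0. *)
Definition affine_normal_at (R : realType) (f xi : 'rV[R]_2 -> 'cV[R]_3)
    (h : 'M[R]_2) (p : 'rV[R]_2) : Prop :=
  let f0 := rmxpd 0 f p in
  let f1 := rmxpd 1 f p in
  [/\ \det (col3 f0 f1 (xi p)) != 0,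
      forall i j : 'I_2,
        \det (col3 f0 f1 (rmxpd i (rmxpd j f) p - h i j *: xi p)) = 0,
      forall j : 'I_2, \det (col3 f0 f1 (rmxpd j xi p)) = 0
    & \det (col3 f0 f1 (xi p)) ^+ 2 = `|\det h|].

(* Definite (with positive definite affine metric) in the cases A+, A-, and
   indefinite in the case iA; the affine mean curvature is H and the center is
   0, i.e. the affine normal is - H f. *)
Definition affine_sphere (R : realType) (c : surface_case) (D : set 'rV[R]_2)
    (f : 'rV[R]_2 -> 'cV[R]_3) : Prop :=
  rmxsmooth_on D f /\
  forall p, D p -> exists h : 'M[R]_2,
    affine_normal_at f (fun q => - mean_curvature R c *: f q) h p /\
    (if conformal c then 0 < h 0 0 /\ 0 < \det h else \det h < 0).

Definition complexify (R : realType) (f : 'rV[R]_2 -> 'cV[R]_3)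
    (p : 'rV[R]_2) : 'cV[R[i]]_3 :=
  map_mx (real_complex R) (f p).

(* Affine-conformal, resp. null, coordinates with metric function omega. *)
Definition affine_metric_function (R : realType) (c : surface_case)
    (D : set 'rV[R]_2) (f : 'rV[R]_2 -> 'cV[R]_3) (omega : 'rV[R]_2 -> R) : Prop :=
  let fa := mxdela c (complexify f) in
  let fb := mxdelb c (complexify f) in
  forall p, D p ->
    [/\ \det (col3 (fa p) (fb p) (mxdela c fa p)) = 0,
        \det (col3 (fa p) (fb p) (mxdelb c fb p)) = 0,
        \det (col3 (fa p) (fb p) (mxdelb c fa p))
          = (if conformal c then 'i else 1) * (expR (2 * omega p))%:C
      & (expR (- omega p))%:C *: mxdelb c fa p
          = - (mean_curvature R c)%:C *: complexify f p].

Definition affine_cubic (R : realType) (c : surface_case) (D : set 'rV[R]_2)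
    (f : 'rV[R]_2 -> 'cV[R]_3) (omega : 'rV[R]_2 -> R)
    (Q Q2 : 'rV[R]_2 -> R[i]) : Prop :=
  let fa := mxdela c (complexify f) in
  let fb := mxdelb c (complexify f) in
  let om := fun q => (omega q)%:C in
  forall p, D p ->
    mxdela c fa p = dela c om p *: fa p + (Q p * (expR (- omega p))%:C) *: fb p /\
    (~~ conformal c ->
     mxdelb c fb p = delb c om p *: fb p + (Q2 p * (expR (- omega p))%:C) *: fa p).

Definition affine_frame (R : realType) (c : surface_case) (omega : 'rV[R]_2 -> R)
    (f : 'rV[R]_2 -> 'cV[R]_3) (p : 'rV[R]_2) : 'M[R[i]]_3 :=
  let fa := mxdela c (complexify f) in
  let fb := mxdelb c (complexify f) in
  let e := (expR (- (omega p / 2)))%:C in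
  col3 (e *: fa p) (e *: fb p) ((expR (- omega p))%:C *: mxdelb c fa p).

Definition affine_associated_family (R : realType) (c : surface_case)
    (D : set 'rV[R]_2) (omega : 'rV[R]_2 -> R) (Q Q2 : 'rV[R]_2 -> R[i])
    (f : 'rV[R]_2 -> 'cV[R]_3) : Prop :=
  exists fam : R[i] -> 'rV[R]_2 -> 'cV[R]_3, fam 1 = f /\
    forall lam, Lambda0 c lam ->
      [/\ affine_sphere c D (fam lam),
          affine_metric_function c D (fam lam) omega,
          affine_cubic c D (fam lam) omega
            (fun p => lam ^- 3 * Q p) (fun p => lam ^+ 3 * Q2 p)
        & maurer_cartan_form D (fun p => affine_frame c omega (fam lam) p *m Gmx c lam)
            (alpha c omega Q Q2 lam)].

Definition extended_maurer_cartan (R : realType) (c : surface_case)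
    (D : set 'rV[R]_2) (omega : 'rV[R]_2 -> R) (Q Q2 : 'rV[R]_2 -> R[i]) : Prop :=
  match c with
  | CP | CH | T => exists f, lagrangian_associated_family c D omega Q Q2 f
  | Aplus | Aminus | IA => exists f, affine_associated_family c D omega Q Q2 f
  end.

(* Main.v *)
(* The equations of a surface of the class say that its frame, multiplied by
   [Gmx], has logarithmic derivatives alpha, and equality of the mixed second
   derivatives of the frame is flatness of alpha.

   Conversely let alpha be flat.  Picard iteration and uniqueness solve
   dF = F alpha on small squares, and the solutions continue along homotopies to
   the whole domain, since it is simply connected.  The frame h = F Gmx^-1 solves
   an equation dh = h beta in which the powers of lambda occur only through the
   cubic coefficients.  As lambda is in Lambda0, beta has a symmetry.  In the
   cases CP, CH, T it lies in the Lie algebra of the isometry group of a Hermitian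
   matrix J, so h^* J h is constant, and it is J if h = 1 at one point.  In the
   other cases h and its conjugate, with the first two columns exchanged in the
   conformal cases, solve the same equation, hence agree if they do at one point,
   and the third column is real.  The surface is the third column, up to sign, and
   all its properties are read off from dh = h beta. *)

Require Import Defs.
From mathcomp Require Import all_boot all_order all_algebra.
From mathcomp Require Import all_classical all_reals all_analysis.
From mathcomp Require Import complex ring lra.

Set Implicit Arguments.
Unset Strict Implicit.
Unset Printing Implicit Defensive.

Import Order.TTheory GRing.Theory Num.Theory.
Import numFieldNormedType.Exports.

Local Open Scope classical_set_scope.
Local Open Scope complex_scope.
Local Open Scope ring_scope.

(** * Frobenius theorem on a square *)

(** Smoothness here means iterated partial derivatives along the two axes, so the analysis is built
    from one-variable primitives, Fubini for them and mean value bounds; even the symmetry of second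
    derivatives is obtained that way. Coefficients are extended from a square by clamping the
    coordinates, so that continuity and sup bounds hold on the whole plane. Complex systems become
    real ones of twice the size.

    A solution is first found on a square whose size depends on the coefficients. The passage to [D]
    is kept apart from the analysis: only the algebraic compatibility of invertible local frames
    enters. Invertibility comes from solving the dual equation, for [- A^T], along with the one for
    [A].

    The six cases share one computation, because [has_ab] treats z, zbar and u, v alike; they differ
    in the signs [gauged_p], [gauged_r], those of the cubic terms, and in the reality conditions.
    The initial value of the frame carries the normalisation: 1 has Gram matrix [Jmx c], and
    [initial_frame] is real in the appropriate sense and has the prescribed determinant. Frames for
    different [lam] are found separately and assembled by choice. *)

Section Primitive.
Context {R : realType}.
Implicit Types (f g : R -> R).

Lemma is_derive_continuous f (df x : R) : is_derive x 1 f df -> {for x, continuous f}.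
Proof.
move=> h; apply: differentiable_continuous; apply/derivable1_diffP.
by case: h.
Qed.

Lemma mvt_bound f (df : R -> R) (r C x : R) :
  (forall y : R, `|y| < r -> is_derive y 1 f (df y)) ->
  (forall y : R, `|y| < r -> `|df y| <= C) -> `|x| < r -> `|f x - f 0| <= C * `|x|.
Proof.
move=> fd fC xr.
have r0 : 0 < r by apply: le_lt_trans xr.
have key a b : a <= b -> `|a| < r -> `|b| < r -> `|f b - f a| <= C * (b - a).
  move=> ab; rewrite !ltr_norml => /andP[ra ar] /andP[rb br].
  have inr y : a <= y -> y <= b -> `|y| < r.
    by move=> ay yb; rewrite ltr_norml; apply/andP; split; lra.
  have dab (y : R) : y \in `]a, b[%R -> is_derive y 1 f (df y).
    by rewrite in_itv/= => /andP[/ltW ay /ltW yb]; apply/fd/inr.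
  have cab : {within `[a, b], continuous f}.
    apply: continuous_in_subspaceT => y; rewrite mem_setE in_itv/= => /andP[ay yb].
    by apply: is_derive_continuous; apply/fd/inr.
  have [c] := MVT_segment ab dab cab; rewrite in_itv/= => /andP[ac cb] ->.
  rewrite normrM [`|b - a|]ger0_norm ?subr_ge0//.
  by apply: ler_wpM2r; [rewrite subr_ge0 | exact/fC/inr].
have r0' : `|0 : R| < r by rewrite normr0.
have [x0|x0] := leP 0 x.
  by have := key 0 x x0 r0' xr; rewrite subr0 (ger0_norm x0).
by have := key x 0 (ltW x0) xr r0'; rewrite sub0r distrC (ltr0_norm x0).
Qed.

Lemma is_derive_unique f g (dfg : R -> R) (r x : R) :
  (forall y : R, `|y| < r -> is_derive y 1 f (dfg y)) ->
  (forall y : R, `|y| < r -> is_derive y 1 g (dfg y)) ->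
  f 0 = g 0 -> `|x| < r -> f x = g x.
Proof.
move=> fd gd fg xr.
have d (y : R) : `|y| < r -> is_derive y 1 (fun z => f z - g z) (dfg y - dfg y).
  by move=> yr; have ? := fd y yr; have ? := gd y yr; exact: is_deriveB.
have := @mvt_bound (fun z => f z - g z) (fun y => dfg y - dfg y) r 0 x d.
rewrite mul0r fg subrr subr0 => h; apply/eqP; rewrite -subr_eq0 -normr_le0.
by apply: h => // y _; rewrite subrr normr0.
Qed.

(** The integral starts at [- r], so that 0 and every [x] with [|x| < r] are interior and the
    derivative there is two-sided; subtracting [F 0] restores the base point. *)
Lemma local_primitive g (r : R) : continuous g -> 0 < r ->
  exists G : R -> R, G 0 = 0 /\ forall x : R, `|x| < r -> is_derive x 1 G (g x).
Proof.
move=> gc r0.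
pose F x := (\int[lebesgue_measure]_(t in `[(- r)%R, x]) g t)%R.
exists (fun x => F x - F 0); split; first by rewrite subrr.
move=> x; rewrite ltr_norml => /andP[rx xr].
have [] := @continuous_FTC1_closed R g (- r) x r xr.
- apply: continuous_compact_integrable; first exact: segment_compact.
  exact: continuous_subspaceT.
- exact: rx.
- exact: gc.
move=> dF Fx.
have h : is_derive x 1 F (g x).
  by apply: DeriveDef; [exact: dF|rewrite -derive1E; exact: Fx].
by rewrite -[g x]subr0; apply: is_deriveB.
Qed.

Lemma primitive_exists g : continuous g ->
  exists G : R -> R, G 0 = 0 /\ forall x : R, is_derive x 1 G (g x).
Proof.
move=> gc.
have ex (n : nat) : {G : R -> R | G 0 = 0 /\
    forall x : R, `|x| < n.+1%:R -> is_derive x 1 G (g x)}.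
  by apply: cid; apply: local_primitive.
pose G n := sval (ex n).
have G0 n : G n 0 = 0 by rewrite /G; case: (ex n) => ? [].
have Gd n (x : R) : `|x| < n.+1%:R -> is_derive x 1 (G n) (g x).
  by rewrite /G; case: (ex n) => ? [] ? /=; exact.
have GE m n x : (m <= n)%N -> `|x| < m.+1%:R -> G m x = G n x.
  move=> mn xm; apply: (@is_derive_unique _ _ g m.+1%:R) => //.
  - by move=> y ym; apply: Gd; apply: lt_le_trans ym _; rewrite ler_nat.
  - by rewrite !G0.
(* The primitives on the intervals of radius [n.+1] agree by uniqueness; at [x] the one on the first
   such interval containing [x] is taken. *)
pose N (x : R) := Num.truncn `|x|.
have NP x : `|x| < (N x).+1%:R by apply: truncnS_gt.
have GN m x : `|x| < m.+1%:R -> G (N x) x = G m x.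
  by move=> xm; have [/GE->|/ltnW/GE->] := leqP (N x) m.
exists (fun x => G (N x) x); split; first exact: G0.
move=> x; apply: (@near_eq_is_derive _ _ _ (G (N x))); last exact/Gd/NP.
have : \forall y \near x, `|y| < (N x).+1%:R.
  by apply: (cvgr_lt `|x| (@norm_continuous _ _ x)); exact: NP.
by apply: filterS => y /GN.
Qed.

(** Total, with value 0 for discontinuous [g], so that primitives can be nested without continuity
    proofs inside the terms. *)
Definition prim g : R -> R :=
  if pselect (continuous g) is left gc then sval (cid (primitive_exists gc)) else cst 0.

Lemma prim0 g : prim g 0 = 0.
Proof. by rewrite /prim; case: pselect => // gc; case: cid => ? []. Qed.

Lemma prim_derive g (x : R) : continuous g -> is_derive x 1 (prim g) (g x).
Proof. by rewrite /prim; case: pselect => // gc _; case: cid => ? [? ] /=. Qed.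

Lemma prim_unique g (G : R -> R) r x : continuous g ->
  (forall y : R, `|y| < r -> is_derive y 1 G (g y)) -> `|x| < r ->
  G x - G 0 = prim g x.
Proof.
move=> gc Gd xr; apply: (@is_derive_unique (fun y => G y - G 0) (prim g) g r) => //.
- by move=> y /Gd h; rewrite -[g y]subr0; apply: is_deriveB.
- by move=> y _; exact: prim_derive.
- by rewrite subrr prim0.
Qed.

Lemma prim_bound g (r C x : R) : continuous g ->
  (forall y : R, `|y| < r -> `|g y| <= C) -> `|x| < r -> `|prim g x| <= C * `|x|.
Proof.
move=> gc gC xr; rewrite -[prim g x]subr0 -(prim0 g).
by apply: (@mvt_bound _ g r) => // y _; exact: prim_derive.
Qed.

Lemma primD f g x : continuous f -> continuous g ->
  prim (fun y => f y + g y) x = prim f x + prim g x.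
Proof.
move=> fc gc; have h : continuous (fun y => f y + g y).
  by move=> y; apply: continuousD; [exact: fc|exact: gc].
have d (y : R) : is_derive y 1 (fun y => prim f y + prim g y) (f y + g y).
  by have ? := prim_derive y fc; have ? := prim_derive y gc; exact: is_deriveD.
have /= <- := @prim_unique _ _ (`|x| + 1) x h (fun y _ => d y).
  by rewrite !prim0 addr0 subr0.
by rewrite ltrDl.
Qed.

Lemma primZ (k : R) g x : continuous g -> prim (fun y => k * g y) x = k * prim g x.
Proof.
move=> gc; have h : continuous (fun y => k * g y).
  by move=> y; apply: continuousM; [exact: cst_continuous|exact: gc].
have d (y : R) : is_derive y 1 (fun y => k * prim g y) (k * g y).
  by have ? := prim_derive y gc; exact: (@is_deriveZ _ _ _ (prim g) k).
have /= <- := @prim_unique _ _ (`|x| + 1) x h (fun y _ => d y).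
  by rewrite !prim0 mulr0 subr0.
by rewrite ltrDl.
Qed.

Lemma primB f g x : continuous f -> continuous g ->
  prim (fun y => f y - g y) x = prim f x - prim g x.
Proof.
move=> fc gc; have h (k : R) : continuous (fun y => k * g y).
  by move=> y; apply: continuousM; [exact: cst_continuous|exact: gc].
rewrite -[- prim g x]mulN1r -primZ// -primD//.
by congr prim; apply/funext => y; rewrite mulN1r.
Qed.

End Primitive.

Lemma pair_continuous (T U V : topologicalType) (f : T -> U) (g : T -> V) (x : T) :
  {for x, continuous f} -> {for x, continuous g} ->
  {for x, continuous (fun y => (f y, g y))}.
Proof. by move=> fc gc; exact: cvg_pair fc gc. Qed.

Lemma near_fst (U V : topologicalType) (P : U -> Prop) (x : U) (y : V) :
  (\forall u \near x, P u) -> \forall q \near (x, y), P q.1.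
Proof. by move=> h; exact: (@cvg_fst U V (nbhs x) (nbhs y) _ P h). Qed.

Lemma near_snd (U V : topologicalType) (P : V -> Prop) (x : U) (y : V) :
  (\forall v \near y, P v) -> \forall q \near (x, y), P q.2.
Proof. by move=> h; exact: (@cvg_snd U V (nbhs x) (nbhs y) _ P h). Qed.

Section Continuity.
Context {R : realType} {T : topologicalType}.
Implicit Types f g : T -> R.

Lemma contD f g : continuous f -> continuous g -> continuous (fun x => f x + g x).
Proof. by move=> fc gc x; apply: continuousD; [exact: fc|exact: gc]. Qed.

Lemma contB f g : continuous f -> continuous g -> continuous (fun x => f x - g x).
Proof. by move=> fc gc x; apply: continuousB; [exact: fc|exact: gc]. Qed.

Lemma contM f g : continuous f -> continuous g -> continuous (fun x => f x * g x).
Proof. by move=> fc gc x; apply: continuousM; [exact: fc|exact: gc]. Qed.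

Lemma contZ (k : R) g : continuous g -> continuous (fun x => k * g x).
Proof. by move=> gc; apply: contM => // x; exact: cst_continuous. Qed.

Lemma cont_sum (I : Type) (r : seq I) (F : I -> T -> R) :
  (forall i, continuous (F i)) -> continuous (fun x => \sum_(i <- r) F i x).
Proof.
move=> Fc; elim: r => [|i r IH].
  by under eq_fun do rewrite big_nil; move=> x; exact: cst_continuous.
by under eq_fun do rewrite big_cons; exact: contD.
Qed.

End Continuity.

(** * Primitives in the plane and Fubini's theorem *)

Section Plane.
Context {R : realType}.
Implicit Types (f g : R * R -> R) (q : R * R).

Lemma is_derive_eps (f : R -> R) (x d : R) :
  (forall e : R, 0 < e -> \forall h \near 0, `|f (x + h) - f x - d * h| <= e * `|h|) ->
  is_derive x 1 f d.
Proof.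
move=> H.
have L : (fun h : R => h^-1 *: ((f \o shift x) (h *: 1) - f x)) @ 0^' --> d.
  apply/cvgrPdist_le => e e0; rewrite near_withinE.
  near=> h => h0; have := near (H e e0) h.
  rewrite /= /shift/= scaler1 [h + x]addrC => /(_ _) hh.
  have {}hh : `|f (x + h) - f x - d * h| <= e * `|h| by near: h; exact: H.
  rewrite -(ler_pM2r (_ : 0 < `|h|)) ?normr_gt0//; apply: le_trans hh.
  rewrite -normrM distrC /GRing.scale/= mulrBl mulrAC mulVf// mul1r.
  by [].
by apply: DeriveDef; [apply/cvg_ex; exists d | apply: (cvg_lim _ L)].
Unshelve. all: by end_near. Qed.

Lemma is_derive_addr (f : R -> R) (k y d : R) :
  is_derive (k + y) 1 f d -> is_derive k 1 (fun t => f (t + y)) d.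
Proof.
move=> fd; rewrite -[d]mulr1.
exact: (@is_derive1_comp _ f (shift y) k d 1 fd (is_derive_shift k 1 y)).
Qed.

Lemma continuous_slicel g (y : R) : continuous g -> continuous (fun s => g (s, y)).
Proof.
move=> gc s; apply: (@continuous_comp _ _ _ (fun s : R => (s, y)) g); last exact: gc.
by apply: pair_continuous; [exact: cvg_id|exact: cvg_cst].
Qed.

Lemma continuous_slicer g (x : R) : continuous g -> continuous (fun t => g (x, t)).
Proof.
move=> gc t; apply: (@continuous_comp _ _ _ (fun t : R => (x, t)) g); last exact: gc.
by apply: pair_continuous; [exact: cvg_cst|exact: cvg_id].
Qed.

(** Compactness of the segment turns continuity at each point [(s, y0)] into an estimate uniform in
    [s]. *)
Lemma tube g (y0 r e : R) : continuous g -> 0 < e ->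
  \forall y \near y0, forall s, `|s| <= r -> `|g (s, y) - g (s, y0)| < e.
Proof.
move=> gc e0.
have /compact_near_coveringP : compact `[- r, r]%classic by exact: segment_compact.
move=> /(_ R (nbhs y0) (fun y s => `|g (s, y) - g (s, y0)| < e)) H.
apply: filterS (H _ _).
  move=> y yP s; rewrite ler_norml => sr; apply: yP.
  by rewrite /= in_itv.
move=> s _.
have e20 : 0 < e / 2 by lra.
have /cvgrPdist_lt/(_ _ e20) h1 := gc (s, y0).
have /cvgrPdist_lt/(_ _ e20) h2 := @continuous_slicel g y0 gc s.
have h2' : \forall q \near (s, y0), `|g (s, y0) - g (q.1, y0)| < e / 2.
  by apply: (near_fst (P := fun u => `|g (s, y0) - g (u, y0)| < e / 2)) h2.
near=> q => /=.
have a : `|g (s, y0) - g (q.1, q.2)| < e / 2 by rewrite -surjective_pairing; near: q.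
have b : `|g (s, y0) - g (q.1, y0)| < e / 2 by near: q.
rewrite -(subrKA (g (s, y0))); apply: le_lt_trans (ler_normD _ _) _.
by rewrite distrC; lra.
Unshelve. all: by end_near. Qed.

Definition PX g q := prim (fun s => g (s, q.2)) q.1.
Definition PY g q := prim (fun t => g (q.1, t)) q.2.

Lemma PX_derive g (x y : R) : continuous g ->
  is_derive x 1 (fun s => PX g (s, y)) (g (x, y)).
Proof. by move=> gc; exact: (prim_derive x (@continuous_slicel g y gc)). Qed.

Lemma PY_derive g (x y : R) : continuous g ->
  is_derive y 1 (fun t => PY g (x, t)) (g (x, y)).
Proof. by move=> gc; exact: (prim_derive y (@continuous_slicer g x gc)). Qed.

(** In the direction of integration [PX g] is even derivable; in the transverse direction [tube]
    makes the integrands uniformly close, and the length of the path of integration is at most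
    [r]. *)
Lemma PX_continuous g : continuous g -> continuous (PX g).
Proof.
move=> gc [x0 y0]; apply/cvgrPdist_lt => e e0.
pose r := `|x0| + 1.
have r0 : 0 < r by rewrite /r; have := normr_ge0 x0; lra.
have er : 0 < e / (2 * r) by apply: divr_gt0 => //; lra.
have T := @tube g y0 r _ gc er.
have /cvgrPdist_lt/(_ (e / 2)) : {for x0, continuous (fun s => PX g (s, y0))}.
  by apply: is_derive_continuous; exact: PX_derive.
move=> /(_ ltac:(lra)) X.
have N : \forall x \near x0, `|x| < r.
  by apply: (cvgr_lt `|x0| (@norm_continuous _ _ x0)); rewrite ltrDl.
have X' : \forall q \near (x0, y0), `|PX g (x0, y0) - PX g (q.1, y0)| < e / 2.
  by apply: (near_fst (P := fun u => `|PX g (x0, y0) - PX g (u, y0)| < e / 2)) X.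
have N' : \forall q \near (x0, y0), `|q.1| < r by apply: (near_fst (P := fun u => `|u| < r)) N.
have T' : \forall q \near (x0, y0), forall s, `|s| <= r -> `|g (s, q.2) - g (s, y0)| < e / (2 * r).
  by apply: (near_snd (P := fun u => forall s, `|s| <= r -> `|g (s, u) - g (s, y0)| < e / (2 * r))) T.
near=> q.
have a : `|PX g (x0, y0) - PX g (q.1, y0)| < e / 2 by near: q.
have b : `|q.1| < r by near: q.
have c : forall s, `|s| <= r -> `|g (s, q.2) - g (s, y0)| < e / (2 * r) by near: q.
have d : `|PX g q - PX g (q.1, y0)| <= e / 2.
  rewrite /PX /= -primB; [|exact: continuous_slicel..].
  apply: (@le_trans _ _ (e / (2 * r) * `|q.1|)).
    apply: (@prim_bound _ _ r) => //.
      by move=> s; apply: continuousB; exact: continuous_slicel.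
    by move=> s sr; apply/ltW/c/ltW.
  have -> : e / 2 = e / (2 * r) * r by field; lra.
  by apply: ler_wpM2l; exact: ltW.
rewrite -(subrKA (PX g (q.1, y0))); apply: le_lt_trans (ler_normD _ _) _.
by rewrite (distrC _ (PX g q)); lra.
Unshelve. all: by end_near. Qed.

Definition swap q := (q.2, q.1).

Lemma swap_continuous : continuous swap.
Proof. by move=> [x y]; apply: pair_continuous; [exact: cvg_snd|exact: cvg_fst]. Qed.

Lemma PY_continuous g : continuous g -> continuous (PY g).
Proof.
move=> gc q; have -> : PY g = PX (g \o swap) \o swap by [].
apply: continuous_comp; first exact: swap_continuous.
apply: PX_continuous => z; apply: continuous_comp; first exact: swap_continuous.
exact: gc.
Qed.

(** Differentiation under the integral sign: as a function of [y], the left side has derivative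
    [PX g (x, y)] and vanishes at [y = 0], so it is the primitive on the right. *)
Lemma Fubini_PXPY g q : continuous g -> PX (PY g) q = PY (PX g) q.
Proof.
move=> gc; case: q => x y.
have PYc := PY_continuous gc.
have D (y0 : R) : is_derive y0 1 (fun t => PX (PY g) (x, t)) (PX g (x, y0)).
  apply: is_derive_eps => e e0.
  pose r := `|x| + 1.
  have r0 : 0 < r by rewrite /r; have := normr_ge0 x; lra.
  have er : 0 < e / r by apply: divr_gt0.
  have /nbhs_ballP[d /= d0 dP] := @tube g y0 r _ gc er.
  have : \forall h \near (0 : R), `|h| < d by exact: nbhs0_lt.
  apply: filterS => h hd.
  have c1 (t : R) : continuous (fun s => PY g (s, t)) by exact: continuous_slicel.
  have c2 : continuous (fun s => PY g (s, y0 + h) - PY g (s, y0)).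
    exact: (contB (c1 _) (c1 _)).
  have c3 : continuous (fun s => g (s, y0)) by exact: continuous_slicel.
  have c4 : continuous (fun s => h * g (s, y0)).
    exact: (contZ (k := h) c3).
  have c5 : continuous (fun s => PY g (s, y0 + h) - PY g (s, y0) - h * g (s, y0)).
    exact: (contB c2 c4).
  rewrite /PX /= -primB// mulrC -primZ// -primB//.
  apply: (@le_trans _ _ (e / r * `|h| * `|x|)).
    apply: (@prim_bound _ _ r) => //; last by rewrite ltrDl.
    move=> s sr.
    (* The remainder of the first-order expansion of [PY g (s, _)] at [y0]; its derivative
       [g (s, k + y0) - g (s, y0)] is small uniformly in [s] by [tube]. *)
    have := @mvt_bound _ (fun k => PY g (s, k + y0) - k * g (s, y0))
      (fun k => g (s, k + y0) - 1 * g (s, y0)) d (e / r) h.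
    rewrite add0r mul0r subr0 addrAC [y0 + h]addrC; apply => //.
    - move=> k _; apply: is_deriveB.
        by apply: (@is_derive_addr (fun t => PY g (s, t))); exact: PY_derive.
      rewrite mulrC; under eq_fun do rewrite mulrC.
      exact: (@is_deriveZ _ _ _ id (g (s, y0))).
    - move=> k kd; rewrite mul1r; apply/ltW/dP => //=; last exact: ltW.
      by rewrite /ball/= opprD addrCA subrr addr0 normrN.
  rewrite mulrAC; apply: ler_wpM2r => //.
  rewrite mulrAC ler_pdivrMr//; apply: ler_wpM2l; first exact: ltW.
  by rewrite lerDl.
transitivity (PX (PY g) (x, y) - PX (PY g) (x, 0)).
  rewrite [X in _ - X]/PX /=; have -> : (fun s => PY g (s, 0)) = (fun s => 0 * 0).
    by apply/funext => s; rewrite /PY /= prim0 mul0r.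
  by rewrite primZ ?mul0r ?subr0//; move=> s; exact: cst_continuous.
have h : continuous (fun t => PX g (x, t)) by exact/continuous_slicer/PX_continuous.
apply: (@prim_unique _ _ (fun t => PX (PY g) (x, t)) (`|y| + 1) y h); last by rewrite ltrDl.
Qed.

(** The differential identities to be integrated hold only inside the square, whereas both
    integrands are continuous everywhere. *)
Lemma PX_ext f g (r x y : R) : continuous f -> continuous g -> `|x| < r ->
  (forall s, `|s| < r -> f (s, y) = g (s, y)) -> PX f (x, y) = PX g (x, y).
Proof.
move=> fc gc xr fg; rewrite -[LHS]subr0 -(prim0 (fun s => f (s, y))).
have h : continuous (fun s => g (s, y)) by exact: continuous_slicel.
apply: (@prim_unique _ _ (fun s => PX f (s, y)) r x h) => // s sr.
by rewrite -fg//; exact: PX_derive.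
Qed.

Lemma PY_ext f g (r x y : R) : continuous f -> continuous g -> `|y| < r ->
  (forall t, `|t| < r -> f (x, t) = g (x, t)) -> PY f (x, y) = PY g (x, y).
Proof.
move=> fc gc yr fg; rewrite -[LHS]subr0 -(prim0 (fun s => f (x, s))).
have h : continuous (fun s => g (x, s)) by exact: continuous_slicer.
apply: (@prim_unique _ _ (fun s => PY f (x, s)) r y h) => // s sr.
by rewrite -fg//; exact: PY_derive.
Qed.

End Plane.

(** * Entrywise primitives of matrix-valued functions *)

Section MatrixPrimitive.
Context {R : realType} {n : nat}.
Implicit Types (f g : R * R -> 'M[R]_n) (q : R * R).

Definition mcont (T : topologicalType) (f : T -> 'M[R]_n) :=
  forall i j, continuous (fun z => f z i j).

Lemma mcontD (T : topologicalType) (f g : T -> 'M[R]_n) :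
  mcont f -> mcont g -> mcont (fun z => f z + g z).
Proof.
move=> fc gc i j; under eq_fun do rewrite mxE; exact: contD (fc i j) (gc i j).
Qed.

Lemma mcontB (T : topologicalType) (f g : T -> 'M[R]_n) :
  mcont f -> mcont g -> mcont (fun z => f z - g z).
Proof.
move=> fc gc i j; under eq_fun do rewrite !mxE; exact: contB (fc i j) (gc i j).
Qed.

Lemma mcontM (T : topologicalType) (f g : T -> 'M[R]_n) :
  mcont f -> mcont g -> mcont (fun z => f z *m g z).
Proof.
move=> fc gc i j; under eq_fun do rewrite mxE; apply: cont_sum => k.
exact: contM (fc i k) (gc k j).
Qed.

Lemma mcont_cst (T : topologicalType) (A : 'M[R]_n) : mcont (fun _ : T => A).
Proof. by move=> i j x; exact: cst_continuous. Qed.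

Lemma mcont_comp (T U : topologicalType) (f : T -> 'M[R]_n) (h : U -> T) :
  continuous h -> mcont f -> mcont (fun u => f (h u)).
Proof.
move=> hc fc i j x; apply: (@continuous_comp _ _ _ h (fun z => f z i j)); first exact: hc.
exact: fc.
Qed.

Lemma is_derive_mulmx (f g : R -> 'M[R]_n) (df dg : 'M[R]_n) (x : R) :
  (forall i j, is_derive x 1 (fun s => f s i j) (df i j)) ->
  (forall i j, is_derive x 1 (fun s => g s i j) (dg i j)) ->
  forall i j, is_derive x 1 (fun s => (f s *m g s) i j) ((df *m g x + f x *m dg) i j).
Proof.
move=> fd gd i j.
have -> : (fun s => (f s *m g s) i j) = (fun s => \sum_(k < n) f s i k * g s k j).
  by apply/funext => s; rewrite mxE.
rewrite !mxE -big_split/=.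
have h k : is_derive x 1 (fun s => f s i k * g s k j) (df i k * g x k j + f x i k * dg k j).
  rewrite addrC [df i k * _]mulrC.
  exact: (@is_deriveM _ _ (fun s => f s i k) (fun s => g s k j) x 1 _ _ (fd i k) (gd k j)).
have -> : (fun s => \sum_(k < n) f s i k * g s k j) =
    \sum_(k < n) (fun s => f s i k * g s k j).
  by apply/funext => s; rewrite fct_sumE.
exact: is_derive_sum.
Qed.

Definition PXm f q : 'M[R]_n := \matrix_(i, j) PX (fun p => f p i j) q.
Definition PYm f q : 'M[R]_n := \matrix_(i, j) PY (fun p => f p i j) q.

Lemma PXm_cont f : mcont f -> mcont (PXm f).
Proof.
by move=> fc i j; under eq_fun do rewrite mxE; apply: PX_continuous; exact: fc.
Qed.

Lemma PYm_cont f : mcont f -> mcont (PYm f).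
Proof.
by move=> fc i j; under eq_fun do rewrite mxE; apply: PY_continuous; exact: fc.
Qed.

Lemma PXmD f g q : mcont f -> mcont g -> PXm (fun p => f p + g p) q = PXm f q + PXm g q.
Proof.
move=> fc gc; apply/matrixP => i j; rewrite !mxE /PX.
under [in LHS]eq_fun do rewrite mxE.
by rewrite primD; [|exact: (@continuous_slicel _ _ _ (fc i j))|exact: (@continuous_slicel _ _ _ (gc i j))].
Qed.

Lemma PXmB f g q : mcont f -> mcont g -> PXm (fun p => f p - g p) q = PXm f q - PXm g q.
Proof.
move=> fc gc; apply/matrixP => i j; rewrite !mxE /PX.
under [in LHS]eq_fun do rewrite !mxE.
by rewrite primB; [|exact: (@continuous_slicel _ _ _ (fc i j))|exact: (@continuous_slicel _ _ _ (gc i j))].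
Qed.

Lemma PYmD f g q : mcont f -> mcont g -> PYm (fun p => f p + g p) q = PYm f q + PYm g q.
Proof.
move=> fc gc; apply/matrixP => i j; rewrite !mxE /PY.
under [in LHS]eq_fun do rewrite mxE.
by rewrite primD; [|exact: (@continuous_slicer _ _ _ (fc i j))|exact: (@continuous_slicer _ _ _ (gc i j))].
Qed.

Lemma PYmB f g q : mcont f -> mcont g -> PYm (fun p => f p - g p) q = PYm f q - PYm g q.
Proof.
move=> fc gc; apply/matrixP => i j; rewrite !mxE /PY.
under [in LHS]eq_fun do rewrite !mxE.
by rewrite primB; [|exact: (@continuous_slicer _ _ _ (fc i j))|exact: (@continuous_slicer _ _ _ (gc i j))].
Qed.

Lemma PXm_PYm f q : mcont f -> PXm (PYm f) q = PYm (PXm f) q.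
Proof.
move=> fc; apply/matrixP => i j; rewrite !mxE.
transitivity (PX (PY (fun p => f p i j)) q).
  by congr (PX _ q); apply/funext => p; rewrite mxE.
rewrite Fubini_PXPY; last exact: fc.
by congr (PY _ q); apply/funext => p; rewrite mxE.
Qed.

Lemma PXm_ext f g (r x y : R) : mcont f -> mcont g -> `|x| < r ->
  (forall s, `|s| < r -> f (s, y) = g (s, y)) -> PXm f (x, y) = PXm g (x, y).
Proof.
move=> fc gc xr fg; apply/matrixP => i j; rewrite !mxE.
by apply: (@PX_ext _ _ _ r); [exact: fc|exact: gc|exact: xr|move=> s /fg ->].
Qed.

Lemma PYm_ext f g (r x y : R) : mcont f -> mcont g -> `|y| < r ->
  (forall s, `|s| < r -> f (x, s) = g (x, s)) -> PYm f (x, y) = PYm g (x, y).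
Proof.
move=> fc gc xr fg; apply/matrixP => i j; rewrite !mxE.
by apply: (@PY_ext _ _ _ r); [exact: fc|exact: gc|exact: xr|move=> s /fg ->].
Qed.

Lemma PXm0 f y : PXm f (0, y) = 0.
Proof. by apply/matrixP => i j; rewrite !mxE /PX prim0. Qed.

Lemma PYm0 f x : PYm f (x, 0) = 0.
Proof. by apply/matrixP => i j; rewrite !mxE /PY prim0. Qed.

Lemma PXm_derive f (x y : R) i j : mcont f ->
  is_derive x 1 (fun s => PXm f (s, y) i j) (f (x, y) i j).
Proof. by move=> fc; under eq_fun do rewrite mxE; apply: PX_derive; exact: fc. Qed.

Lemma PYm_derive f (x y : R) i j : mcont f ->
  is_derive y 1 (fun t => PYm f (x, t) i j) (f (x, y) i j).
Proof. by move=> fc; under eq_fun do rewrite mxE; apply: PY_derive; exact: fc. Qed.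

Lemma PXm_unique f g (r x y : R) : mcont f ->
  (forall (s : R) i j, `|s| < r -> is_derive s 1 (fun s => g (s, y) i j) (f (s, y) i j)) ->
  `|x| < r -> g (x, y) = g (0, y) + PXm f (x, y).
Proof.
move=> fc gd xr; apply/matrixP => i j; rewrite !mxE /PX.
have h := @continuous_slicel _ _ y (fc i j).
have /= <- := @prim_unique _ _ (fun s => g (s, y) i j) r x h (fun s sr => gd s i j sr) xr.
by rewrite addrC subrK.
Qed.

Lemma PYm_unique f g (r x y : R) : mcont f ->
  (forall (s : R) i j, `|s| < r -> is_derive s 1 (fun s => g (x, s) i j) (f (x, s) i j)) ->
  `|y| < r -> g (x, y) = g (x, 0) + PYm f (x, y).
Proof.
move=> fc gd yr; apply/matrixP => i j; rewrite !mxE /PY.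
have h := @continuous_slicer _ _ x (fc i j).
have /= <- := @prim_unique _ _ (fun s => g (x, s) i j) r y h (fun s sr => gd s i j sr) yr.
by rewrite addrC subrK.
Qed.

Lemma PXm_bound f (r B x y : R) : mcont f -> `|x| < r ->
  (forall s i j, `|s| < r -> `|f (s, y) i j| <= B) ->
  forall i j, `|PXm f (x, y) i j| <= B * `|x|.
Proof.
move=> fc xr fB i j; rewrite mxE; apply: (@prim_bound _ _ r) => //.
  exact: (@continuous_slicel _ _ _ (fc i j)).
by move=> s /fB.
Qed.

Lemma PYm_bound f (r B x y : R) : mcont f -> `|y| < r ->
  (forall s i j, `|s| < r -> `|f (x, s) i j| <= B) ->
  forall i j, `|PYm f (x, y) i j| <= B * `|y|.
Proof.
move=> fc xr fB i j; rewrite mxE; apply: (@prim_bound _ _ r) => //.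
  exact: (@continuous_slicer _ _ _ (fc i j)).
by move=> s /fB.
Qed.

Lemma mulmx_bound (A B : 'M[R]_n) (a b : R) : (forall i j, `|A i j| <= a) ->
  (forall i j, `|B i j| <= b) -> forall i j, `|(A *m B) i j| <= n%:R * (a * b).
Proof.
move=> Aa Bb i j; rewrite mxE.
apply: (le_trans (ler_norm_sum _ _ _)).
apply: (@le_trans _ _ (\sum_(k < n) a * b)).
  by apply: ler_sum => k _; rewrite normrM; apply: ler_pM.
by rewrite sumr_const card_ord mulr_natl.
Qed.

End MatrixPrimitive.

(** * Picard iteration *)

Section Picard.
Context {R : realType} {n : nat}.
Variables (a0 a1 : R * R -> 'M[R]_n) (r C : R).
Hypotheses (a0c : mcont a0) (a1c : mcont a1).
Hypotheses (a0C : forall q i j, `|a0 q i j| <= C) (a1C : forall q i j, `|a1 q i j| <= C).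
Hypotheses (r0 : 0 < r) (C0 : 0 <= C) (nCr : n%:R * C * r <= 4^-1) (Cr : C * r <= 4^-1).
Implicit Types (f g : R * R -> 'M[R]_n).

(** Retraction of the line onto [[- r, r]]. Composed with it, the iterates are defined on the whole
    plane and keep their values on the square, so estimates need no restriction on the point. *)
Definition clamp (x : R) : R := Num.max (- r) (Num.min r x).

Lemma clamp_norm x : `|clamp x| <= r.
Proof.
rewrite /clamp ler_norml le_max lexx /= ge_max ge_min lexx/=.
by rewrite (le_trans _ (ltW r0))// oppr_le0 ltW.
Qed.

Lemma clamp_id x : `|x| <= r -> clamp x = x.
Proof.
rewrite ler_norml /clamp => /andP[rx xr].
by rewrite min_r// max_r.
Qed.

Lemma clamp_continuous : continuous clamp.
Proof.
move=> x; apply: (@continuous_max _ _ (fun=> - r) (fun x => Num.min r x)).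
  exact: cst_continuous.
apply: (@continuous_min _ _ (fun=> r) id); first exact: cst_continuous.
exact: cvg_id.
Qed.

Definition clamp2 (q : R * R) := (clamp q.1, clamp q.2).

Lemma clamp2_continuous : continuous clamp2.
Proof.
move=> [x y]; apply: (@pair_continuous _ _ _ (clamp \o fst) (clamp \o snd)).
  by apply: continuous_comp; [exact: cvg_fst|exact: clamp_continuous].
by apply: continuous_comp; [exact: cvg_snd|exact: clamp_continuous].
Qed.

(* One Picard step, for the solution first transported along the horizontal
   axis and then along vertical lines. *)
Definition picard0 f q : 'M[R]_n :=
  1%:M + PXm (fun p => f p *m a0 p) (q.1, 0) + PYm (fun p => f p *m a1 p) q.
Definition picard f q := picard0 f (clamp2 q).
Definition picardn k := iter k picard (fun=> 1%:M).

Lemma axis_continuous : continuous (fun q : R * R => (q.1, 0 : R)).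
Proof.
by move=> [x y]; apply: (@pair_continuous _ _ _ fst (fun=> 0)); [exact: cvg_fst|exact: cst_continuous].
Qed.

Lemma picard_cont f : mcont f -> mcont (picard f).
Proof.
move=> fc; apply: (mcont_comp clamp2_continuous); apply: mcontD.
  apply: mcontD; first exact: mcont_cst.
  exact: (mcont_comp axis_continuous (PXm_cont (mcontM fc a0c))).
exact: (PYm_cont (mcontM fc a1c)).
Qed.

Lemma picardn_cont k : mcont (picardn k).
Proof. by elim: k => [|k IH]; [exact: mcont_cst|exact: picard_cont]. Qed.

(** Each of the two primitives is at most [n * (B * C) * r], which is at most [B / 4] by the choice
    of [r]. *)
Lemma picard_contr f g B : mcont f -> mcont g ->
  (forall q i j, `|f q i j - g q i j| <= B) ->
  forall q i j, `|picard f q i j - picard g q i j| <= B / 2.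
Proof.
move=> fc gc fgB q i j; rewrite /picard.
have : `|(clamp2 q).1| <= r by exact: clamp_norm.
have : `|(clamp2 q).2| <= r by exact: clamp_norm.
case: (clamp2 q) => x y /= yr xr.
have B0 : 0 <= B by apply: le_trans (fgB q i j).
have E : picard0 f (x, y) - picard0 g (x, y) =
   PXm (fun p => (f p - g p) *m a0 p) (x, 0) + PYm (fun p => (f p - g p) *m a1 p) (x, y).
  have -> : (fun p => (f p - g p) *m a0 p) = (fun p => f p *m a0 p - g p *m a0 p).
    by apply/funext => p; rewrite mulmxBl.
  have -> : (fun p => (f p - g p) *m a1 p) = (fun p => f p *m a1 p - g p *m a1 p).
    by apply/funext => p; rewrite mulmxBl.
  rewrite PXmB; [|exact: mcontM..]; rewrite PYmB; [|exact: mcontM..].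
  rewrite /picard0 /=; move: (PXm _ _) (PYm _ _) (PXm _ _) (PYm _ _) => A B1 A' B1'.
  by apply/matrixP => k l; rewrite !mxE; ring.
have -> : picard0 f (x, y) i j - picard0 g (x, y) i j = (picard0 f (x, y) - picard0 g (x, y)) i j.
  by rewrite !mxE.
rewrite E mxE; apply: le_trans (ler_normD _ _) _.
have fgb p i' j' : `|(f p - g p) i' j'| <= B by rewrite !mxE.
have hx : `|PXm (fun p => (f p - g p) *m a0 p) (x, 0) i j| <= n%:R * (B * C) * `|x|.
  (* A clamped point may lie on the boundary, while the bound on primitives needs a strict
     inequality; the integrand is bounded everywhere, so [r + 1] serves. *)
  apply: (@PXm_bound _ _ _ (r + 1)); first exact: (mcontM (mcontB fc gc) a0c).
    by apply: le_lt_trans xr _; rewrite ltrDl.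
  by move=> s i' j' _; apply: mulmx_bound.
have hy : `|PYm (fun p => (f p - g p) *m a1 p) (x, y) i j| <= n%:R * (B * C) * `|y|.
  apply: (@PYm_bound _ _ _ (r + 1)); first exact: (mcontM (mcontB fc gc) a1c).
    by apply: le_lt_trans yr _; rewrite ltrDl.
  by move=> s i' j' _; apply: mulmx_bound.
have nBC : 0 <= n%:R * (B * C) by rewrite !mulr_ge0.
apply: le_trans (lerD hx hy) _.
apply: le_trans (lerD (ler_wpM2l nBC xr) (ler_wpM2l nBC yr)) _.
have := ler_wpM2l B0 nCr; rewrite !mulrA ![B * _]mulrC => h.
by nra.
Qed.

Lemma picardn_step k q i j : `|picardn k.+1 q i j - picardn k q i j| <= 2^-1 ^+ k.
Proof.
elim: k q i j => [|k IH] q i j.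
  rewrite expr0 /= /picard.
  have : `|(clamp2 q).1| <= r by exact: clamp_norm.
  have : `|(clamp2 q).2| <= r by exact: clamp_norm.
  case: (clamp2 q) => x y /= yr xr; rewrite /picard0/=.
  have -> : (fun p => 1%:M *m a0 p) = a0 by apply/funext => p; rewrite mul1mx.
  have -> : (fun p => 1%:M *m a1 p) = a1 by apply/funext => p; rewrite mul1mx.
  have hx : `|PXm a0 (x, 0) i j| <= C * `|x|.
    apply: (@PXm_bound _ _ _ (r + 1)) => //.
    by apply: le_lt_trans xr _; rewrite ltrDl.
  have hy : `|PYm a1 (x, y) i j| <= C * `|y|.
    apply: (@PYm_bound _ _ _ (r + 1)) => //.
    by apply: le_lt_trans yr _; rewrite ltrDl.
  move: hx hy; move: (PXm _ _) (PYm _ _) => A B hA hB.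
  have -> : (1%:M + A + B) i j - (1%:M : 'M[R]_n) i j = A i j + B i j.
    by rewrite 2!mxE; ring.
  apply: le_trans (ler_normD _ _) _.
  have h1 := ler_wpM2l C0 xr; have h2 := ler_wpM2l C0 yr.
  apply: le_trans (lerD (le_trans hA h1) (le_trans hB h2)) _.
  by move: Cr; move: (C * r) => z Hz; lra.
have := picard_contr (@picardn_cont k.+1) (@picardn_cont k) IH q i j.
by rewrite exprS mulrC.
Qed.

Lemma picardn_tail k m q i j :
  `|picardn (k + m) q i j - picardn k q i j| <= 2 * 2^-1 ^+ k.
Proof.
(* The exact partial sum of the geometric series, without which the induction on [m] does not
   close. *)
have h : `|picardn (k + m) q i j - picardn k q i j| <= (2 - 2 * 2^-1 ^+ m) * 2^-1 ^+ k.
  elim: m => [|m IH]; first by rewrite addn0 subrr normr0 expr0; lra.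
  rewrite addnS -(subrKA (picardn (k + m) q i j)); apply: le_trans (ler_normD _ _) _.
  apply: le_trans (lerD (picardn_step _ _ _ _) IH) _.
  by rewrite exprD exprS; move: (2^-1 ^+ k) (2^-1 ^+ m) => u v; lra.
apply: le_trans h _; apply: ler_wpM2r; first by rewrite exprn_ge0// invr_ge0.
by rewrite gerBl mulr_ge0// exprn_ge0// invr_ge0.
Qed.

Lemma half_pow_small (e : R) : 0 < e -> exists k, 2 * 2^-1 ^+ k < e.
Proof.
move=> e0; have : (fun k => 2 * 2^-1 ^+ k : R) @ \oo --> (2 * 0 : R).
  apply: cvgM; first exact: cvg_cst.
  by apply: cvg_expr; rewrite ger0_norm ?invr_ge0//; lra.
rewrite mulr0 => /cvgr_lt/(_ _ e0)[k _ h]; exists k; exact: h (leqnn k).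
Qed.

Lemma picardn_cvg q i j : exists l : R, forall k, `|l - picardn k q i j| <= 2 * 2^-1 ^+ k.
Proof.
have cv : cvgn (fun k => picardn k q i j : R^o).
  apply/cauchy_cvgP/cauchy_exP => e e0.
  have [k ke] := half_pow_small e0.
  exists (picardn k q i j); exists k => //= m /= km.
  rewrite /ball /= distrC -(subnKC km).
  exact: le_lt_trans (picardn_tail _ _ _ _ _) ke.
exists (limn (fun k => picardn k q i j : R^o)) => k.
have cv2 : (fun m => `|picardn m q i j - picardn k q i j|) @ \oo -->
  `|limn (fun k => picardn k q i j : R^o) - picardn k q i j|.
  by apply: cvg_norm; apply: cvgB => //; exact: cvg_cst.
apply: (cvgr_to_le cv2); exists k => //= m /= km.
by rewrite -(subnKC km); exact: picardn_tail.
Qed.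

(** The steps decay geometrically, so the iterates converge uniformly and the limit is continuous.
    The bound 3 is the distance 2 of the limit from the initial iterate 1, plus the bound 1 on the
    entries of the latter. *)
Lemma picard_fixpoint : exists F : R * R -> 'M[R]_n,
  [/\ mcont F, (forall q i j, `|F q i j| <= 3) & forall q, F q = picard F q].
Proof.
pose F q : 'M[R]_n := \matrix_(i, j) sval (cid (picardn_cvg q i j)).
have FP k q i j : `|F q i j - picardn k q i j| <= 2 * 2^-1 ^+ k.
  by rewrite mxE; case: cid => l /=.
have Fc : mcont F.
  move=> i j q0; apply/cvgrPdist_lt => e e0.
  have e30 : 0 < e / 3 by lra.
  have [k ke] := half_pow_small e30.
  have /cvgrPdist_lt/(_ _ e30) := @picardn_cont k i j q0.
  apply: filterS => q h.
  rewrite -(subrKA (picardn k q0 i j)); apply: le_lt_trans (ler_normD _ _) _.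
  rewrite -[X in `|X| + _]/(F q0 i j - _).
  have h1 := FP k q0 i j; have h2 := FP k q i j.
  have : `|picardn k q0 i j - F q i j| < e / 3 + e / 3.
    rewrite -(subrKA (picardn k q i j)); apply: le_lt_trans (ler_normD _ _) _.
    by rewrite [X in _ + X < _]distrC; lra.
  lra.
exists F; split => //.
  move=> q i j; have := FP 0 q i j; rewrite expr0 /= => h.
  have : `|(1%:M : 'M[R]_n) i j| <= 1.
    by rewrite mxE; case: (i == j); rewrite ?normr1 ?normr0.
  move=> h2; rewrite -(subrK ((1%:M : 'M[R]_n) i j) (F q i j)).
  by apply: le_trans (ler_normD _ _) _; lra.
(* Both [F] and [picard F] are within [2^-1 ^+ k] of the iterate of index [k.+1]. *)
move=> q; apply/matrixP => i j; apply/eqP; rewrite -subr_eq0 -normr_le0.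
apply/ler_addgt0Pr => e e0; rewrite add0r.
have e20 : 0 < e / 2 by lra.
have [k ke] := half_pow_small e20.
rewrite -(subrKA (picardn k.+1 q i j)); apply: le_trans (ler_normD _ _) _.
have h1 := FP k.+1 q i j.
have h2 := picard_contr Fc (@picardn_cont k) (FP k) q i j.
rewrite [X in _ + X <= _]distrC.
move: h1 h2; rewrite exprS /=; move: ke; move: (2^-1 ^+ k) => z; lra.
Qed.

End Picard.

(** * Integrability of flat systems on a square *)

Section Frobenius.
Context {R : realType} {n : nat}.
Variables (a0 a1 b0 b1 : R * R -> 'M[R]_n) (r C : R).
Hypotheses (a0c : mcont a0) (a1c : mcont a1) (b1c : mcont b1).
Hypotheses (a0C : forall q i j, `|a0 q i j| <= C) (a1C : forall q i j, `|a1 q i j| <= C)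
  (b1C : forall q i j, `|b1 q i j| <= C).
Hypotheses (r0 : 0 < r) (r1 : r <= 1) (C0 : 0 <= C)
  (nCr : n%:R * C * r <= 4^-1) (Cr : C * r <= 4^-1).
Hypothesis a1d : forall (x y : R) i j, `|x| < r -> `|y| < r ->
  is_derive x 1 (fun s => a1 (s, y) i j) (b1 (x, y) i j).
Hypothesis a0d : forall (x y : R) i j, `|x| < r -> `|y| < r ->
  is_derive y 1 (fun t => a0 (x, t) i j) (b0 (x, y) i j).
Hypothesis flat : forall x y : R, `|x| < r -> `|y| < r ->
  b1 (x, y) - b0 (x, y) + (a0 (x, y) *m a1 (x, y) - a1 (x, y) *m a0 (x, y)) = 0.

Let F := sval (cid (picard_fixpoint a0c a1c a0C a1C r0 C0 nCr Cr)).
Let Fc : mcont F. Proof. by rewrite /F; case: cid => ? []. Qed.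
Let F3 q i j : `|F q i j| <= 3. Proof. by rewrite /F; case: cid => ? []. Qed.
Let FE (x y : R) : `|x| < r -> `|y| < r -> F (x, y) = 1%:M +
  PXm (fun p => F p *m a0 p) (x, 0) + PYm (fun p => F p *m a1 p) (x, y).
Proof.
move=> xr yr; have -> : F (x, y) = picard a0 a1 r F (x, y).
  by rewrite /F; case: cid => ? [].
by rewrite /picard /clamp2 /= !clamp_id// ltW.
Qed.

Let absr0 : `|0 : R| < r. Proof. by rewrite normr0. Qed.

Let Fy (x y : R) i j : `|x| < r -> `|y| < r ->
  is_derive y 1 (fun t => F (x, t) i j) ((F (x, y) *m a1 (x, y)) i j).
Proof.
move=> xr yr.
apply: (@near_eq_is_derive _ _ _ (fun t => ((1%:M + PXm (fun p => F p *m a0 p) (x, 0)) i j) +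
   PYm (fun p => F p *m a1 p) (x, t) i j)).
  have : \forall t \near y, `|t| < r.
    by apply: (cvgr_lt `|y| (@norm_continuous _ _ y)).
  by apply: filterS => t tr; rewrite FE// [in RHS]mxE.
rewrite -[X in is_derive _ _ _ X]add0r; apply: is_deriveD.
exact: (PYm_derive _ _ _ _ (mcontM Fc a1c)).
Qed.

(* [F] is transported along the horizontal axis and then vertically, so it solves
   the vertical equation; [M] starts from [F] on the vertical axis and solves the
   horizontal one.  Flatness turns the difference [E] into a solution of the linear
   integral equation [step3], which halves every bound on [E]; hence [E = 0]. *)
Let M q := F (0, q.2) + PXm (fun p => F p *m a0 p) q.

Let Mc : mcont M.
Proof.
apply: mcontD; last exact: PXm_cont (mcontM Fc a0c).
apply: (@mcont_comp _ _ _ _ F (fun q : R * R => (0 : R, q.2))) => // -[x y].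
by apply: (@pair_continuous _ _ _ (fun=> 0) snd); [exact: cst_continuous|exact: cvg_snd].
Qed.

Let Mx (x y : R) i j :
  is_derive x 1 (fun s => M (s, y) i j) ((F (x, y) *m a0 (x, y)) i j).
Proof.
have -> : (fun s => M (s, y) i j) = (fun s => F (0, y) i j + PXm (fun p => F p *m a0 p) (s, y) i j).
  by apply/funext => s; rewrite /M mxE.
rewrite -[X in is_derive _ _ _ X]add0r; apply: is_deriveD.
exact: (PXm_derive _ _ _ _ (mcontM Fc a0c)).
Qed.

(** By flatness [W] is the y-derivative of [F a0] ([step2]), while [W'] below is the x-derivative of
    [M a1] ([step1]); they differ by [E b1]. *)
Let W q := F q *m a0 q *m a1 q + F q *m b1 q.
Let Wc : mcont W.
Proof. by apply: mcontD; apply: mcontM => //; apply: mcontM. Qed.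
Let W' q := F q *m a0 q *m a1 q + M q *m b1 q.
Let W'c : mcont W'.
Proof. by apply: mcontD; apply: mcontM => //; apply: mcontM. Qed.

Let step1 x y : `|x| < r -> `|y| < r ->
  M (x, y) *m a1 (x, y) = M (0, y) *m a1 (0, y) + PXm W' (x, y).
Proof.
move=> xr yr; apply: (@PXm_unique _ _ _ (fun q => M q *m a1 q) r) => // s i j sr.
apply: (@is_derive_mulmx _ _ (fun s => M (s, y)) (fun s => a1 (s, y))).
  by move=> *; exact: Mx.
by move=> *; exact: a1d.
Qed.

Let step2 x y : `|x| < r -> `|y| < r ->
  F (x, y) *m a0 (x, y) = F (x, 0) *m a0 (x, 0) + PYm W (x, y).
Proof.
move=> xr yr; apply: (@PYm_unique _ _ _ (fun q => F q *m a0 q) r) => // t i j tr.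
have -> : W (x, t) = F (x, t) *m a1 (x, t) *m a0 (x, t) + F (x, t) *m b0 (x, t).
  rewrite /W -!mulmxA -!mulmxDr; congr (_ *m _); apply/eqP; rewrite -subr_eq0.
  by rewrite -(flat xr tr); apply/eqP; rewrite opprD addrACA addrC.
apply: (@is_derive_mulmx _ _ (fun s => F (x, s)) (fun s => a0 (x, s))).
  by move=> *; exact: Fy.
by move=> *; exact: a0d.
Qed.

Let E q := F q - M q.
Let Ec : mcont E. Proof. exact: mcontB. Qed.

(** Integrating [step2] in x produces the double primitive of [W]. Fubini puts the x-integration
    inside, where [W] is [W'] plus [E b1] and [W'] integrates exactly to a difference of values of
    [M a1]. On the axis [x = 0] the functions [M] and [F] agree, so the boundary terms cancel. *)
Let step3 x y : `|x| < r -> `|y| < r ->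
  E (x, y) = PYm (fun p => E p *m a1 p) (x, y) - PYm (PXm (fun p => E p *m b1 p)) (x, y).
Proof.
move=> xr yr.
have Fa0 : mcont (fun p => F p *m a0 p) by exact: mcontM.
have Fa1 : mcont (fun p => F p *m a1 p) by exact: mcontM.
have Ma1 : mcont (fun p => M p *m a1 p) by exact: mcontM.
have Eb1 : mcont (fun p => E p *m b1 p) by exact: mcontM.
have ax0 : continuous (fun q : R * R => (q.1, 0 : R)) by exact: axis_continuous.
have a0y : continuous (fun q : R * R => (0 : R, q.2)).
  move=> -[? ?].
  by apply: (@pair_continuous _ _ _ (fun=> 0) snd); [exact: cst_continuous|exact: cvg_snd].
have Fa00 : mcont (fun p : R * R => F (p.1, 0) *m a0 (p.1, 0)) by exact: (mcont_comp ax0 Fa0).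
have Ma10 : mcont (fun p : R * R => M (0, p.2) *m a1 (0, p.2)) by exact: (mcont_comp a0y Ma1).
have M0 t : M (0, t) = F (0, t) by rewrite /M PXm0 addr0.
have e1 : PXm (fun p => F p *m a0 p) (x, y) =
    PXm (fun p => F p *m a0 p) (x, 0) + PXm (PYm W) (x, y).
  rewrite (@PXm_ext _ _ _ (fun p => F (p.1, 0) *m a0 (p.1, 0) + PYm W p) r)//.
  - by rewrite PXmD//; exact: PYm_cont.
  - exact: (mcontD Fa00 (PYm_cont Wc)).
  - by move=> s sr; exact: step2.
have e2 : PYm (PXm W) (x, y) = PYm (fun p => M p *m a1 p) (x, y) -
     PYm (fun p => M p *m a1 p) (0, y) + PYm (PXm (fun p => E p *m b1 p)) (x, y).
  have cc : mcont (fun p => M p *m a1 p - M (0, p.2) *m a1 (0, p.2)) by exact: mcontB.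
  rewrite (@PYm_ext _ _ _ (fun p => (M p *m a1 p - M (0, p.2) *m a1 (0, p.2)) +
     PXm (fun p => E p *m b1 p) p) r)//.
  - by rewrite PYmD ?PYmB//; exact: PXm_cont.
  - exact: PXm_cont.
  - exact: (mcontD cc (PXm_cont Eb1)).
  move=> t tr; rewrite /= (step1 xr tr) [_ + PXm W' _]addrC addrK -PXmD//.
  congr (PXm _ _); apply/funext => q.
  by rewrite /W /W' /E mulmxBl -addrA [_ + (_ - _)]addrC subrK.
have e3 : PYm (fun p => M p *m a1 p) (0, y) = F (0, y) - 1%:M.
  rewrite (@PYm_ext _ _ _ (fun p => F p *m a1 p) r)//; last by move=> t tr; rewrite M0.
  by rewrite (FE absr0 yr) PXm0 addr0 addrAC subrr add0r.
rewrite /E {1}/M (FE xr yr) /= e1 PXm_PYm// e2 e3.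
have -> : (fun p => (F p - M p) *m a1 p) = (fun p => F p *m a1 p - M p *m a1 p).
  by apply/funext => p; rewrite mulmxBl.
rewrite PYmB//.
move: (PXm _ _) (PYm _ _) (PYm _ _) (PYm _ _) (F (0, y)) => A1 A2 A3 A4 A5.
by apply/matrixP => i j; rewrite !mxE; ring.
Qed.

(** Both terms of [step3] are at most [n * (B * C) * r], hence at most [B / 4]; in the double
    primitive the extra integration costs a factor [|x|], which is at most [r <= 1]. *)
Let step4 B : (forall x y i j, `|x| < r -> `|y| < r -> `|E (x, y) i j| <= B) ->
  forall x y i j, `|x| < r -> `|y| < r -> `|E (x, y) i j| <= B / 2.
Proof.
move=> EB x y i j xr yr.
have B0 : 0 <= B by apply: le_trans (EB x y i j xr yr).
have h1 : `|PYm (fun p => E p *m a1 p) (x, y) i j| <= n%:R * (B * C) * `|y|.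
  apply: (@PYm_bound _ _ _ r) => //; first exact: mcontM.
  by move=> s i' j' sr; apply: mulmx_bound => // *; exact: EB.
have nBC : 0 <= n%:R * (B * C) by rewrite !mulr_ge0.
have h2 : `|PYm (PXm (fun p => E p *m b1 p)) (x, y) i j| <= n%:R * (B * C) * `|y|.
  apply: (@PYm_bound _ _ _ r) => //; first by apply: PXm_cont; exact: mcontM.
  move=> s i' j' sr; apply: (@le_trans _ _ (n%:R * (B * C) * `|x|)).
    apply: (@PXm_bound _ _ _ r) => //; first exact: mcontM.
    by move=> t i2 j2 tr; apply: mulmx_bound => // *; exact: EB.
  by rewrite -[leRHS]mulr1; apply: ler_wpM2l => //; apply/ltW/(lt_le_trans xr).
rewrite (step3 xr yr); move: h1 h2.
move: (PYm (fun p => _) _) (PYm (PXm _) _) => A1 A2 h1 h2; rewrite 2!mxE.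
apply: le_trans (ler_normB _ _) _.
apply: le_trans (lerD h1 h2) _.
have h3 := ler_wpM2l nBC (ltW yr).
have := ler_wpM2l B0 nCr; rewrite !mulrA ![B * _]mulrC => h.
by nra.
Qed.

Let E0 x y : `|x| < r -> `|y| < r -> M (x, y) = F (x, y).
Proof.
(* Here 7 is 3 for each of [F (x, y)] and [F (0, y)], plus 1 for the primitive in [M]. *)
have Eb : forall x y i j, `|x| < r -> `|y| < r -> `|E (x, y) i j| <= 7.
  move=> {}x {}y i j xr yr; rewrite /E /M !mxE.
  have h : `|PXm (fun p => F p *m a0 p) (x, y) i j| <= n%:R * (3 * C) * `|x|.
    apply: (@PXm_bound _ _ _ r) => //; first exact: mcontM.
    by move=> s i' j' sr; apply: mulmx_bound.
  rewrite mxE in h.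
  have h1 := F3 (x, y) i j; have h2 := F3 (0, y) i j.
  have nBC : 0 <= n%:R * (3 * C) by rewrite !mulr_ge0.
  have h3 := ler_wpM2l nBC (ltW xr).
  have h4 : n%:R * (3 * C) * r <= 1.
    have -> : n%:R * (3 * C) * r = 3 * (n%:R * C * r) by ring.
    by move: nCr; move: (n%:R * C * r) => z; lra.
  have h5 := le_trans h (le_trans h3 h4).
  apply: le_trans (ler_normB _ _) _; apply: le_trans (lerD h1 (ler_normD _ _)) _.
  by apply: le_trans (lerD (lexx _) (lerD h2 h5)) _; lra.
have Ek k : forall x y i j, `|x| < r -> `|y| < r -> `|E (x, y) i j| <= 7 * 2^-1 ^+ k.
  elim: k => [|k IH]; first by rewrite expr0 mulr1.
  by rewrite exprS mulrCA mulrC; exact: step4.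
move=> xr yr; apply/matrixP => i j; apply/eqP; rewrite eq_sym -subr_eq0 -normr_le0.
apply/ler_addgt0Pr => e e0; rewrite add0r.
have e40 : 0 < e / 4 by lra.
have [k ke] := half_pow_small e40.
have := Ek k x y i j xr yr; rewrite /E 2!mxE => h; apply: le_trans h _.
by move: ke; move: (2^-1 ^+ k) => z; lra.
Qed.

Lemma frobenius_box : exists G : R * R -> 'M[R]_n, [/\ mcont G, G (0, 0) = 1%:M,
  (forall (x y : R) i j, `|x| < r -> `|y| < r ->
     is_derive x 1 (fun s => G (s, y) i j) ((G (x, y) *m a0 (x, y)) i j)) &
  (forall (x y : R) i j, `|x| < r -> `|y| < r ->
     is_derive y 1 (fun t => G (x, t) i j) ((G (x, y) *m a1 (x, y)) i j))].
Proof.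
exists F; split => //.
- by rewrite (FE absr0 absr0) PXm0 PYm0 !addr0.
- move=> x y i j xr yr; apply: (@near_eq_is_derive _ _ _ (fun s => M (s, y) i j)); last exact: Mx.
  have : \forall t \near x, `|t| < r.
    by apply: (cvgr_lt `|x| (@norm_continuous _ _ x)).
  by apply: filterS => t tr; rewrite E0.
Qed.

End Frobenius.

Local Open Scope complex_scope.

Local Notation Re := complex.Re.
Local Notation Im := complex.Im.

(** * Calculus on the plane *)

Section PlaneCalculus.
Context {R : realType}.
Implicit Types (f g : 'rV[R]_2 -> R) (p q : 'rV[R]_2) (D : set 'rV[R]_2).

Local Notation e_ j := (delta_mx 0 j : 'rV[R]_2).

Lemma derive_line f p (v : 'rV[R]_2) (t d : R) :
  is_derive (p + t *: v) v f d -> is_derive t 1 (fun s => f (p + s *: v)) d.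
Proof.
have E : (fun h : R => h^-1 *: ((f \o shift (p + t *: v)) (h *: v) - f (p + t *: v))) =
  (fun h : R => h^-1 *: (((fun s => f (p + s *: v)) \o shift t) (h *: 1) - f (p + t *: v))).
  apply/funext => h; rewrite /= /shift /=; congr (_ *: (f _ - _)).
  by rewrite [h *: 1]mulr1 scalerDl addrCA.
case=> h1 h2; apply: DeriveDef.
  by rewrite /derivable -E.
by rewrite /derive -E.
Qed.

Lemma line_derive f p (v : 'rV[R]_2) (t d : R) :
  is_derive t 1 (fun s => f (p + s *: v)) d -> is_derive (p + t *: v) v f d.
Proof.
have E : (fun h : R => h^-1 *: ((f \o shift (p + t *: v)) (h *: v) - f (p + t *: v))) =
  (fun h : R => h^-1 *: (((fun s => f (p + s *: v)) \o shift t) (h *: 1) - f (p + t *: v))).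
  apply/funext => h; rewrite /= /shift /=; congr (_ *: (f _ - _)).
  by rewrite [h *: 1]mulr1 scalerDl addrCA.
case=> h1 h2; apply: DeriveDef.
  by rewrite /derivable E.
by rewrite /derive E.
Qed.

Lemma pd_val j f p d : is_derive p (e_ j) f d -> pd j f p = d.
Proof. by move=> h; rewrite /pd derive_val. Qed.

Lemma near_open D p : open D -> D p -> \forall q \near p, D q.
Proof. by move=> oD Dp; exact: open_nbhs_nbhs. Qed.

Lemma pd_ext D j f g p : open D -> D p -> (forall q, D q -> f q = g q) ->
  pd j f p = pd j g p.
Proof.
move=> oD Dp fg; apply: near_eq_derive.
by apply: filterS (near_open oD Dp) => q /fg.
Qed.

Lemma Ck_ext n D f g : open D -> (forall q, D q -> f q = g q) ->
  Ck_on n D f -> Ck_on n D g.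
Proof.
move=> oD; elim: n f g => [|n IH] f g fg /=.
  move=> fc p Dp; have E : \forall q \near p, f q = g q.
    by apply: filterS (near_open oD Dp) => q /fg.
  rewrite /prop_for /continuous_at -fg//.
  exact: cvg_trans (near_eq_cvg E) (fc p Dp).
move=> H j; have [fd fk] := H j; split.
  move=> p Dp; apply: near_eq_derivable (fd p Dp).
  by apply: filterS (near_open oD Dp) => q /fg.
by apply: IH fk => q Dq; exact: pd_ext Dq fg.
Qed.

Lemma smooth_ext D f g : open D -> (forall q, D q -> f q = g q) ->
  smooth_on D f -> smooth_on D g.
Proof. by move=> oD fg fs n; apply: Ck_ext fg (fs n). Qed.

Lemma smooth_continuous D f p : smooth_on D f -> D p -> {for p, continuous f}.
Proof. by move=> /(_ 0%N); exact. Qed.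

Lemma smooth_is_derive D j f p : smooth_on D f -> D p ->
  is_derive p (e_ j) f (pd j f p).
Proof. by move=> /(_ 1%N)/(_ j)[fd _] Dp; apply: DeriveDef => //; exact: fd. Qed.

Lemma smooth_pd D j f : smooth_on D f -> smooth_on D (pd j f).
Proof. by move=> fs n; have [] := fs n.+1 j. Qed.

Lemma smooth_cst D (k : R) : open D -> smooth_on D (fun=> k).
Proof.
move=> oD n; elim: n k => [|n IH] k /=; first by move=> p _; exact: cst_continuous.
move=> j; split; first by move=> p _; exact: derivable_cst.
apply: Ck_ext (IH 0) => // q _; apply/esym/pd_val; exact: is_derive_cst.
Qed.

Lemma is_deriveMR f g p v (df dg : R) : is_derive p v f df -> is_derive p v g dg ->
  is_derive p v (fun q => f q * g q) (df * g p + f p * dg).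
Proof.
move=> fd gd; rewrite addrC [df * _]mulrC.
exact: (@is_deriveM _ _ f g p v df dg fd gd).
Qed.

Lemma is_derive_expR_comp f p v (df : R) : is_derive p v f df ->
  is_derive p v (fun q => expR (f q)) (df * expR (f p)).
Proof.
move=> fd; have -> : p = p + 0 *: v by rewrite scale0r addr0.
apply: line_derive.
have fd' : is_derive (0 : R) 1 (fun s : R => f (p + s *: v)) df.
  by apply: derive_line; rewrite scale0r addr0.
have := @is_derive1_comp _ expR (fun s : R => f (p + s *: v)) 0 _ _ (is_derive_expR _) fd'.
by rewrite mulrC.
Qed.

(** [Ck_on n] speaks only about the derivatives of order [n]. The Leibniz rule mixes orders, so
    inductions carry all orders up to [n] at once. *)
Definition Ck_le n D f := forall k, (k <= n)%N -> Ck_on k D f.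

Lemma Ck_leS n D f : Ck_le n D f -> Ck_on n.+1 D f -> Ck_le n.+1 D f.
Proof. by move=> fn fS k; rewrite leq_eqVlt => /orP[/eqP->//|]; exact: fn. Qed.

Lemma Ck_leW n D f : Ck_le n.+1 D f -> Ck_le n D f.
Proof. by move=> fn k kn; apply: fn; exact: leqW. Qed.

Lemma Ck_le_is_derive n D j f p : Ck_le n.+1 D f -> D p ->
  is_derive p (e_ j) f (pd j f p).
Proof. by move=> /(_ 1%N isT)/(_ j)[fd _] Dp; apply: DeriveDef => //; exact: fd. Qed.

Lemma Ck_le_pd n D j f : Ck_le n.+1 D f -> Ck_le n D (pd j f).
Proof. by move=> fn k kn; have [] := fn k.+1 kn j. Qed.

Lemma Ck_onS n D f (df : 'I_2 -> 'rV[R]_2 -> R) : open D ->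
  (forall j p, D p -> is_derive p (e_ j) f (df j p)) ->
  (forall j, Ck_on n D (df j)) -> Ck_on n.+1 D f.
Proof.
move=> oD fd dfn j; split; first by move=> p /(fd j); case.
by apply: Ck_ext (dfn j) => // q /(fd j) /pd_val ->.
Qed.

Lemma Ck_leD n D f g : open D -> Ck_le n D f -> Ck_le n D g ->
  Ck_le n D (fun q => f q + g q).
Proof.
move=> oD; elim: n f g => [|n IH] f g fn gn.
  move=> [|//] _ p Dp; apply: continuousD; [exact: (fn 0%N isT p Dp)|].
  exact: (gn 0%N isT p Dp).
apply: Ck_leS; first by apply: IH; exact: Ck_leW.
apply: (Ck_onS (df := fun j p => pd j f p + pd j g p)) => // [j p Dp|j].
  by apply: is_deriveD; [exact: (Ck_le_is_derive j fn Dp)|exact: (Ck_le_is_derive j gn Dp)].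
by apply: (IH _ _ _ _ n) => //; exact: Ck_le_pd.
Qed.

Lemma Ck_leM n D f g : open D -> Ck_le n D f -> Ck_le n D g ->
  Ck_le n D (fun q => f q * g q).
Proof.
move=> oD; elim: n f g => [|n IH] f g fn gn.
  move=> [|//] _ p Dp; apply: continuousM; [exact: (fn 0%N isT p Dp)|].
  exact: (gn 0%N isT p Dp).
apply: Ck_leS; first by apply: IH; exact: Ck_leW.
apply: (Ck_onS (df := fun j p => pd j f p * g p + f p * pd j g p)) => // [j p Dp|j].
  by apply: is_deriveMR; [exact: (Ck_le_is_derive j fn Dp)|exact: (Ck_le_is_derive j gn Dp)].
apply: (@Ck_leD n) => //; apply: IH; first [exact: Ck_le_pd | exact: Ck_leW].
Qed.

Lemma Ck_le_expR n D f : open D -> Ck_le n D f -> Ck_le n D (fun q => expR (f q)).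
Proof.
move=> oD; elim: n f => [|n IH] f fn.
  move=> [|//] _ p Dp; apply: (@continuous_comp _ _ _ f expR); first exact: (fn 0%N isT p Dp).
  exact: continuous_expR.
apply: Ck_leS; first by apply: IH; exact: Ck_leW.
apply: (Ck_onS (df := fun j p => pd j f p * expR (f p))) => // [j p Dp|j].
  by apply: is_derive_expR_comp; exact: (Ck_le_is_derive j fn Dp).
by apply: (@Ck_leM n) => //; [exact: Ck_le_pd|apply: IH; exact: Ck_leW].
Qed.

Lemma smooth_le n D f : smooth_on D f -> Ck_le n D f.
Proof. by move=> fs k _. Qed.

Lemma smoothD D f g : open D -> smooth_on D f -> smooth_on D g ->
  smooth_on D (fun q => f q + g q).
Proof. by move=> oD fs gs n; apply: (@Ck_leD n) => //; exact: smooth_le. Qed.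

Lemma smoothM D f g : open D -> smooth_on D f -> smooth_on D g ->
  smooth_on D (fun q => f q * g q).
Proof. by move=> oD fs gs n; apply: (@Ck_leM n) => //; exact: smooth_le. Qed.

Lemma smooth_expR D f : open D -> smooth_on D f -> smooth_on D (fun q => expR (f q)).
Proof. by move=> oD fs n; apply: (@Ck_le_expR n) => //; exact: smooth_le. Qed.

Lemma smoothN D f : open D -> smooth_on D f -> smooth_on D (fun q => - f q).
Proof.
move=> oD fs; apply: (@smooth_ext _ (fun q => -1 * f q)) => //.
  by move=> q _; rewrite mulN1r.
by apply: smoothM => //; exact: smooth_cst.
Qed.

Lemma smoothB D f g : open D -> smooth_on D f -> smooth_on D g ->
  smooth_on D (fun q => f q - g q).
Proof. by move=> oD fs gs; apply: smoothD => //; exact: smoothN. Qed.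

End PlaneCalculus.

(** * Charts on squares and the symmetry of second derivatives *)

Section Chart.
Context {R : realType}.
Implicit Types (f g : 'rV[R]_2 -> R) (p q : 'rV[R]_2) (D : set 'rV[R]_2).
Local Notation e_ j := (delta_mx 0 j : 'rV[R]_2).

Lemma ord2 (j : 'I_2) : j = 0 \/ j = 1.
Proof. by case: j => -[|[|//]] jlt; [left|right]; exact: val_inj. Qed.

(** The x-term comes last so that horizontal lines have literally the form [p + s *: v] of
    [derive_line]; [chartC] gives the order suited to vertical lines. *)
Definition chart p0 (q : R * R) : 'rV[R]_2 := p0 + q.2 *: e_ 1 + q.1 *: e_ 0.
Definition unchart p0 p : R * R := (p 0 0 - p0 0 0, p 0 1 - p0 0 1).

Lemma chartC p0 x y : chart p0 (x, y) = p0 + x *: e_ 0 + y *: e_ 1.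
Proof. by rewrite /chart /= addrAC. Qed.

Lemma chart0 p0 : chart p0 (0, 0) = p0.
Proof. by rewrite /chart !scale0r !addr0. Qed.

Lemma unchartK p0 p : chart p0 (unchart p0 p) = p.
Proof.
apply/matrixP => i j; rewrite ord1 !mxE /=.
have [->|->] := ord2 j; rewrite /= ?mulr1 ?mulr0 ?addr0 addrC subrK//.
Qed.

Lemma chartK p0 (q : R * R) : unchart p0 (chart p0 q) = q.
Proof.
case: q => x y; rewrite /unchart /chart !mxE /= !mulr1 !mulr0 !addr0.
by congr pair; rewrite addrAC subrr add0r.
Qed.

Lemma chart_continuous p0 : continuous (chart p0).
Proof.
move=> [x y]; rewrite /chart.
have h1 : {for (x, y), continuous (fun q : R * R => q.1 *: e_ 0)}.
  by apply: (@cvgZl _ _ _ _ _ fst); exact: cvg_fst.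
have h2 : {for (x, y), continuous (fun q : R * R => q.2 *: e_ 1)}.
  by apply: (@cvgZl _ _ _ _ _ snd); exact: cvg_snd.
have h3 : {for (x, y), continuous (fun q : R * R => p0 + q.2 *: e_ 1)}.
  by apply: (@continuousD _ _ _ (fun=> p0)) => //; exact: cst_continuous.
exact: (continuousD h3 h1).
Qed.

Lemma coord_continuous_at i (p : 'rV[R]_2) : {for p, continuous (fun q : 'rV[R]_2 => q 0 i)}.
Proof. exact: coord_continuous. Qed.

Lemma unchart_continuous p0 : continuous (unchart p0).
Proof.
move=> p; apply: (@pair_continuous _ _ _ (fun p => p 0 0 - p0 0 0) (fun p => p 0 1 - p0 0 1)).
  by apply: continuousB; [exact: coord_continuous_at|exact: cst_continuous].
by apply: continuousB; [exact: coord_continuous_at|exact: cst_continuous].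
Qed.

Lemma near_box p0 (P : 'rV[R]_2 -> Prop) : (\forall p \near p0, P p) ->
  exists2 e : R, 0 < e & forall x y, `|x| < e -> `|y| < e -> P (chart p0 (x, y)).
Proof.
move=> /nbhs_ballP[e /= e0 eP]; exists e => // x y xe ye; apply: eP.
split=> // i j; rewrite ord1 /ball /= !mxE /=.
have [->|->] := ord2 j; rewrite /= ?mulr1 ?mulr0 ?addr0.
  by rewrite opprD addrA subrr sub0r normrN.
by rewrite opprD addrA subrr sub0r normrN.
Qed.

(** Data that are continuous only on [D] become continuous on the whole plane, as primitives
    require. *)
Lemma clamp_chart_continuous p0 (r : R) D f : 0 < r ->
  (forall x y, `|x| <= r -> `|y| <= r -> D (chart p0 (x, y))) ->
  (forall p, D p -> {for p, continuous f}) ->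
  continuous (fun q : R * R => f (chart p0 (clamp2 r q))).
Proof.
move=> r0 rD fc q; apply: (@continuous_comp _ _ _ (chart p0 \o clamp2 r) f).
  by apply: continuous_comp; [exact: clamp2_continuous|exact: chart_continuous].
by apply: fc; apply: rD; exact: clamp_norm.
Qed.

Lemma chart_dx p0 (r x y d : R) f : `|x| < r -> `|y| < r ->
  is_derive (chart p0 (x, y)) (e_ 0) f d ->
  is_derive x 1 (fun s => f (chart p0 (clamp2 r (s, y)))) d.
Proof.
move=> xr yr fd; apply: (@near_eq_is_derive _ _ _ (fun s => f (chart p0 (s, y)))).
  have : \forall t \near x, `|t| < r.
    by apply: (cvgr_lt `|x| (@norm_continuous _ _ x)).
  by apply: filterS => t tr; rewrite /clamp2 /= !clamp_id ?ltW.
exact: (@derive_line _ f (p0 + y *: e_ 1)).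
Qed.

Lemma chart_dy p0 (r x y d : R) f : `|x| < r -> `|y| < r ->
  is_derive (chart p0 (x, y)) (e_ 1) f d ->
  is_derive y 1 (fun s => f (chart p0 (clamp2 r (x, s)))) d.
Proof.
move=> xr yr fd; apply: (@near_eq_is_derive _ _ _ (fun s => f (chart p0 (x, s)))).
  have : \forall t \near y, `|t| < r.
    by apply: (cvgr_lt `|y| (@norm_continuous _ _ y)).
  by apply: filterS => t tr; rewrite /clamp2 /= !clamp_id ?ltW.
rewrite chartC in fd; under eq_fun do rewrite chartC.
exact: derive_line.
Qed.

Lemma unchart_dx p0 (x y d : R) (G : R * R -> R) :
  is_derive x 1 (fun s => G (s, y)) d ->
  is_derive (chart p0 (x, y)) (e_ 0) (fun p => G (unchart p0 p)) d.
Proof.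
move=> Gd; apply: (@line_derive _ (fun p => G (unchart p0 p)) (p0 + y *: e_ 1)).
by under eq_fun do rewrite -[X in unchart _ X]/(chart p0 (_, y)) chartK.
Qed.

Lemma unchart_dy p0 (x y d : R) (G : R * R -> R) :
  is_derive y 1 (fun s => G (x, s)) d ->
  is_derive (chart p0 (x, y)) (e_ 1) (fun p => G (unchart p0 p)) d.
Proof.
move=> Gd; rewrite chartC.
apply: (@line_derive _ (fun p => G (unchart p0 p)) (p0 + x *: e_ 0)).
by under eq_fun do rewrite -chartC chartK.
Qed.

(** By Fubini the double primitives of both mixed derivatives are the same second difference of [f]
    over a rectangle with a corner at [p0]. Differentiating this identity at the origin, in x and
    then in y, recovers the values at [p0]. *)
Lemma pd_comm D f p0 : open D -> smooth_on D f -> D p0 ->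
  pd 0 (pd 1 f) p0 = pd 1 (pd 0 f) p0.
Proof.
move=> oD fs Dp0.
have [e e0 eD] := near_box (near_open oD Dp0).
pose r := e / 2; have r0 : 0 < r by rewrite /r; lra.
have rD x y : `|x| <= r -> `|y| <= r -> D (chart p0 (x, y)).
  by move=> xr yr; apply: eD; rewrite /r in xr yr *; lra.
pose g := pd 0 (pd 1 f); pose h := pd 1 (pd 0 f).
pose cl k := fun q : R * R => k (chart p0 (clamp2 r q)) : R.
have clc k : smooth_on D k -> continuous (cl k).
  move=> ks; apply: (@clamp_chart_continuous p0 r D) => // p Dp.
  exact: smooth_continuous ks Dp.
have s1 j := smooth_pd j fs; have s2 i j := smooth_pd i (s1 j).
have gc : continuous (cl g) by exact: (clc _ (s2 0 1)).
have hc : continuous (cl h) by exact: (clc _ (s2 1 0)).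
have z : `|0 : R| < r by rewrite normr0.
have dx k (x y : R) : smooth_on D k -> `|x| < r -> `|y| < r ->
    is_derive x 1 (fun s => cl k (s, y)) (cl (pd 0 k) (x, y)).
  move=> ks xr yr; apply: chart_dx => //; rewrite /cl /clamp2 /= !clamp_id ?ltW//.
  by apply: smooth_is_derive ks _; apply: rD; exact: ltW.
have dy k (x y : R) : smooth_on D k -> `|x| < r -> `|y| < r ->
    is_derive y 1 (fun s => cl k (x, s)) (cl (pd 1 k) (x, y)).
  move=> ks xr yr; apply: chart_dy => //; rewrite /cl /clamp2 /= !clamp_id ?ltW//.
  by apply: smooth_is_derive ks _; apply: rD; exact: ltW.
have PXE k x y : smooth_on D k -> `|x| < r -> `|y| < r ->
    PX (cl (pd 0 k)) (x, y) = cl k (x, y) - cl k (0, y).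
  move=> ks xr yr; have hh := @continuous_slicel _ _ y (clc _ (smooth_pd 0 ks)).
  by rewrite /PX -(@prim_unique _ _ (fun s => cl k (s, y)) r x hh (fun s sr => dx k s y ks sr yr) xr).
have PYE k x y : smooth_on D k -> `|x| < r -> `|y| < r ->
    PY (cl (pd 1 k)) (x, y) = cl k (x, y) - cl k (x, 0).
  move=> ks xr yr; have hh := @continuous_slicer _ _ x (clc _ (smooth_pd 1 ks)).
  by rewrite /PY -(@prim_unique _ _ (fun s => cl k (x, s)) r y hh (fun s sr => dy k x s ks xr sr) yr).
have cB (k : R * R -> R) : continuous k -> continuous (fun q : R * R => k (0, q.2)).
  move=> kc q; apply: (@continuous_comp _ _ _ (fun q : R * R => (0 : R, q.2)) k) => //; last exact: kc.
  case: q => ? ?; apply: (@pair_continuous _ _ _ (fun=> 0) snd); [exact: cst_continuous|exact: cvg_snd].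
have cB' (k : R * R -> R) : continuous k -> continuous (fun q : R * R => k (q.1, 0)).
  move=> kc q; apply: (@continuous_comp _ _ _ (fun q : R * R => (q.1, 0 : R)) k) => //; last exact: kc.
  exact: axis_continuous.
have D1 x y : `|x| < r -> `|y| < r ->
    PX (PY (cl g)) (x, y) = cl f (x, y) - cl f (0, y) - (cl f (x, 0) - cl f (0, 0)).
  move=> xr yr; rewrite Fubini_PXPY//.
  have c1 : continuous (cl (pd 1 f)) by exact: clc.
  rewrite (@PY_ext _ _ (fun q : R * R => cl (pd 1 f) q - cl (pd 1 f) (0, q.2)) r) //; last 3 first.
  - exact: PX_continuous.
  - exact: (contB c1 (cB _ c1)).
  - by move=> t tr; rewrite PXE.
  rewrite /PY primB; [|exact: continuous_slicer|exact: continuous_slicer (cB _ c1)].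
  rewrite -[prim _ _]/(PY (cl (pd 1 f)) (x, y)) -[X in _ - X]/(PY (cl (pd 1 f)) (0, y)).
  by rewrite !PYE//; ring.
have D2 x y : `|x| < r -> `|y| < r ->
    PX (PY (cl h)) (x, y) = cl f (x, y) - cl f (0, y) - (cl f (x, 0) - cl f (0, 0)).
  move=> xr yr.
  have c1 : continuous (cl (pd 0 f)) by exact: clc.
  rewrite (@PX_ext _ _ (fun q : R * R => cl (pd 0 f) q - cl (pd 0 f) (q.1, 0)) r) //; last 3 first.
  - exact: PY_continuous.
  - exact: (contB c1 (cB' _ c1)).
  - by move=> t tr; rewrite PYE.
  rewrite /PX primB; [|exact: continuous_slicel|exact: continuous_slicel (cB' _ c1)].
  rewrite -[prim _ _]/(PX (cl (pd 0 f)) (x, y)) -[X in _ - X]/(PX (cl (pd 0 f)) (x, 0)).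
  by rewrite !PXE//; ring.
have nr : \forall t \near (0 : R), `|t| < r by exact: nbhs0_lt.
have deq (k1 k2 : R -> R) (d1 d2 : R) : is_derive (0 : R) 1 k1 d1 -> is_derive (0 : R) 1 k2 d2 ->
    (forall s, `|s| < r -> k1 s = k2 s) -> d1 = d2.
  case=> _ H1 [_ H2] k12; rewrite -H1 -H2.
  by apply: near_eq_derive; apply: filterS nr => s /k12.
have E1 y : `|y| < r -> PY (cl g) (0, y) = PY (cl h) (0, y).
  move=> yr; apply: (deq _ _ _ _ (PX_derive 0 y (PY_continuous gc)) (PX_derive 0 y (PY_continuous hc))).
  by move=> s sr; exact: (etrans (D1 s y sr yr) (esym (D2 s y sr yr))).
have : cl g (0, 0) = cl h (0, 0).
  by apply: (deq _ _ _ _ (PY_derive 0 0 gc) (PY_derive 0 0 hc)) => s sr; exact: E1.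
have cc : chart p0 (clamp2 r (0, 0)) = p0 by rewrite /clamp2 /= (clamp_id (ltW z)) chart0.
by rewrite /cl cc.
Qed.

End Chart.

(** * Derivatives of complex-valued functions *)

Section ComplexCalculus.
Context {R : realType}.
Implicit Types (f g : 'rV[R]_2 -> R[i]) (p q : 'rV[R]_2) (D : set 'rV[R]_2).
Local Notation e_ j := (delta_mx 0 j : 'rV[R]_2).

Lemma cReD (x y : R[i]) : Re (x + y) = Re x + Re y. Proof. by case: x; case: y. Qed.
Lemma cImD (x y : R[i]) : Im (x + y) = Im x + Im y. Proof. by case: x; case: y. Qed.
Lemma cReN (x : R[i]) : Re (- x) = - Re x. Proof. by case: x. Qed.
Lemma cImN (x : R[i]) : Im (- x) = - Im x. Proof. by case: x. Qed.
Lemma cReM (x y : R[i]) : Re (x * y) = Re x * Re y - Im x * Im y.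
Proof. by case: x; case: y. Qed.
Lemma cImM (x y : R[i]) : Im (x * y) = Re x * Im y + Im x * Re y.
Proof. by case: x; case: y. Qed.
Lemma cReJ (x : R[i]) : Re (x^*) = Re x. Proof. by case: x. Qed.
Lemma cImJ (x : R[i]) : Im (x^*) = - Im x. Proof. by case: x. Qed.
Lemma Re_sum (I : Type) (r : seq I) (F : I -> R[i]) :
  Re (\sum_(i <- r) F i) = \sum_(i <- r) Re (F i).
Proof. by elim: r => [|i r IH]; rewrite ?big_nil// !big_cons cReD IH. Qed.
Lemma Im_sum (I : Type) (r : seq I) (F : I -> R[i]) :
  Im (\sum_(i <- r) F i) = \sum_(i <- r) Im (F i).
Proof. by elim: r => [|i r IH]; rewrite ?big_nil// !big_cons cImD IH. Qed.
Lemma complex_eq (x y : R[i]) : Re x = Re y -> Im x = Im y -> x = y.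
Proof. by case: x y => a b [c d] /= -> ->. Qed.

Definition has_cpd (j : 'I_2) f p (d : R[i]) :=
  is_derive p (e_ j) (fun q => Re (f q)) (Re d) /\
  is_derive p (e_ j) (fun q => Im (f q)) (Im d).

Lemma has_cpd_val j f p d : has_cpd j f p d -> cpd j f p = d.
Proof. by case=> h1 h2; rewrite /cpd (pd_val h1) (pd_val h2); case: d {h1 h2}. Qed.

Lemma has_cpd_eq j f p d d' : d = d' -> has_cpd j f p d -> has_cpd j f p d'.
Proof. by move=> ->. Qed.

Lemma has_cpd_near j f g p d : (\forall q \near p, f q = g q) ->
  has_cpd j f p d -> has_cpd j g p d.
Proof.
by move=> fg [h1 h2]; split;
  [apply: near_eq_is_derive h1|apply: near_eq_is_derive h2]; apply: filterS fg => q ->.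
Qed.

Lemma has_cpd_cst j (k : R[i]) p : has_cpd j (fun=> k) p 0.
Proof. by split; exact: is_derive_cst. Qed.

Lemma has_cpdD j f g p df dg : has_cpd j f p df -> has_cpd j g p dg ->
  has_cpd j (fun q => f q + g q) p (df + dg).
Proof.
move=> [f1 f2] [g1 g2]; split; rewrite ?cReD ?cImD.
  by under eq_fun do rewrite cReD; exact: is_deriveD.
by under eq_fun do rewrite cImD; exact: is_deriveD.
Qed.

Lemma has_cpdN j f p df : has_cpd j f p df -> has_cpd j (fun q => - f q) p (- df).
Proof.
move=> [f1 f2]; split; rewrite ?cReN ?cImN.
  by under eq_fun do rewrite cReN; exact: is_deriveN.
by under eq_fun do rewrite cImN; exact: is_deriveN.
Qed.

Lemma has_cpdM j f g p df dg : has_cpd j f p df -> has_cpd j g p dg ->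
  has_cpd j (fun q => f q * g q) p (df * g p + f p * dg).
Proof.
move=> [f1 f2] [g1 g2]; split.
  under eq_fun do rewrite cReM; rewrite cReD !cReM addrACA -opprD.
  by apply: is_deriveB; apply: is_deriveMR.
under eq_fun do rewrite cImM; rewrite cImD !cImM addrACA.
by apply: is_deriveD; apply: is_deriveMR.
Qed.

Lemma has_cpdJ j f p df : has_cpd j f p df -> has_cpd j (fun q => (f q)^*) p (df^*).
Proof.
move=> [f1 f2]; split; rewrite ?cReJ ?cImJ.
  by under eq_fun do rewrite cReJ.
by under eq_fun do rewrite cImJ; exact: is_deriveN.
Qed.

Lemma has_cpd_real j (f : 'rV[R]_2 -> R) p (d : R) : is_derive p (e_ j) f d ->
  has_cpd j (fun q => (f q)%:C) p d%:C.
Proof. by move=> fd; split => //=; exact: is_derive_cst. Qed.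

Lemma has_cpd_sum (I : Type) (r : seq I) j (F : I -> 'rV[R]_2 -> R[i]) p (d : I -> R[i]) :
  (forall i, has_cpd j (F i) p (d i)) ->
  has_cpd j (fun q => \sum_(i <- r) F i q) p (\sum_(i <- r) d i).
Proof.
move=> Fd; elim: r => [|i r IH].
  by rewrite big_nil; under eq_fun do rewrite big_nil; exact: has_cpd_cst.
by rewrite big_cons; under eq_fun do rewrite big_cons; exact: has_cpdD.
Qed.

Lemma csmooth_has_cpd D j f p : csmooth_on D f -> D p -> has_cpd j f p (cpd j f p).
Proof. by move=> [f1 f2] Dp; split; exact: smooth_is_derive Dp. Qed.

Lemma csmooth_cpd D j f : csmooth_on D f -> csmooth_on D (cpd j f).
Proof. by move=> [f1 f2]; split; exact: smooth_pd. Qed.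

Lemma csmooth_cst D (k : R[i]) : open D -> csmooth_on D (fun=> k).
Proof. by move=> oD; split; exact: smooth_cst. Qed.

Lemma csmoothD D f g : open D -> csmooth_on D f -> csmooth_on D g ->
  csmooth_on D (fun q => f q + g q).
Proof.
move=> oD [f1 f2] [g1 g2]; split.
  by under eq_fun do rewrite cReD; exact: smoothD.
by under eq_fun do rewrite cImD; exact: smoothD.
Qed.

Lemma csmoothM D f g : open D -> csmooth_on D f -> csmooth_on D g ->
  csmooth_on D (fun q => f q * g q).
Proof.
move=> oD [f1 f2] [g1 g2]; split.
  by under eq_fun do rewrite cReM; apply: smoothB => //; exact: smoothM.
by under eq_fun do rewrite cImM; apply: smoothD => //; exact: smoothM.
Qed.

Lemma csmoothN D f : open D -> csmooth_on D f -> csmooth_on D (fun q => - f q).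
Proof.
move=> oD [f1 f2]; split.
  by under eq_fun do rewrite cReN; exact: smoothN.
by under eq_fun do rewrite cImN; exact: smoothN.
Qed.

Lemma csmoothB D f g : open D -> csmooth_on D f -> csmooth_on D g ->
  csmooth_on D (fun q => f q - g q).
Proof. by move=> oD fs gs; apply: csmoothD => //; exact: csmoothN. Qed.

Lemma csmoothZ D (k : R[i]) f : open D -> csmooth_on D f ->
  csmooth_on D (fun q => k * f q).
Proof. by move=> oD fs; apply: csmoothM => //; exact: csmooth_cst. Qed.

Lemma csmoothJ D f : open D -> csmooth_on D f -> csmooth_on D (fun q => (f q)^*).
Proof.
move=> oD [f1 f2]; split.
  by under eq_fun do rewrite cReJ.
by under eq_fun do rewrite cImJ; exact: smoothN.
Qed.

Lemma csmooth_real D (f : 'rV[R]_2 -> R) : open D -> smooth_on D f ->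
  csmooth_on D (fun q => (f q)%:C).
Proof. by move=> oD fs; split => //=; exact: smooth_cst. Qed.

Lemma csmooth_sum D (I : Type) (r : seq I) (F : I -> 'rV[R]_2 -> R[i]) : open D ->
  (forall i, csmooth_on D (F i)) -> csmooth_on D (fun q => \sum_(i <- r) F i q).
Proof.
move=> oD Fs; elim: r => [|i r IH].
  by under eq_fun do rewrite big_nil; exact: csmooth_cst.
by under eq_fun do rewrite big_cons; exact: csmoothD.
Qed.

Lemma cpd_comm D f p : open D -> csmooth_on D f -> D p ->
  cpd 0 (cpd 1 f) p = cpd 1 (cpd 0 f) p.
Proof.
by move=> oD [f1 f2] Dp; rewrite /cpd /= (pd_comm oD f1 Dp) (pd_comm oD f2 Dp).
Qed.

End ComplexCalculus.

(** * Derivatives and regularity of matrix-valued functions *)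

Section MatrixCalculus.
Context {R : realType}.
Implicit Types (p q : 'rV[R]_2) (D : set 'rV[R]_2).
Local Notation e_ j := (delta_mx 0 j : 'rV[R]_2).

Definition has_mpd m n (j : 'I_2) (F : 'rV[R]_2 -> 'M[R[i]]_(m, n)) p (M : 'M[R[i]]_(m, n)) :=
  forall i k, has_cpd j (fun q => F q i k) p (M i k).

Lemma mxpdE m n j (F : 'rV[R]_2 -> 'M[R[i]]_(m, n)) p i k :
  mxpd j F p i k = cpd j (fun q => F q i k) p.
Proof. by rewrite mxE. Qed.

Lemma has_mpd_val m n j (F : 'rV[R]_2 -> 'M[R[i]]_(m, n)) p M :
  has_mpd j F p M -> mxpd j F p = M.
Proof. by move=> h; apply/matrixP => i k; rewrite mxE; exact: has_cpd_val. Qed.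

Lemma has_mpd_near m n j (F G : 'rV[R]_2 -> 'M[R[i]]_(m, n)) p M :
  (\forall q \near p, F q = G q) -> has_mpd j F p M -> has_mpd j G p M.
Proof.
by move=> FG Fd i k; apply: has_cpd_near (Fd i k); apply: filterS FG => q ->.
Qed.

Lemma has_mpd_cst m n j (M : 'M[R[i]]_(m, n)) p : has_mpd j (fun=> M) p 0.
Proof. by move=> i k; rewrite mxE; exact: has_cpd_cst. Qed.

Lemma has_mpdD m n j (F G : 'rV[R]_2 -> 'M[R[i]]_(m, n)) p dF dG :
  has_mpd j F p dF -> has_mpd j G p dG -> has_mpd j (fun q => F q + G q) p (dF + dG).
Proof.
by move=> Fd Gd i k; rewrite mxE; under eq_fun do rewrite mxE; exact: has_cpdD.
Qed.

Lemma has_mpdM m n k j (F : 'rV[R]_2 -> 'M[R[i]]_(m, n)) (G : 'rV[R]_2 -> 'M[R[i]]_(n, k)) p dF dG :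
  has_mpd j F p dF -> has_mpd j G p dG ->
  has_mpd j (fun q => F q *m G q) p (dF *m G p + F p *m dG).
Proof.
move=> Fd Gd i l; rewrite !mxE -big_split/=.
by under eq_fun do rewrite mxE; apply: has_cpd_sum => s; exact: has_cpdM.
Qed.

Lemma has_mpdZ m n j (f : 'rV[R]_2 -> R[i]) (F : 'rV[R]_2 -> 'M[R[i]]_(m, n)) p df dF :
  has_cpd j f p df -> has_mpd j F p dF ->
  has_mpd j (fun q => f q *: F q) p (df *: F p + f p *: dF).
Proof.
by move=> fd Fd i k; rewrite !mxE; under eq_fun do rewrite mxE; exact: has_cpdM.
Qed.

Lemma has_mpd_tr m n j (F : 'rV[R]_2 -> 'M[R[i]]_(m, n)) p dF :
  has_mpd j F p dF -> has_mpd j (fun q => (F q)^T) p dF^T.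
Proof. by move=> Fd i k; rewrite mxE; under eq_fun do rewrite mxE; exact: Fd. Qed.

Lemma mxsmooth_has_mpd m n D j (F : 'rV[R]_2 -> 'M[R[i]]_(m, n)) p :
  mxsmooth_on D F -> D p -> has_mpd j F p (mxpd j F p).
Proof. by move=> Fs Dp i k; rewrite mxE; exact: csmooth_has_cpd Dp. Qed.

Lemma mxsmooth_mxpd m n D j (F : 'rV[R]_2 -> 'M[R[i]]_(m, n)) :
  mxsmooth_on D F -> mxsmooth_on D (mxpd j F).
Proof. by move=> Fs i k; under eq_fun do rewrite mxE; exact: csmooth_cpd. Qed.

Lemma mxsmoothM m n k D (F : 'rV[R]_2 -> 'M[R[i]]_(m, n)) (G : 'rV[R]_2 -> 'M[R[i]]_(n, k)) :
  open D -> mxsmooth_on D F -> mxsmooth_on D G -> mxsmooth_on D (fun q => F q *m G q).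
Proof.
move=> oD Fs Gs i j; under eq_fun do rewrite mxE.
by apply: csmooth_sum => // l; exact: csmoothM.
Qed.

Lemma mxsmooth_cst m n D (M : 'M[R[i]]_(m, n)) : open D -> mxsmooth_on D (fun=> M).
Proof. by move=> oD i j; exact: csmooth_cst. Qed.

Lemma mxpd_comm m n D (F : 'rV[R]_2 -> 'M[R[i]]_(m, n)) p : open D -> mxsmooth_on D F -> D p ->
  mxpd 0 (mxpd 1 F) p = mxpd 1 (mxpd 0 F) p.
Proof.
move=> oD Fs Dp; apply/matrixP => i j; rewrite [LHS]mxpdE [RHS]mxpdE.
have E k : (fun q => mxpd k F q i j) = cpd k (fun q => F q i j).
  by apply/funext => q; rewrite mxpdE.
by rewrite !E (cpd_comm oD (Fs i j) Dp).
Qed.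

Definition mxcont m n (F : 'rV[R]_2 -> 'M[R[i]]_(m, n)) p := forall i k,
  {for p, continuous (fun q => Re (F q i k))} /\ {for p, continuous (fun q => Im (F q i k))}.

Lemma near_continuous (f g : 'rV[R]_2 -> R) p : (\forall q \near p, f q = g q) ->
  {for p, continuous f} -> {for p, continuous g}.
Proof.
move=> fg fc; rewrite /prop_for /continuous_at -(nbhs_singleton fg).
exact: cvg_trans (near_eq_cvg fg) fc.
Qed.

Lemma mxcont_near m n (F G : 'rV[R]_2 -> 'M[R[i]]_(m, n)) p : (\forall q \near p, F q = G q) ->
  mxcont F p -> mxcont G p.
Proof.
move=> FG Fc i k; have [h1 h2] := Fc i k.
by split; [apply: near_continuous h1|apply: near_continuous h2]; apply: filterS FG => q ->.
Qed.

Lemma cont_sum_at (I : Type) (r : seq I) (F : I -> 'rV[R]_2 -> R) p :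
  (forall i, {for p, continuous (F i)}) -> {for p, continuous (fun q => \sum_(i <- r) F i q)}.
Proof.
move=> Fc; elim: r => [|i r IH].
  rewrite (_ : (fun q => _) = fun=> 0); first exact: cst_continuous.
  by apply/funext => q; rewrite big_nil.
rewrite (_ : (fun q => _) = fun q => F i q + \sum_(i <- r) F i q).
  exact: continuousD.
by apply/funext => q; rewrite big_cons.
Qed.

Lemma mxcont_mull m n k (M : 'M[R[i]]_(m, n)) (F : 'rV[R]_2 -> 'M[R[i]]_(n, k)) p :
  mxcont F p -> mxcont (fun q => M *m F q) p.
Proof.
move=> Fc i l; split.
  rewrite (_ : (fun q => _) = fun q => \sum_s (Re (M i s) * Re (F q s l) - Im (M i s) * Im (F q s l))).
    apply: cont_sum_at => s; have [h1 h2] := Fc s l.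
    have c (x : R) : {for p, continuous (fun _ : 'rV[R]_2 => x)} by exact: cst_continuous.
    exact: (continuousB (continuousM (c (Re (M i s))) h1) (continuousM (c (Im (M i s))) h2)).
  by apply/funext => q; rewrite mxE Re_sum; apply: eq_bigr => s _; rewrite cReM.
rewrite (_ : (fun q => _) = fun q => \sum_s (Re (M i s) * Im (F q s l) + Im (M i s) * Re (F q s l))).
  apply: cont_sum_at => s; have [h1 h2] := Fc s l.
  have c (x : R) : {for p, continuous (fun _ : 'rV[R]_2 => x)} by exact: cst_continuous.
  exact: (continuousD (continuousM (c (Re (M i s))) h2) (continuousM (c (Im (M i s))) h1)).
by apply/funext => q; rewrite mxE Im_sum; apply: eq_bigr => s _; rewrite cImM.
Qed.

Definition cCk_le n D (f : 'rV[R]_2 -> R[i]) :=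
  Ck_le n D (fun q => Re (f q)) /\ Ck_le n D (fun q => Im (f q)).

Lemma cCk_leM n D f g : open D -> cCk_le n D f -> cCk_le n D g -> cCk_le n D (fun q => f q * g q).
Proof.
have N h : open D -> Ck_le n D h -> Ck_le n D (fun q => - h q).
  move=> oD hk; rewrite (_ : (fun q => _) = fun q => -1 * h q).
    by apply: Ck_leM => //; apply: smooth_le; exact: smooth_cst.
  by apply/funext => q; rewrite mulN1r.
move=> oD [f1 f2] [g1 g2]; split.
  rewrite (_ : (fun q => _) = fun q => Re (f q) * Re (g q) + - (Im (f q) * Im (g q))).
    by apply: Ck_leD => //; [exact: Ck_leM|apply: N => //; exact: Ck_leM].
  by apply/funext => q; rewrite cReM.
rewrite (_ : (fun q => _) = fun q => Re (f q) * Im (g q) + Im (f q) * Re (g q)).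
  by apply: Ck_leD => //; exact: Ck_leM.
by apply/funext => q; rewrite cImM.
Qed.

Lemma cCk_le_sum n D (I : Type) (r : seq I) (F : I -> 'rV[R]_2 -> R[i]) : open D ->
  (forall i, cCk_le n D (F i)) -> cCk_le n D (fun q => \sum_(i <- r) F i q).
Proof.
move=> oD Fk; elim: r => [|i r [IH1 IH2]].
  rewrite (_ : (fun q => _) = fun=> 0).
    by split; apply: smooth_le; exact: smooth_cst.
  by apply/funext => q; rewrite big_nil.
have [F1 F2] := Fk i.
rewrite (_ : (fun q => _) = fun q => F i q + \sum_(i <- r) F i q); last first.
  by apply/funext => q; rewrite big_cons.
split.
  rewrite (_ : (fun q => _) = fun q => Re (F i q) + Re (\sum_(i <- r) F i q)).
    exact: Ck_leD.
  by apply/funext => q; rewrite cReD.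
rewrite (_ : (fun q => _) = fun q => Im (F i q) + Im (\sum_(i <- r) F i q)).
  exact: Ck_leD.
by apply/funext => q; rewrite cImD.
Qed.

(** Bootstrap: if [F] is of class C^l then so are its derivatives [F A j], hence [F] is of class
    C^(l+1). *)
Lemma solution_smooth m n D (A : 'I_2 -> 'rV[R]_2 -> 'M[R[i]]_n) (F : 'rV[R]_2 -> 'M[R[i]]_(m, n)) :
  open D -> (forall j, mxsmooth_on D (A j)) -> (forall p, D p -> mxcont F p) ->
  (forall p j, D p -> has_mpd j F p (F p *m A j p)) -> mxsmooth_on D F.
Proof.
move=> oD As Fc Fd.
have K l : forall i k, cCk_le l D (fun q => F q i k).
  elim: l => [|l IH] i k.
    by split=> -[|//] _ p Dp; have [h1 h2] := Fc p Dp i k.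
  have H j : cCk_le l D (fun q => (F q *m A j q) i k).
    rewrite (_ : (fun q => _) = fun q => \sum_s F q i s * A j q s k).
      apply: cCk_le_sum => // s; apply: cCk_leM => //.
      by have [a1 a2] := As j s k; split; exact: smooth_le.
    by apply/funext => q; rewrite mxE.
  have [IH1 IH2] := IH i k; split; apply: Ck_leS => //.
    apply: (Ck_onS (df := fun j p => Re ((F p *m A j p) i k))) => // [j p Dp|j].
      by have [] := Fd p j Dp i k.
    by have [h _] := H j; exact: h.
  apply: (Ck_onS (df := fun j p => Im ((F p *m A j p) i k))) => // [j p Dp|j].
    by have [] := Fd p j Dp i k.
  by have [_ h] := H j; exact: h.
by move=> i k; split=> l; have [h1 h2] := K l i k; [exact: h1|exact: h2].
Qed.

Lemma ball_chart p0 (r x y : R) : ball p0 r (chart p0 (x, y)) <-> `|x| < r /\ `|y| < r.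
Proof.
have E0 : chart p0 (x, y) 0 0 - p0 0 0 = x by have [] := chartK p0 (x, y).
have E1 : chart p0 (x, y) 0 1 - p0 0 1 = y by have [] := chartK p0 (x, y).
split=> [[_ h]|[xr yr]].
  by split; [have := h 0 0; rewrite /ball/= distrC E0|have := h 0 1; rewrite /ball/= distrC E1].
split; first exact: le_lt_trans xr.
by move=> i j; rewrite ord1 /ball /= distrC; have [->|->] := ord2 j; rewrite ?E0 ?E1.
Qed.

(** The ball is a square for the sup norm, so with a point [(x, y)] it contains the broken line
    through [(0, y)] to the centre. *)
Lemma is_derive0_ball (f : 'rV[R]_2 -> R) p0 (r : R) :
  (forall p j, ball p0 r p -> is_derive p (e_ j) f 0) ->
  forall p, ball p0 r p -> f p = f p0.
Proof.
move=> fd p; rewrite -(unchartK p0 p); case: (unchart p0 p) => x y.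
move=> h; have [xr yr] := (ball_chart p0 r x y).1 h.
have z : `|0 : R| < r by rewrite normr0; apply: le_lt_trans xr.
transitivity (f (chart p0 (0, y))).
  apply: (@is_derive_unique _ (fun s => f (chart p0 (s, y))) (fun=> f (chart p0 (0, y))) (fun=> 0) r) => //.
  move=> s sr; apply: (@derive_line _ f (p0 + y *: e_ 1)).
  by apply: fd; apply/(ball_chart p0 r s y).
rewrite -[in RHS](chart0 p0).
apply: (@is_derive_unique _ (fun s => f (chart p0 (0, s))) (fun=> f (chart p0 (0, 0))) (fun=> 0) r) => //.
move=> s sr; under eq_fun do rewrite chartC.
by apply: derive_line; rewrite -chartC; apply: fd; exact/ball_chart.
Qed.

Lemma has_mpd0_ball m n (F : 'rV[R]_2 -> 'M[R[i]]_(m, n)) p0 (r : R) :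
  (forall p j, ball p0 r p -> has_mpd j F p 0) ->
  forall p, ball p0 r p -> F p = F p0.
Proof.
move=> Fd p rp; apply/matrixP => i k; apply: complex_eq.
  apply: (@is_derive0_ball (fun q => Re (F q i k)) p0 r) => // q j rq.
  by have [] := Fd q j rq i k; rewrite mxE.
apply: (@is_derive0_ball (fun q => Im (F q i k)) p0 r) => // q j rq.
by have [] := Fd q j rq i k; rewrite mxE.
Qed.

End MatrixCalculus.

(** * Local solutions and monodromy *)

Section LocalSolution.
Context {R : realType} {n : nat}.
Implicit Types (p q : 'rV[R]_2) (D U : set 'rV[R]_2).
Local Notation e_ j := (delta_mx 0 j : 'rV[R]_2).

Local Notation ReM := (map_mx (@complex.Re R)).
Local Notation ImM := (map_mx (@complex.Im R)).

(** The matrix of right multiplication by [A] on row vectors split into real and imaginary parts. It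
    is a ring homomorphism, so flatness is preserved. *)
Definition realify (A : 'M[R[i]]_n) : 'M[R]_(n + n) :=
  block_mx (ReM A) (ImM A) (- ImM A) (ReM A).

Lemma map_ReM (A B : 'M[R[i]]_n) :
  ReM (A *m B) = ReM A *m ReM B - ImM A *m ImM B.
Proof.
apply/matrixP => i j; rewrite !mxE Re_sum -sumrB; apply: eq_bigr => k _.
by rewrite !mxE cReM.
Qed.

Lemma map_ImM (A B : 'M[R[i]]_n) :
  ImM (A *m B) = ReM A *m ImM B + ImM A *m ReM B.
Proof.
apply/matrixP => i j; rewrite !mxE Im_sum -big_split; apply: eq_bigr => k _.
by rewrite !mxE cImM.
Qed.

Lemma realifyM A B : realify (A *m B) = realify A *m realify B.
Proof.
rewrite /realify mulmx_block map_ReM map_ImM !mulNmx !mulmxN.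
by congr block_mx; rewrite ?opprD // [RHS]addrC.
Qed.

Lemma realifyD A B : realify (A + B) = realify A + realify B.
Proof.
rewrite /realify add_block_mx -opprD; congr block_mx; first [congr (- _)|idtac];
  by apply/matrixP => i j; rewrite !mxE ?cReD ?cImD.
Qed.

Lemma realifyN A : realify (- A) = - realify A.
Proof.
rewrite /realify opp_block_mx; congr block_mx; first [congr (- _)|idtac];
  by apply/matrixP => i j; rewrite !mxE ?cReN ?cImN.
Qed.

Lemma realify0 : realify 0 = 0.
Proof. by apply: (addrI (realify 0)); rewrite -realifyD !addr0. Qed.

Lemma realify_ul A i k : realify A (lshift n i) (lshift n k) = Re (A i k).
Proof. by rewrite /realify block_mxEul mxE. Qed.
Lemma realify_ur A i k : realify A (lshift n i) (rshift n k) = Im (A i k).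
Proof. by rewrite /realify block_mxEur mxE. Qed.
Lemma realify_dl A i k : realify A (rshift n i) (lshift n k) = - Im (A i k).
Proof. by rewrite /realify block_mxEdl !mxE. Qed.
Lemma realify_dr A i k : realify A (rshift n i) (rshift n k) = Re (A i k).
Proof. by rewrite /realify block_mxEdr mxE. Qed.

Lemma realify_derive j (F : 'rV[R]_2 -> 'M[R[i]]_n) p dF : has_mpd j F p dF ->
  forall i k, is_derive p (e_ j) (fun q => realify (F q) i k) (realify dF i k).
Proof.
move=> Fd i k; case: (split_ordP i) => i' ->; case: (split_ordP k) => k' ->;
  have [h1 h2] := Fd i' k'.
- by rewrite realify_ul; under eq_fun do rewrite realify_ul.
- by rewrite realify_ur; under eq_fun do rewrite realify_ur.
- by rewrite realify_dl; under eq_fun do rewrite realify_dl; exact: is_deriveN.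
- by rewrite realify_dr; under eq_fun do rewrite realify_dr.
Qed.

Lemma realify_continuous D (F : 'rV[R]_2 -> 'M[R[i]]_n) p : mxsmooth_on D F -> D p ->
  forall i k, {for p, continuous (fun q => realify (F q) i k)}.
Proof.
move=> Fs Dp i k; case: (split_ordP i) => i' ->; case: (split_ordP k) => k' ->;
  have [F1 F2] := Fs i' k'.
- rewrite (_ : (fun q => _) = fun q => Re (F q i' k')); first exact: smooth_continuous F1 Dp.
  by apply/funext => q; rewrite realify_ul.
- rewrite (_ : (fun q => _) = fun q => Im (F q i' k')); first exact: smooth_continuous F2 Dp.
  by apply/funext => q; rewrite realify_ur.
- rewrite (_ : (fun q => _) = fun q => - Im (F q i' k')); last first.
    by apply/funext => q; rewrite realify_dl.
  by apply: continuousN; exact: smooth_continuous F2 Dp.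
- rewrite (_ : (fun q => _) = fun q => Re (F q i' k')); first exact: smooth_continuous F1 Dp.
  by apply/funext => q; rewrite realify_dr.
Qed.

Lemma near_bounded m (f : 'rV[R]_2 -> 'M[R]_m) p :
  (forall i k, {for p, continuous (fun q => f q i k)}) ->
  exists2 C, 0 <= C & \forall q \near p, forall i k, `|f q i k| <= C.
Proof.
move=> fc; exists (\sum_i \sum_k (`|f p i k| + 1)).
  by apply: sumr_ge0 => i _; apply: sumr_ge0 => k _; rewrite addr_ge0.
set C := \sum_i _.
have H i k : \forall q \near p, `|f q i k| <= C.
  have : \forall q \near p, `|f q i k| < `|f p i k| + 1.
    by apply: (cvgr_lt _ (cvg_norm (fc i k))); rewrite ltrDl.
  apply: filterS => q h; apply: le_trans (ltW h) _.
  rewrite /C (bigD1 i)//= (bigD1 k)//= -addrA lerDl addr_ge0//.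
    by apply: sumr_ge0 => *; rewrite addr_ge0.
  by apply: sumr_ge0 => *; apply: sumr_ge0 => *; rewrite addr_ge0.
have H2 i : \forall q \near p, forall k, `|f q i k| <= C.
  exact: (@filter_forall 'rV[R]_2 _ (fun k q => `|f q i k| <= C) (nbhs p) _ (H i)).
exact: (@filter_forall 'rV[R]_2 _ (fun i q => forall k, `|f q i k| <= C) (nbhs p) _ H2).
Qed.

Definition flatness (A : 'I_2 -> 'rV[R]_2 -> 'M[R[i]]_n) p :=
  mxpd 0 (A 1) p - mxpd 1 (A 0) p + (A 0 p *m A 1 p - A 1 p *m A 0 p).

Lemma local_solution D (A : 'I_2 -> 'rV[R]_2 -> 'M[R[i]]_n) p0 :
  open D -> (forall j, mxsmooth_on D (A j)) -> (forall p, D p -> flatness A p = 0) -> D p0 ->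
  exists r F, [/\ 0 < r, ball p0 r `<=` D, F p0 = 1%:M, forall p, mxcont F p &
    forall p j, ball p0 r p -> has_mpd j F p (F p *m A j p)].
Proof.
move=> oD As Aflat Dp0.
pose B0 p := realify (A 0 p); pose B1 p := realify (A 1 p).
pose b1 p := realify (mxpd 0 (A 1) p); pose b0 p := realify (mxpd 1 (A 0) p).
have [C0 C00 nC0] := near_bounded (realify_continuous (As 0) Dp0).
have [C1 C10 nC1] := near_bounded (realify_continuous (As 1) Dp0).
have [C2 C20 nC2] := near_bounded (realify_continuous (mxsmooth_mxpd 0 (As 1)) Dp0).
have [e e0 eP] := near_box (filterI (filterI nC0 nC1) (filterI nC2 (near_open oD Dp0))).
pose C := C0 + C1 + C2 + 1.
have Cg : 1 <= C by rewrite lerDr !addr_ge0.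
pose N : R := (n + n)%:R; have N0 : 0 <= N by rewrite /N ler0n.
(* One constant for all smallness conditions: [K * r <= 1] gives [N * C * r <= 1/4], [C * r <= 1/4]
   and, as [K >= 4], also [r <= 1]. The other bound [e / 2] on [r] keeps the closed square inside
   the box of radius [e]. *)
pose K := 4 * ((N + 1) * C).
have K0 : 0 < K by rewrite /K; apply: mulr_gt0 => //; apply: mulr_gt0; lra.
have K4 : 4 <= K by rewrite /K; nra.
pose r := Num.min (e / 2) K^-1.
have r0 : 0 < r by rewrite /r lt_min invr_gt0 K0 andbT; lra.
have re : r < e by rewrite /r gt_min; apply/orP; left; lra.
have rK : K * r <= 1.
  by rewrite mulrC -ler_pdivlMr// div1r /r ge_min lexx orbT.
have r1 : r <= 1.
  have : 1 * r <= K * r by apply: ler_wpM2r; lra.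
  by lra.
have NCr : N * C * r <= 4^-1.
  have : 4 * (N * C * r) <= K * r.
    rewrite /K; have : 0 <= C * r by rewrite mulr_ge0//; lra.
    by nra.
  by lra.
have Cr : C * r <= 4^-1.
  have : 4 * (C * r) <= K * r.
    rewrite /K; have : 0 <= N * (C * r) by rewrite mulr_ge0// mulr_ge0//; lra.
    by nra.
  by lra.
have bP x y : `|x| <= r -> `|y| <= r -> [/\ D (chart p0 (x, y)),
    forall i k, `|B0 (chart p0 (x, y)) i k| <= C, forall i k, `|B1 (chart p0 (x, y)) i k| <= C &
    forall i k, `|b1 (chart p0 (x, y)) i k| <= C].
  move=> xr yr; have [||[h0 h1] [h2 hD]] := eP x y; [exact: le_lt_trans xr re|exact: le_lt_trans yr re|].
  by split => // i k; [apply: le_trans (h0 i k) _|apply: le_trans (h1 i k) _|apply: le_trans (h2 i k) _];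
    rewrite /C; lra.
have rD x y : `|x| <= r -> `|y| <= r -> D (chart p0 (x, y)) by move=> xr /(bP x y xr)[].
pose cl (M : 'rV[R]_2 -> 'M[R]_(n + n)) (q : R * R) := M (chart p0 (clamp2 r q)).
have clc (F : 'rV[R]_2 -> 'M[R[i]]_n) : mxsmooth_on D F -> mcont (cl (fun p => realify (F p))).
  move=> Fs i k; apply: (@clamp_chart_continuous R p0 r D (fun p => realify (F p) i k)) => // p Dp.
  exact: realify_continuous Fs Dp i k.
have cn (q : R * R) : `|(clamp2 r q).1| <= r /\ `|(clamp2 r q).2| <= r by split; exact: clamp_norm.
have cle (x y : R) : `|x| < r -> `|y| < r -> clamp2 r (x, y) = (x, y).
  by move=> xr yr; rewrite /clamp2 /= !clamp_id// ltW.
have [] := @frobenius_box R (n + n) (cl B0) (cl B1) (cl b0) (cl b1) r C.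
- exact: clc (As 0).
- exact: clc (As 1).
- exact: clc (mxsmooth_mxpd 0 (As 1)).
- move=> q i k; have [u v] := cn q; rewrite /cl; case: (clamp2 r q) u v => x y /= u v.
  by have [] := bP x y u v.
- move=> q i k; have [u v] := cn q; rewrite /cl; case: (clamp2 r q) u v => x y /= u v.
  by have [] := bP x y u v.
- move=> q i k; have [u v] := cn q; rewrite /cl; case: (clamp2 r q) u v => x y /= u v.
  by have [] := bP x y u v.
- exact: r0.
- exact: r1.
- by lra.
- exact: NCr.
- exact: Cr.
- move=> x y i k xr yr; apply: (@chart_dx _ p0 r x y _ (fun p => B1 p i k)) => //.
  rewrite /cl cle//; apply: realify_derive; apply: mxsmooth_has_mpd (As 1) _.
  by apply: rD; exact: ltW.
- move=> x y i k xr yr; apply: (@chart_dy _ p0 r x y _ (fun p => B0 p i k)) => //.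
  rewrite /cl cle//; apply: realify_derive; apply: mxsmooth_has_mpd (As 0) _.
  by apply: rD; exact: ltW.
- move=> x y xr yr; rewrite /cl cle//.
  have := Aflat _ (rD x y (ltW xr) (ltW yr)); rewrite /flatness => /(congr1 realify).
  by rewrite !(realifyD, realifyN, realifyM, realify0).
move=> G [Gc G1 Gx Gy].
(* The first block row of the real solution, read as real and imaginary parts, already satisfies the
   complex equation, since multiplication by [realify (A j p)] acts on each block row as [A j p]. *)
pose F p : 'M[R[i]]_n := \matrix_(i, k) (G (unchart p0 p) (lshift n i) (lshift n k)
   +i* G (unchart p0 p) (lshift n i) (rshift n k)).
have u0 : unchart p0 p0 = (0, 0) by rewrite /unchart !subrr.
have Gd p j : ball p0 r p -> forall i k,
    is_derive p (e_ j) (fun q => G (unchart p0 q) i k) ((G (unchart p0 p) *m realify (A j p)) i k).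
  rewrite -(unchartK p0 p); case: (unchart p0 p) => x y h i k.
  have [xr yr] := (ball_chart p0 r x y).1 h; rewrite chartK.
  have [->|->] := ord2 j.
    apply: (@unchart_dx _ p0 x y _ (fun z => G z i k)).
    by have := Gx x y i k xr yr; rewrite /cl cle.
  apply: (@unchart_dy _ p0 x y _ (fun z => G z i k)).
  by have := Gy x y i k xr yr; rewrite /cl cle.
exists r, F; split => //.
- move=> p; rewrite -(unchartK p0 p); case: (unchart p0 p) => x y h.
  have [xr yr] := (ball_chart p0 r x y).1 h.
  by apply: rD; exact: ltW.
- apply/matrixP => i k; rewrite mxE u0 G1 !mxE.
  by rewrite eq_lshift eq_lrshift; case: (i == k).
- have c i k p : {for p, continuous (fun q => G (unchart p0 q) i k)}.
    by apply: (@continuous_comp _ _ _ (unchart p0) (fun z => G z i k)); [exact: unchart_continuous|exact: Gc].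
  move=> p i k; split.
    rewrite (_ : (fun q => _) = (fun q => G (unchart p0 q) (lshift n i) (lshift n k))); first exact: c.
    by apply/funext => q; rewrite mxE.
  rewrite (_ : (fun q => _) = (fun q => G (unchart p0 q) (lshift n i) (rshift n k))); first exact: c.
  by apply/funext => q; rewrite mxE.
- move=> p j rp i k.
  have E l k' : F p l k' = G (unchart p0 p) (lshift n l) (lshift n k') +i*
     G (unchart p0 p) (lshift n l) (rshift n k') by rewrite mxE.
  split.
    have := Gd p j rp (lshift n i) (lshift n k).
    have -> : (fun q => Re (F q i k)) = (fun q => G (unchart p0 q) (lshift n i) (lshift n k)).
      by apply/funext => q; rewrite mxE.
    have -> // : Re ((F p *m A j p) i k) =
      (G (unchart p0 p) *m realify (A j p)) (lshift n i) (lshift n k).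
    rewrite !mxE Re_sum big_split_ord /= -big_split; apply: eq_bigr => l _.
    by rewrite cReM E /= realify_ul realify_dl mulrN.
  have := Gd p j rp (lshift n i) (rshift n k).
  have -> : (fun q => Im (F q i k)) = (fun q => G (unchart p0 q) (lshift n i) (rshift n k)).
    by apply/funext => q; rewrite mxE.
  have -> // : Im ((F p *m A j p) i k) =
    (G (unchart p0 p) *m realify (A j p)) (lshift n i) (rshift n k).
  rewrite !mxE Im_sum big_split_ord /= -big_split; apply: eq_bigr => l _.
  by rewrite cImM E /= realify_ur realify_dr.
Qed.

End LocalSolution.

Local Open Scope ring_scope.

(** The supremum of the points reachable from [a] is reachable and, by the local hypothesis around
    it, cannot lie below [b]. This replaces subdivision into small pieces in all arguments along
    paths and over squares. *)
Lemma interval_ind (R : realType) (P : R -> R -> Prop) (a b : R) : a <= b ->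
  (forall x y z, a <= x -> x <= y -> y <= z -> z <= b -> P x y -> P y z -> P x z) ->
  (forall x, a <= x -> x <= b -> exists2 e, 0 < e &
     forall y z, a <= y -> y <= z -> z <= b -> `|y - x| < e -> `|z - x| < e -> P y z) ->
  P a b.
Proof.
move=> ab Ptr Ploc.
pose S := [set x | a <= x /\ x <= b /\ P a x].
have Sa : S a.
  split=> //; split=> //; have [e e0 h] := Ploc a (lexx a) ab.
  by apply: h => //; rewrite subrr normr0.
have Sub : has_ubound S by exists b => x [_ []].
have hS : has_sup S by split => //; exists a.
pose c := sup S.
have ac : a <= c by exact: ub_le_sup.
have cb : c <= b by apply: ge_sup => [|x [_ []]//]; exists a.
have [e e0 h] := Ploc c ac cb.
have [x [ax [xb Pax]] cx] := sup_adherent e0 hS.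
have xc : x <= c by apply: ub_le_sup => //; split.
have e20 : e / 2 < e by lra.
pose c' := Num.min (c + e / 2) b.
have cc' : c <= c' by rewrite /c' le_min cb andbT; lra.
have c'b : c' <= b by rewrite /c' ge_min lexx orbT.
have c'e : c' <= c + e / 2 by rewrite /c' ge_min lexx.
have xc' := le_trans xc cc'.
have Pxc' : P x c'.
  by apply: h => //; rewrite ltr_norml; apply/andP; split; rewrite -/c in cx *; lra.
have Pac' := Ptr _ _ _ (lexx a) ax xc' c'b Pax Pxc'.
have : c' <= c by apply: ub_le_sup => //; split; [exact: le_trans ac cc'|split].
rewrite {1}/c' ge_min => /orP[|bc]; first by move=> ?; exfalso; lra.
by have <- : c' = b by apply/eqP; rewrite eq_le c'b (le_trans bc cc').
Qed.

Lemma invmx_mul (K : fieldType) n (A B : 'M[K]_n) : A \in unitmx -> B \in unitmx ->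
  invmx (A *m B) = invmx B *m invmx A.
Proof.
move=> Au Bu; have ABu : A *m B \in unitmx by rewrite unitmx_mul Au.
apply: (can_inj (mulKmx ABu)).
by rewrite mulmxV// -mulmxA (mulmxA B) mulmxV// mul1mx mulmxV.
Qed.

(** * Local systems, parallel transport and the monodromy theorem *)

Section Monodromy.
Context {R : realType} {K : fieldType} {n : nat}.
Variables (D : set 'rV[R]_2) (Fr : 'rV[R]_2 -> 'rV[R]_2 -> 'M[K]_n) (rad : 'rV[R]_2 -> R).
Hypothesis rad0 : forall p, D p -> 0 < rad p.
Hypothesis radD : forall p, D p -> ball p (rad p) `<=` D.
Hypothesis Fr1 : forall p, D p -> Fr p p = 1%:M.
Hypothesis FrU : forall p q, D p -> ball p (rad p) q -> Fr p q \in unitmx.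
Hypothesis FrC : forall p q, D p -> ball p (rad p) q ->
  \forall q' \near q, Fr p q' = Fr p q *m Fr q q'.
Implicit Types (X Y Z : set (R * R)) (h : R * R -> 'rV[R]_2) (Phi Psi : R * R -> 'M[K]_n).

(* [Fr p] is the parallel frame near [p]; [Phi] is a parallel section, over [X],
   of the local system pulled back by [h]. *)
Definition sec X h Phi := forall z, X z -> Phi z \in unitmx /\
  \forall z' \near z, X z' -> Phi z' = Phi z *m Fr (h z) (h z').

Lemma sec_subset X Y h Phi : Y `<=` X -> sec X h Phi -> sec Y h Phi.
Proof.
move=> YX S z /YX /S[u N]; split=> //.
by apply: filterS N => z' + /YX; exact.
Qed.

Lemma sec_pullback X Y h Phi (g : R * R -> R * R) : continuous g ->
  (forall z, Y z -> X (g z)) -> sec X h Phi -> sec Y (h \o g) (Phi \o g).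
Proof.
move=> gc YX S z /YX /S[u N]; split=> //=.
have N' : \forall z' \near z, X (g z') -> Phi (g z') = Phi (g z) *m Fr (h (g z)) (h (g z')).
  exact: gc z _ N.
by apply: filterS N' => z' /= H /YX; exact: H.
Qed.

Lemma sec_ext X h h' Phi : (forall z, X z -> h z = h' z) -> sec X h Phi -> sec X h' Phi.
Proof.
move=> hh S z Xz; have [u N] := S z Xz; split=> //.
by apply: filterS N => z' H Xz'; rewrite -!hh//; exact: H.
Qed.

Lemma sec_mull X h Phi C : C \in unitmx -> sec X h Phi -> sec X h (fun z => C *m Phi z).
Proof.
move=> Cu S z Xz; have [u N] := S z Xz; split; first by rewrite unitmx_mul Cu.
by apply: filterS N => z' H Xz'; rewrite H// mulmxA.
Qed.

Lemma sec_local X h p : continuous h -> D p ->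
  (forall z, X z -> ball p (rad p) (h z)) -> sec X h (fun z => Fr p (h z)).
Proof.
move=> hc Dp Xb z /Xb bz; split; first exact: FrU.
have N' : \forall z' \near z, Fr p (h z') = Fr p (h z) *m Fr (h z) (h z').
  exact: hc z _ (FrC Dp bz).
by apply: filterS N' => z'.
Qed.

Lemma sec_cst X h p : D p -> (forall z, X z -> h z = p) -> sec X h (fun=> 1%:M).
Proof.
move=> Dp hp z Xz; split; first exact: unitmx1.
by apply: (@nearW _ (nbhs z) _ (nbhs_filter z)) => z' Xz'; rewrite !hp// Fr1// mulmx1.
Qed.

Definition seg (z0 z1 : R * R) (t : R) : R * R :=
  (z0.1 + t * (z1.1 - z0.1), z0.2 + t * (z1.2 - z0.2)).

Lemma affine_continuous (a b : R) : continuous (fun t : R => a + t * b).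
Proof.
have c (k : R) : continuous (fun _ : R => k) by move=> t; exact: cst_continuous.
have i : continuous (fun t : R => t) by move=> t; exact: cvg_id.
exact: contD (c a) (contM i (c b)).
Qed.

Lemma seg_continuous z0 z1 : continuous (seg z0 z1).
Proof.
move=> t.
exact: (pair_continuous (@affine_continuous z0.1 (z1.1 - z0.1) t)
  (@affine_continuous z0.2 (z1.2 - z0.2) t)).
Qed.

Lemma seg0 z0 z1 : seg z0 z1 0 = z0.
Proof. by case: z0 => x y; rewrite /seg !mul0r !addr0. Qed.

Lemma seg1 z0 z1 : seg z0 z1 1 = z1.
Proof. by case: z0 z1 => x y [x' y']; rewrite /seg /= !mul1r !subrKC. Qed.

(** Near each point both sections change by the same right factor [Fr (h z) (h z')], which cancels
    in the ratio. *)
Lemma sec_ratio X h Phi Psi z0 z1 : sec X h Phi -> sec X h Psi ->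
  (forall t, 0 <= t -> t <= 1 -> X (seg z0 z1 t)) ->
  Phi z0 *m invmx (Psi z0) = Phi z1 *m invmx (Psi z1).
Proof.
move=> S1 S2 Xs.
pose P (a b : R) := Phi (seg z0 z1 a) *m invmx (Psi (seg z0 z1 a)) =
  Phi (seg z0 z1 b) *m invmx (Psi (seg z0 z1 b)).
suff : P 0 1 by rewrite /P seg0 seg1.
apply: interval_ind => //; first by move=> x y z _ _ _ _; rewrite /P => ->.
move=> t t0 t1; have Xt := Xs t t0 t1.
have [u1 N1] := S1 _ Xt; have [u2 N2] := S2 _ Xt.
have : \forall s \near t,
    (X (seg z0 z1 s) -> Phi (seg z0 z1 s) = Phi (seg z0 z1 t) *m Fr (h (seg z0 z1 t)) (h (seg z0 z1 s))) /\
    (X (seg z0 z1 s) -> Psi (seg z0 z1 s) = Psi (seg z0 z1 t) *m Fr (h (seg z0 z1 t)) (h (seg z0 z1 s))).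
  exact: (@seg_continuous z0 z1 t _ (filterI N1 N2)).
move=> /nbhs_ballP[e /= e0 eP].
have E s : 0 <= s -> s <= 1 -> `|s - t| < e -> P t s.
  move=> s0 s1 st; have Xss := Xs s s0 s1.
  have bs : ball t e s by rewrite /ball/= distrC.
  have [H1 H2] := eP s bs.
  have [u3 _] := S2 _ Xss; rewrite (H2 Xss) unitmx_mul u2 /= in u3.
  by rewrite /P (H1 Xss) (H2 Xss) invmx_mul// mulmxA mulmxK.
exists e => // y z y0 yz z1' ye ze; rewrite /P -(E y) -?(E z)//.
  exact: le_trans y0 yz.
exact: le_trans yz z1'.
Qed.

(** The seam, where [l z = m], contains the segments between its points, so the ratio of the two
    sections is constant along it; multiplied by this constant, [Psi] agrees with [Phi] on the
    seam. *)
Lemma sec_glue Z h (l : R * R -> R) (m : R) Phi Psi : continuous l ->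
  (forall z0 z1 t, Z z0 -> Z z1 -> l z0 = m -> l z1 = m -> 0 <= t -> t <= 1 ->
     Z (seg z0 z1 t) /\ l (seg z0 z1 t) = m) ->
  sec [set z | Z z /\ l z <= m] h Phi -> sec [set z | Z z /\ m <= l z] h Psi ->
  exists Theta, sec Z h Theta.
Proof.
move=> lc Wc S1 S2.
have [C Cu CP] : exists2 C, C \in unitmx & forall z, Z z -> l z = m -> Phi z = C *m Psi z.
  (* If the seam is empty there is nothing to match, and 1 is taken as the constant. *)
  have [[z0 [Z0 l0]]|no] := pselect (exists z, Z z /\ l z = m); last first.
    by exists 1%:M; [exact: unitmx1|move=> z Zz lz; case: no; exists z].
  have [u1 _] := S1 z0 (conj Z0 (eq_ind_r (fun x => x <= m) (lexx m) l0)).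
  have [u2 _] := S2 z0 (conj Z0 (eq_ind_r (fun x => m <= x) (lexx m) l0)).
  exists (Phi z0 *m invmx (Psi z0)); first by rewrite unitmx_mul u1 unitmx_inv.
  move=> z1 Z1 l1.
  have [u3 _] := S2 z1 (conj Z1 (eq_ind_r (fun x => m <= x) (lexx m) l1)).
  have SW1 : sec [set z | Z z /\ l z = m] h Phi.
    by apply: sec_subset S1 => z /= [Zz ->].
  have SW2 : sec [set z | Z z /\ l z = m] h Psi.
    by apply: sec_subset S2 => z /= [Zz ->].
  rewrite (sec_ratio SW1 SW2 (z1 := z1)) ?mulmxKV//.
  by move=> t t0 t1; exact: Wc.
have S3 := sec_mull Cu S2.
exists (fun z => if l z <= m then Phi z else C *m Psi z) => z Zz.
case: (ltgtP (l z) m) => lm.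
- have [u N] := S1 z (conj Zz (ltW lm)); split=> //.
  have Nl : \forall z' \near z, l z' < m by apply: (cvgr_lt _ (lc z)).
  apply: filterS2 N Nl => z' H /ltW lz Zz'; rewrite lz; exact: H.
- have [u N] := S3 z (conj Zz (ltW lm)); split=> //.
  have Nl : \forall z' \near z, m < l z' by apply: (cvgr_gt _ (lc z)).
  by apply: filterS2 N Nl => z' H lz Zz'; rewrite leNgt lz /=; apply: H; split=> //; exact: ltW.
- have lem : l z <= m by rewrite lm.
  have gem : m <= l z by rewrite lm.
  have [u N] := S1 z (conj Zz lem); have [_ N3] := S3 z (conj Zz gem).
  split=> //; apply: filterS2 N N3 => z' H H3 Zz'.
  case: (leP (l z') m) => [lz|/ltW lz]; first exact: H.
  by rewrite (CP z Zz lm); apply: H3.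
Qed.

Definition rect (a b c d : R) : set (R * R) :=
  [set z | [/\ a <= z.1, z.1 <= b, c <= z.2 & z.2 <= d]].

Lemma itv_comb (a b x y t : R) : a <= x -> x <= b -> a <= y -> y <= b ->
  0 <= t -> t <= 1 -> a <= x + t * (y - x) /\ x + t * (y - x) <= b.
Proof.
move=> ax xb ay yb t0 t1.
have -> : x + t * (y - x) = (1 - t) * x + t * y by ring.
have h1 := ler_wpM2l t0 ay; have h2 := ler_wpM2l t0 yb.
have t1' : 0 <= 1 - t by rewrite subr_ge0.
have h3 := ler_wpM2l t1' ax; have h4 := ler_wpM2l t1' xb.
by split; lra.
Qed.

Lemma rect_seg a b c d z0 z1 t : rect a b c d z0 -> rect a b c d z1 ->
  0 <= t -> t <= 1 -> rect a b c d (seg z0 z1 t).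
Proof.
move=> [a0 b0 c0 d0] [a1 b1 c1 d1] t0 t1.
have [? ?] := itv_comb a0 b0 a1 b1 t0 t1.
by have [? ?] := itv_comb c0 d0 c1 d1 t0 t1.
Qed.

Section Square.
Variable h : R * R -> 'rV[R]_2.
Hypotheses (hc : continuous h) (hD : forall z, D (h z)).

Let Good a b c d := exists Phi, sec (rect a b c d) h Phi.

Let Good_sub a b c d a' b' c' d' : a <= a' -> b' <= b -> c <= c' -> d' <= d ->
  Good a b c d -> Good a' b' c' d'.
Proof.
move=> aa bb cc dd [Phi S]; exists Phi; apply: sec_subset S => z [? ? ? ?].
by split; [apply: le_trans aa _|apply: le_trans bb|apply: le_trans cc _|apply: le_trans dd].
Qed.

Let Good1 a m b c d : Good a m c d -> Good m b c d -> Good a b c d.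
Proof.
move=> [Phi S1] [Psi S2].
apply: (@sec_glue _ _ fst m Phi Psi).
- by move=> z; exact: cvg_fst.
- move=> z0 z1 t Z0 Z1 l0 l1 t0 t1; split; first exact: rect_seg.
  by rewrite /seg /= l0 l1 subrr mulr0 addr0.
- by apply: sec_subset S1 => z /= [[? ? ? ?] ?].
- by apply: sec_subset S2 => z /= [[? ? ? ?] ?].
Qed.

Let Good2 a b c m d : Good a b c m -> Good a b m d -> Good a b c d.
Proof.
move=> [Phi S1] [Psi S2].
apply: (@sec_glue _ _ snd m Phi Psi).
- by move=> z; exact: cvg_snd.
- move=> z0 z1 t Z0 Z1 l0 l1 t0 t1; split; first exact: rect_seg.
  by rewrite /seg /= l0 l1 subrr mulr0 addr0.
- by apply: sec_subset S1 => z /= [[? ? ? ?] ?].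
- by apply: sec_subset S2 => z /= [[? ? ? ?] ?].
Qed.

Let Good_local (x y : R) : exists2 e : R, 0 < e & forall a b c d,
  x - e < a -> b < x + e -> y - e < c -> d < y + e -> Good a b c d.
Proof.
have : \forall z \near (x, y), ball (h (x, y)) (rad (h (x, y))) (h z).
  exact: (@hc (x, y) _ (nbhsx_ballx (h (x, y)) _ (rad0 (hD (x, y))))).
move=> /nbhs_ballP[e /= e0 eP]; exists e => // a b c d xa bx yc dy.
exists (fun z => Fr (h (x, y)) (h z)); apply: sec_local => // z [? ? ? ?].
by apply: eP; split; rewrite /ball /= ltr_norml; apply/andP; split; lra.
Qed.

(** Two interval inductions. On a vertical line small rectangles are glued into a strip, whose width
    shrinks to the smaller one at each gluing; then the strips are glued horizontally. *)
Lemma square_section : exists Phi, sec (rect 0 1 0 1) h Phi.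
Proof.
apply: (@interval_ind _ (fun a b => Good a b 0 1)) => // [x y z _ _ _ _|s _ _]; first exact: Good1.
have [e e0 eP] : exists2 e : R, 0 < e & Good (s - e) (s + e) 0 1.
  apply: (@interval_ind _ (fun c d => exists2 e : R, 0 < e & Good (s - e) (s + e) c d)) => //.
    move=> x y z _ _ _ _ [e1 e10 G1] [e2 e20 G2].
    exists (Num.min e1 e2); first by rewrite lt_min e10.
    have m1 : Num.min e1 e2 <= e1 by rewrite ge_min lexx.
    have m2 : Num.min e1 e2 <= e2 by rewrite ge_min lexx orbT.
    apply: (@Good2 _ _ _ y).
      by apply: Good_sub G1 => //; lra.
    by apply: Good_sub G2 => //; lra.
  move=> t _ _; have [e e0 eP] := Good_local s t; exists e => // c d _ _ _.
  rewrite !ltr_norml => /andP[? ?] /andP[? ?].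
  by exists (e / 2); [lra|apply: eP; lra].
exists e => // a b _ _ _; rewrite !ltr_norml => /andP[? ?] /andP[? ?].
by apply: Good_sub eP => //; lra.
Qed.

End Square.

Definition clamp01 (t : R) : R := Num.max 0 (Num.min 1 t).

Lemma clamp01_itv t : 0 <= clamp01 t /\ clamp01 t <= 1.
Proof. by rewrite /clamp01 le_max lexx /= ge_max ge_min lexx ler01. Qed.

Lemma clamp01_id t : 0 <= t -> t <= 1 -> clamp01 t = t.
Proof. by move=> t0 t1; rewrite /clamp01 min_r// max_r. Qed.

Lemma clamp01_le0 t : t <= 0 -> clamp01 t = 0.
Proof. by move=> t0; rewrite /clamp01 min_r ?max_l//; apply: le_trans t0 _. Qed.

Lemma clamp01_ge1 t : 1 <= t -> clamp01 t = 1.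
Proof. by move=> t1; rewrite /clamp01 min_l// max_r. Qed.

Lemma clamp01_continuous : continuous clamp01.
Proof.
move=> t; apply: (@continuous_max _ _ (fun=> 0 : R) (fun x => Num.min (1 : R) x)).
  exact: cst_continuous.
apply: (@continuous_min _ _ (fun=> 1 : R) id); first exact: cst_continuous.
exact: cvg_id.
Qed.

(** A path extended by constants beyond its ends: continuity holds on the whole line, and
    concatenations can be written as sums. *)
Definition full_path (x y : 'rV[R]_2) (g : R -> 'rV[R]_2) :=
  [/\ continuous g, forall t, D (g t), forall t, t <= 0 -> g t = x & forall t, 1 <= t -> g t = y].

Lemma clamp_within (T : topologicalType) (f : T -> 'rV[R]_2) (S : set T) (c : T -> T) :
  continuous c -> (forall t, S (c t)) -> {within S, continuous f} -> continuous (f \o c).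
Proof.
move=> cc cS /subspace_continuousP fc t A NA.
have N : \forall s \near t, S (c s) -> A (f (c s)) by exact: cc t _ (fc (c t) (cS t) A NA).
by apply: filterS N => s; apply; exact: cS.
Qed.

Lemma path_full x y g : is_path D x y g -> full_path x y (g \o clamp01).
Proof.
move=> [gc g0 g1 gD]; split.
- apply: clamp_within gc; first exact: clamp01_continuous.
  by move=> t /=; rewrite in_itv /=; have [-> ->] := clamp01_itv t.
- by move=> t; apply: gD; rewrite in_itv /=; have [-> ->] := clamp01_itv t.
- by move=> t t0 /=; rewrite clamp01_le0.
- by move=> t t1 /=; rewrite clamp01_ge1.
Qed.

(** A path counts as a map of the plane that depends only on the second coordinate, so sections
    along paths are sections over this degenerate rectangle and compare directly with those over
    squares. *)
Definition edge : set (R * R) := rect 0 0 0 1.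

Lemma edge_square : edge `<=` rect 0 1 0 1.
Proof. by move=> z [? z1 ? ?]; split => //; apply: le_trans z1 _. Qed.

Lemma path_section x y g : full_path x y g -> exists Phi, sec edge (fun z => g z.2) Phi.
Proof.
move=> [gc gD _ _].
have [|//|Phi S] := @square_section (fun z => g z.2).
  by move=> z; apply: (@continuous_comp _ _ _ snd g); [exact: cvg_snd|exact: gc].
by exists Phi; exact: sec_subset edge_square S.
Qed.

(** Unchanged when [Phi] is multiplied on the left by a constant; by [edge_ratio] it therefore
    depends only on the path. *)
Definition transport Phi := invmx (Phi (0, 0)) *m Phi (0, 1).

Lemma edge_end : edge (0, 0) /\ edge (0, 1).
Proof. by split; split. Qed.

Lemma edge_ratio h Phi Psi : sec edge h Phi -> sec edge h Psi ->
  Phi (0, 0) *m invmx (Psi (0, 0)) = Phi (0, 1) *m invmx (Psi (0, 1)).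
Proof.
move=> S1 S2; apply: sec_ratio S1 S2 _ => t t0 t1.
by apply: rect_seg => //; case: edge_end.
Qed.

(** The case [a > b] is used too, for running through half of a path backwards. *)
Definition sub_edge (a b : R) (z : R * R) : R * R := (0, a + z.2 * (b - a)).

Lemma sub_edge_continuous a b : continuous (sub_edge a b).
Proof.
move=> [x y]; apply: (@pair_continuous _ _ _ (fun=> 0) ((fun t => a + t * (b - a)) \o snd)).
  exact: cst_continuous.
by apply: continuous_comp; [exact: cvg_snd|exact: affine_continuous].
Qed.

Lemma sec_sub_edge a b h h' Phi : 0 <= a -> a <= 1 -> 0 <= b -> b <= 1 ->
  (forall t, 0 <= t -> t <= 1 -> h (0, a + t * (b - a)) = h' (0, t)) ->
  sec edge h Phi -> sec edge h' (Phi \o sub_edge a b).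
Proof.
move=> a0 a1 b0 b1 hh S.
have T : sec edge (h \o sub_edge a b) (Phi \o sub_edge a b).
  apply: sec_pullback S; first exact: sub_edge_continuous.
  move=> [x t] [_ _ /= t0 t1]; have [? ?] := itv_comb a0 a1 b0 b1 t0 t1.
  by split.
apply: sec_ext T => -[x t] [/= x0 x0' t0 t1]; rewrite /sub_edge /= hh//.
by congr (h' (_, _)); apply/eqP; rewrite eq_le x0 x0'.
Qed.

Hypothesis D_sc : simply_connected D.

(** A section over the square of a null homotopy takes equal values at the ends of the side lying
    over the loop, as these ends are joined by the other three sides. [Phi] differs from it by a
    constant left factor. *)
Lemma loop_transport x g Phi : full_path x x g -> sec edge (fun z => g z.2) Phi ->
  Phi (0, 0) = Phi (0, 1).
Proof.
move=> [gc gD g0 g1] S.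
have Dx : D x by rewrite -(g0 0 (lexx 0)).
have pg : is_path D x x g.
  by split => //; [exact: continuous_subspaceT|exact: g0|exact: g1].
have [H [Hc H01 Hp]] := (let: And3 _ _ h := D_sc in h) x g Dx pg.
pose c (z : R * R) := (clamp01 z.1, clamp01 z.2).
have cc : continuous c.
  move=> [u v]; apply: (@pair_continuous _ _ _ (clamp01 \o fst) (clamp01 \o snd)).
    by apply: continuous_comp; [exact: cvg_fst|exact: clamp01_continuous].
  by apply: continuous_comp; [exact: cvg_snd|exact: clamp01_continuous].
have cS z : (`[0, 1] `*` `[0, 1])%classic (c z).
  have [a1 a2] := clamp01_itv z.1; have [b1 b2] := clamp01_itv z.2.
  by split; rewrite /= in_itv /= ?a1 ?a2 ?b1 ?b2.
have hc : continuous (H \o c) by exact: clamp_within cc cS Hc.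
have hD z : D ((H \o c) z).
  have [/= + +] := cS z => i1 i2.
  by have [_ _ _] := Hp _ i1; apply.
have [Psi SP] := square_section hc hD.
have I0 : (0 : R) \in `[0, 1]%R by rewrite in_itv /= lexx ler01.
have I1 : (1 : R) \in `[0, 1]%R by rewrite in_itv /= lexx ler01.
have hE s t : 0 <= s -> s <= 1 -> 0 <= t -> t <= 1 -> H (c (s, t)) = H (s, t).
  by move=> ? ? ? ?; rewrite /c /= !clamp01_id.
(* Used on the three sides of the square on which the homotopy is constant. *)
have side (z0 z1 : R * R) : rect 0 1 0 1 z0 -> rect 0 1 0 1 z1 ->
    (forall t, 0 <= t -> t <= 1 -> H (c (seg z0 z1 t)) = x) -> Psi z0 = Psi z1.
  move=> r0 r1 hx.
  pose X := [set z | rect 0 1 0 1 z /\ (H \o c) z = x].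
  have S1 : sec X (H \o c) Psi by apply: sec_subset SP => z [].
  have S2 : sec X (H \o c) (fun=> 1%:M) by apply: (@sec_cst _ _ x) => // z [].
  have := sec_ratio S1 S2 (z0 := z0) (z1 := z1); rewrite invmx1 !mulmx1; apply.
  by move=> t t0 t1; split; [exact: rect_seg|exact: hx].
have E1 : Psi (0, 0) = Psi (1, 0).
  apply: side; rewrite /rect /=; try by split.
  move=> t t0 t1; have -> : seg (0, 0) (1, 0) t = (t, 0).
    by rewrite /seg /= !subr0 mulr0 mulr1 !add0r.
  by rewrite hE//; have [] := Hp t; rewrite ?in_itv /= ?t0.
have E2 : Psi (1, 0) = Psi (1, 1).
  apply: side; rewrite /rect /=; try by split.
  move=> t t0 t1; have -> : seg (1, 0) (1, 1) t = (1, t).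
    by rewrite /seg /= subrr subr0 mulr0 mulr1 addr0 add0r.
  by rewrite hE//; have [] := H01 t; rewrite ?in_itv /= ?t0.
have E3 : Psi (0, 1) = Psi (1, 1).
  apply: side; rewrite /rect /=; try by split.
  move=> t t0 t1; have -> : seg (0, 1) (1, 1) t = (t, 1).
    by rewrite /seg /= subrr subr0 mulr0 mulr1 addr0 add0r.
  by rewrite hE//; have [] := Hp t; rewrite ?in_itv /= ?t0.
have SPe : sec edge (fun z => g z.2) Psi.
  apply: sec_ext (sec_subset edge_square SP) => -[u v] [/= u0 u1 v0 v1].
  have -> : u = 0 by apply/eqP; rewrite eq_le u0 u1.
  by rewrite -[LHS]/(H (c (0, v))) hE//; have [] := H01 v _; rewrite ?in_itv /= ?v0.
have := edge_ratio S SPe; rewrite E1 E2 -E3 => h.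
have [u1 _] := SPe _ edge_end.2.
by rewrite -[LHS](mulmxKV u1) h mulmxKV.
Qed.

(** The path [g1] followed by [g2] backwards is a loop; a section along it restricts to sections
    along both paths, and [loop_transport] makes these agree at [x]. *)
Lemma transport_unique x y g1 g2 Phi1 Phi2 : full_path x y g1 -> full_path x y g2 ->
  sec edge (fun z => g1 z.2) Phi1 -> sec edge (fun z => g2 z.2) Phi2 ->
  transport Phi1 = transport Phi2.
Proof.
move=> P1 P2 S1 S2; have [c1 D1 s1 e1] := P1; have [c2 D2 s2 e2] := P2.
(* On each half one of the two paths rests at [y] and cancels, so the sum is the concatenation and
   its continuity needs no case distinction. *)
pose g t := g1 (0 + t * 2) + (g2 (2 + t * (- 2)) - y).
have gl t : t <= 2^-1 -> g t = g1 (t * 2).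
  by move=> t2; rewrite /g (e2 (2 + _)) ?subrr ?addr0 ?add0r//; lra.
have gr t : 2^-1 <= t -> g t = g2 (2 + t * (- 2)).
  by move=> t2; rewrite /g (e1 (0 + _)) ?subrKC//; lra.
have gp : full_path x x g.
  split.
  - have k1 : continuous (g1 \o (fun t => 0 + t * 2)).
      by move=> t; apply: continuous_comp; [exact: affine_continuous|exact: c1].
    have k2 : continuous (g2 \o (fun t => 2 + t * (- 2))).
      by move=> t; apply: continuous_comp; [exact: affine_continuous|exact: c2].
    move=> t; exact: (continuousD (k1 t) (continuousB (k2 t) (@cst_continuous _ _ y t))).
  - by move=> t; case: (leP t 2^-1) => [/gl ->|/ltW/gr ->].
  - by move=> t t0; rewrite gl ?s1//; lra.
  - by move=> t t1; rewrite gr ?s2//; lra.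
have [Phi S] := path_section gp.
have loop := loop_transport gp S.
have r0 : 0 <= 2^-1 :> R by lra.
have r1 : 2^-1 <= 1 :> R by lra.
have T1 : sec edge (fun z => g1 z.2) (Phi \o sub_edge 0 2^-1).
  apply: (sec_sub_edge (lexx 0) ler01 r0 r1 _ S) => /= t t0 t1.
  by rewrite gl; [congr g1|]; lra.
have T2 : sec edge (fun z => g2 z.2) (Phi \o sub_edge 1 2^-1).
  apply: (sec_sub_edge ler01 (lexx 1) r0 r1 _ S) => /= t t0 t1.
  by rewrite gr; [congr g2|]; lra.
have := edge_ratio T1 S1; have := edge_ratio T2 S2.
rewrite /= /sub_edge /= !mul0r !mul1r !addr0 !subrKC -loop => R2 R1.
have [u1 _] := S1 _ edge_end.2; have [u2 _] := S2 _ edge_end.2.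
have [u _] := S _ edge_end.1.
have := congr1 (mulmx^~ (Phi1 (0, 1))) R1; rewrite (mulmxKV u1) -mulmxA => M1.
have := congr1 (mulmx^~ (Phi2 (0, 1))) R2; rewrite (mulmxKV u2) -mulmxA => M2.
by apply: (can_inj (mulKmx u)); rewrite /transport M1 M2.
Qed.

(** [Psi p] is the transport from [x0] along any path to [p]. For [q] near [p] the path may be
    prolonged by the segment from [p] to [q], along which the transport is [Fr p q]. *)
Lemma global_section x0 : D x0 -> exists Psi : 'rV[R]_2 -> 'M[K]_n,
  Psi x0 = 1%:M /\ forall p, D p -> Psi p \in unitmx /\
    \forall q \near p, Psi q = Psi p *m Fr p q.
Proof.
move=> Dx0; have [_ Dconn _] := D_sc.
have ex p : {Phi : R * R -> 'M[K]_n | D p -> exists2 g, full_path x0 p g & sec edge (fun z => g z.2) Phi}.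
  apply: cid; have [Dp|] := pselect (D p); last by exists (fun=> 0).
  have [g /path_full gp] := Dconn x0 p Dx0 Dp.
  by have [Phi S] := path_section gp; exists Phi => _; exists (g \o clamp01).
pose Psi p := transport (sval (ex p)).
have PsiP p g Phi : D p -> full_path x0 p g -> sec edge (fun z => g z.2) Phi -> Psi p = transport Phi.
  move=> Dp gp S; rewrite /Psi; case: (ex p) => Phi' /= /(_ Dp)[g' gp' S'].
  exact: transport_unique gp' gp S' S.
exists Psi; split.
  have gp : full_path x0 x0 (fun=> x0) by split => // t; exact: cst_continuous.
  have S : sec edge (fun z => (fun=> x0) z.2) (fun=> 1%:M : 'M[K]_n) by exact: (@sec_cst _ _ x0).
  by rewrite (PsiP _ _ _ Dx0 gp S) /transport invmx1 mulmx1.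
move=> p Dp; split.
  rewrite /Psi; case: (ex p) => Phi /= /(_ Dp)[g _ S].
  have [u0 _] := S _ edge_end.1; have [u1 _] := S _ edge_end.2.
  by rewrite unitmx_mul unitmx_inv u0 u1.
have N : \forall q \near p, ball p (rad p) q by exact: nbhsx_ballx (rad0 Dp).
apply: filterS N => q bq.
have h01 : 0 <= 2^-1 :> R by lra.
have h10 : 2^-1 <= 1 :> R by lra.
have [Phi] := ex p; move=> /(_ Dp)[g gp S]; have [gc gD gx gy] := gp.
(* The straight segment stays in the ball of [p], where [Fr p] itself is a section. *)
pose sgm (t : R) := p + clamp01 t *: (q - p).
have sgmc : continuous sgm.
  move=> t; have k : {for t, continuous (fun t => clamp01 t *: (q - p))}.
    by apply: (@cvgZl _ _ _ _ _ clamp01); exact: clamp01_continuous.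
  exact: (continuousD (@cst_continuous _ _ p t) k).
have sgmb t : ball p (rad p) (sgm t).
  have [t0 t1] := clamp01_itv t; split; first exact: rad0.
  case: bq => _ bq i j; have := bq i j; rewrite /ball /= !mxE => h.
  rewrite opprD addrA subrr sub0r normrN normrM (ger0_norm t0).
  apply: le_lt_trans h; rewrite -[leRHS]mul1r distrC.
  exact: ler_wpM2r.
have ballD z : ball p (rad p) z -> D z.
  exact: radD.
pose g' t := g (0 + t * 2) + (sgm (-1 + t * 2) - p).
have gl t : t <= 2^-1 -> g' t = g (t * 2).
  by move=> t2; rewrite /g' /sgm clamp01_le0 ?scale0r ?addr0 ?subrr ?addr0 ?add0r//; lra.
have gr t : 2^-1 <= t -> g' t = sgm (-1 + t * 2).
  by move=> t2; rewrite /g' (gy (0 + _)) ?subrKC//; lra.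
have gp' : full_path x0 q g'.
  split.
  - have k1 : continuous (g \o (fun t => 0 + t * 2)).
      by move=> t; apply: continuous_comp; [exact: affine_continuous|exact: gc].
    have k2 : continuous (sgm \o (fun t => -1 + t * 2)).
      by move=> t; apply: continuous_comp; [exact: affine_continuous|exact: sgmc].
    move=> t; exact: (continuousD (k1 t) (continuousB (k2 t) (@cst_continuous _ _ p t))).
  - by move=> t; case: (leP t 2^-1) => [/gl ->|/ltW/gr ->] //; exact: ballD.
  - by move=> t t0; rewrite gl ?gx//; lra.
  - by move=> t t1; rewrite gr /sgm ?clamp01_ge1 ?scale1r ?subrKC//; lra.
have [Phi' S'] := path_section gp'.
have Dq : D q by exact: ballD.
rewrite (PsiP _ _ _ Dq gp' S') (PsiP _ _ _ Dp gp S).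
have T1 : sec edge (fun z => g z.2) (Phi' \o sub_edge 0 2^-1).
  apply: (sec_sub_edge (lexx 0) ler01 h01 h10 _ S') => /= t t0 t1.
  by rewrite gl; [congr g|]; lra.
have T2 : sec edge (fun z => sgm z.2) (Phi' \o sub_edge 2^-1 1).
  apply: (sec_sub_edge h01 h10 ler01 (lexx 1) _ S') => /= t t0 t1.
  by rewrite gr; [congr sgm|]; lra.
have T3 : sec edge (fun z => sgm z.2) (fun z => Fr p (sgm z.2)).
  apply: sec_local => // z.
  by apply: (@continuous_comp _ _ _ snd sgm); [case: z => *; exact: cvg_snd|exact: sgmc].
have := edge_ratio T1 S; have := edge_ratio T2 T3.
have s0 : sgm 0 = p by rewrite /sgm clamp01_le0// scale0r addr0.
have s1 : sgm 1 = q by rewrite /sgm clamp01_ge1// scale1r subrKC.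
rewrite /= /sub_edge /= !mul0r !mul1r !addr0 !subrKC s0 s1 Fr1// invmx1 mulmx1 => R2 R1.
have [u1 _] := S _ edge_end.2; have [u _] := S' _ edge_end.1.
apply: (can_inj (mulKmx u)); rewrite /transport mulKVmx// !mulmxA.
have := congr1 (mulmx^~ (Phi (0, 1))) R1; rewrite (mulmxKV u1) => ->.
by rewrite R2 mulmxKV// FrU.
Qed.

End Monodromy.

Local Open Scope complex_scope.

(** * Global solutions of flat systems *)

Section GlobalSolution.
Context {R : realType} {n : nat}.
Implicit Types (p q : 'rV[R]_2) (D : set 'rV[R]_2) (A : 'I_2 -> 'rV[R]_2 -> 'M[R[i]]_n).

Lemma has_mpdN m k j (F : 'rV[R]_2 -> 'M[R[i]]_(m, k)) p dF :
  has_mpd j F p dF -> has_mpd j (fun q => - F q) p (- dF).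
Proof. by move=> Fd i l; rewrite mxE; under eq_fun do rewrite mxE; exact: has_cpdN. Qed.

(* The inverse of a solution of [dF = F A] solves [dG = - A G], that is,
   [dG^T = G^T (- A^T)]. *)
Lemma flatness_dual D A p : (forall j, mxsmooth_on D (A j)) -> D p ->
  flatness (fun j q => - (A j q)^T) p = - (flatness A p)^T.
Proof.
move=> As Dp.
have E j k : mxpd j (fun q => - (A k q)^T) p = - (mxpd j (A k) p)^T.
  by apply/has_mpd_val/has_mpdN/has_mpd_tr; exact: mxsmooth_has_mpd (As k) Dp.
rewrite /flatness !E !mulNmx !mulmxN !opprK -!trmx_mul.
move: (mxpd _ _ _) (mxpd _ _ _) (_ *m _) (_ *m _) => X Y U V.
by apply/matrixP => i l; rewrite !mxE; ring.
Qed.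

Lemma mxsmooth_dual D (F : 'rV[R]_2 -> 'M[R[i]]_n) : open D -> mxsmooth_on D F ->
  mxsmooth_on D (fun q => - (F q)^T).
Proof.
move=> oD Fs i k; have -> : (fun q => (- (F q)^T) i k) = (fun q => - F q k i).
  by apply/funext => q; rewrite !mxE.
exact: csmoothN.
Qed.

(** The dual solution supplies the inverse: in the derivative of [F G] the terms [F A G] cancel, so
    the product keeps its value 1 throughout the ball. *)
Lemma local_frame D A p0 : open D -> (forall j, mxsmooth_on D (A j)) ->
  (forall p, D p -> flatness A p = 0) -> D p0 ->
  exists r F G, [/\ 0 < r, ball p0 r `<=` D, F p0 = 1%:M, forall p, mxcont F p &
    forall p, ball p0 r p -> [/\ F p *m G p = 1%:M, forall j, has_mpd j F p (F p *m A j p) &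
        forall j, has_mpd j G p (- (A j p *m G p))]].
Proof.
move=> oD As Af Dp0.
have [r1 [F [r10 rD F1 Fc Fd]]] := local_solution oD As Af Dp0.
have As' j : mxsmooth_on D (fun q => - (A j q)^T) by exact: mxsmooth_dual.
have Af' p : D p -> flatness (fun j q => - (A j q)^T) p = 0.
  by move=> Dp; rewrite (flatness_dual As Dp) Af// trmx0 oppr0.
have [r2 [H [r20 _ H1 _ Hd]]] := local_solution oD As' Af' Dp0.
pose r := Num.min r1 r2.
have b1 : ball p0 r `<=` ball p0 r1 by apply: le_ball; rewrite /r ge_min lexx.
have b2 : ball p0 r `<=` ball p0 r2 by apply: le_ball; rewrite /r ge_min lexx orbT.
pose G q := (H q)^T.
have Gd p j : ball p0 r p -> has_mpd j G p (- (A j p *m G p)).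
  move=> /b2 bp; have := has_mpd_tr (Hd p j bp).
  by rewrite mulmxN linearN /= trmx_mul trmxK.
exists r, F, G; split => //; first by rewrite /r lt_min r10.
  by move=> p /b1 /rD.
move=> p bp; split; [|by move=> j; exact: Fd (b1 _ bp)|by move=> j; exact: Gd].
have := @has_mpd0_ball R n n (fun q => F q *m G q) p0 r _ p bp.
rewrite F1 /G H1 trmx1 mulmx1; apply => q j bq.
have := has_mpdM (Fd q j (b1 _ bq)) (Gd q j bq).
by rewrite mulmxN mulmxA subrr.
Qed.

(** Near [q] both [Fr p] and [Fr q] solve the equation, so [Fr p] times the inverse of [Fr q] is
    constant: this is the compatibility required of a local system. The global section is [Psi p]
    times [Fr p] near [p], hence solves the equation there. *)
Lemma global_solution D A x0 : open D -> simply_connected D ->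
  (forall j, mxsmooth_on D (A j)) -> (forall p, D p -> flatness A p = 0) -> D x0 ->
  exists F, F x0 = 1%:M /\ forall p, D p -> [/\ F p \in unitmx, mxcont F p &
    forall j, has_mpd j F p (F p *m A j p)].
Proof.
move=> oD scD As Af Dx0.
have ex p : {t : R * ('rV[R]_2 -> 'M[R[i]]_n) * ('rV[R]_2 -> 'M[R[i]]_n) | D p ->
    [/\ 0 < t.1.1, ball p t.1.1 `<=` D, t.1.2 p = 1%:M, forall q, mxcont t.1.2 q & forall q, ball p t.1.1 q ->
    [/\ t.1.2 q *m t.2 q = 1%:M, forall j, has_mpd j t.1.2 q (t.1.2 q *m A j q) &
        forall j, has_mpd j t.2 q (- (A j q *m t.2 q))]]}.
  apply: cid; have [Dp|] := pselect (D p); last by exists (0, fun=> 0, fun=> 0).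
  by have [r [F [G h]]] := local_frame oD As Af Dp; exists (r, F, G).
pose rad p := (sval (ex p)).1.1; pose Fr p := (sval (ex p)).1.2; pose Gr p := (sval (ex p)).2.
have exP p : D p -> [/\ 0 < rad p, ball p (rad p) `<=` D, Fr p p = 1%:M,
    forall q, mxcont (Fr p) q & forall q, ball p (rad p) q -> [/\ Fr p q *m Gr p q = 1%:M,
      forall j, has_mpd j (Fr p) q (Fr p q *m A j q) &
      forall j, has_mpd j (Gr p) q (- (A j q *m Gr p q))]].
  by rewrite /rad /Fr /Gr; case: (ex p).
have rad0 p : D p -> 0 < rad p by move=> /exP[].
have radD p : D p -> ball p (rad p) `<=` D by move=> /exP[].
have Fr1 p : D p -> Fr p p = 1%:M by move=> /exP[].
have FrU p q : D p -> ball p (rad p) q -> Fr p q \in unitmx.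
  by move=> /exP[_ _ _ _ h] /h[/mulmx1_unit[]].
have FrC p q : D p -> ball p (rad p) q -> \forall q' \near q, Fr p q' = Fr p q *m Fr q q'.
  move=> Dp bq; have Dq := radD p Dp q bq.
  have [_ _ _ _ hp] := exP p Dp; have [rq0 _ _ _ hq] := exP q Dq.
  have : \forall q' \near q, ball p (rad p) q'.
    by apply: open_nbhs_nbhs; split; [exact: ball_open|exact: bq].
  move=> /nbhs_ballP[e /= e0 eP].
  pose r := Num.min e (rad q).
  have r0 : 0 < r by rewrite /r lt_min e0.
  have b1 : ball q r `<=` ball q e by apply: le_ball; rewrite /r ge_min lexx.
  have b2 : ball q r `<=` ball q (rad q) by apply: le_ball; rewrite /r ge_min lexx orbT.
  have : \forall q' \near q, ball q r q' by exact: nbhsx_ballx.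
  apply: filterS => q' bq'.
  have const := @has_mpd0_ball R n n (fun z => Fr p z *m Gr q z) q r _ q' bq'.
  have [FG _ _] := hq q' (b2 _ bq'); have GF := mulmx1C FG.
  have [FG0 _ _] := hq q (ballxx q rq0).
  rewrite Fr1// mul1mx in FG0.
  rewrite -[LHS]mulmx1 -GF mulmxA const ?FG0 ?mulmx1//.
  move=> z j bz; have [_ /(_ j) h1 _] := hp z (eP _ (b1 _ bz)).
  have [_ _ /(_ j) h2] := hq z (b2 _ bz).
  by have := has_mpdM h1 h2; rewrite mulmxN mulmxA subrr.
have [Psi [Psi1 PsiP]] := global_section rad0 radD Fr1 FrU FrC scD Dx0.
exists Psi; split => // p Dp; have [u N] := PsiP p Dp.
have N' : \forall q \near p, Psi p *m Fr p q = Psi q by apply: filterS N => q ->.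
have [r0 _ F1 Fc /(_ p (ballxx p r0))[_ hd _]] := exP p Dp.
split => // [|j]; first exact: mxcont_near N' (mxcont_mull (Psi p) (Fc p)).
apply: has_mpd_near N' _; have h := hd j.
have := has_mpdM (has_mpd_cst j (Psi p) p) h.
by rewrite mul0mx add0r F1 mul1mx.
Qed.

(* Along a path, the function is locally constant. *)
Lemma has_mpd0_const m k D (F : 'rV[R]_2 -> 'M[R[i]]_(m, k)) x y : open D ->
  simply_connected D -> (forall p j, D p -> has_mpd j F p 0) -> D x -> D y -> F x = F y.
Proof.
move=> oD [_ /(_ x y) conn _] Fd Dx Dy.
have [g /path_full [gc gD gx gy]] := conn Dx Dy.
rewrite -(gx 0 (lexx 0)) -(gy 1 (lexx 1)).
pose P (a b : R) := F ((g \o clamp01) a) = F ((g \o clamp01) b).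
apply: (@interval_ind _ P) => // [a b d _ _ _ _|t _ _]; first by rewrite /P => ->.
have := gD t; set p := (g \o clamp01) t => Dp.
have /nbhs_ballP[r /= r0 rD] := near_open oD Dp.
have const q : ball p r q -> F q = F p.
  by move=> bq; apply: (@has_mpd0_ball _ _ _ F p r) => // z j /rD Dz; exact: Fd.
have N : \forall s \near t, ball p r ((g \o clamp01) s) by exact: gc t _ (nbhsx_ballx p _ r0).
move: N => /nbhs_ballP[e /= e0 eP]; exists e => // a b _ _ _ ta tb.
by rewrite /P !const//; apply: eP; rewrite /ball /= distrC.
Qed.

(** The inverse is delivered together with its own differential equation, from which the uniqueness
    of solutions is read off later. *)
Lemma global_frame D A x0 : open D -> simply_connected D ->
  (forall j, mxsmooth_on D (A j)) -> (forall p, D p -> flatness A p = 0) -> D x0 ->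
  exists F G, F x0 = 1%:M /\ forall p, D p -> [/\ F p *m G p = 1%:M, mxcont F p,
    forall j, has_mpd j F p (F p *m A j p) & forall j, has_mpd j G p (- (A j p *m G p))].
Proof.
move=> oD scD As Af Dx0.
have [F [F1 Fd]] := global_solution oD scD As Af Dx0.
have As' j : mxsmooth_on D (fun q => - (A j q)^T) by exact: mxsmooth_dual.
have Af' p : D p -> flatness (fun j q => - (A j q)^T) p = 0.
  by move=> Dp; rewrite (flatness_dual As Dp) Af// trmx0 oppr0.
have [H [H1 Hd]] := global_solution oD scD As' Af' Dx0.
have Gd p j : D p -> has_mpd j (fun q => (H q)^T) p (- (A j p *m (H p)^T)).
  move=> Dp; have [_ _ /(_ j) h] := Hd p Dp; have := has_mpd_tr h.
  by rewrite mulmxN linearN /= trmx_mul trmxK.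
exists F, (fun q => (H q)^T); split => // p Dp.
split; [|by have [] := Fd p Dp|by move=> j; have [_ _ /(_ j)] := Fd p Dp|by move=> j; exact: Gd].
have -> : F p *m (H p)^T = F x0 *m (H x0)^T; last by rewrite F1 H1 trmx1 mulmx1.
apply: (@has_mpd0_const n n D (fun q => F q *m (H q)^T)) => // q j Dq.
have [_ _ /(_ j) h] := Fd q Dq.
by have := has_mpdM h (Gd q j Dq); rewrite mulmxN mulmxA subrr.
Qed.

End GlobalSolution.

Local Open Scope ring_scope.

(** * Derivatives with respect to a and b *)

Section ComplexDerivatives.
Context {R : realType}.
Variable c : surface_case.
Implicit Types (f g : 'rV[R]_2 -> R[i]) (p q : 'rV[R]_2) (D : set 'rV[R]_2) (da db : R[i]).

Lemma mulii : ('i : R[i]) * 'i = - 1.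
Proof. by rewrite -expr2 sqrCi. Qed.

(** The real partial derivatives are recovered from [f_z] and [f_zbar] by [f_x = f_z + f_zbar] and
    [f_y = i (f_z - f_zbar)]. In this form existence and value go together, and one set of rules
    covers both kinds of coordinates. *)
Definition has_ab f p da db :=
  has_cpd 0 f p (if conformal c then da + db else da) /\
  has_cpd 1 f p (if conformal c then 'i * (da - db) else db).

Lemma has_ab_dela f p da db : has_ab f p da db -> dela c f p = da.
Proof.
case=> /has_cpd_val h0 /has_cpd_val h1; rewrite /dela h0 h1; case: conformal => //.
have two : (2 : R[i]) != 0 by rewrite pnatr_eq0.
by rewrite [_ * (_ * _)]mulrA mulii; field.
Qed.

Lemma has_ab_delb f p da db : has_ab f p da db -> delb c f p = db.
Proof.
case=> /has_cpd_val h0 /has_cpd_val h1; rewrite /delb h0 h1; case: conformal => //.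
have two : (2 : R[i]) != 0 by rewrite pnatr_eq0.
by rewrite [_ * (_ * _)]mulrA mulii; field.
Qed.

Lemma has_ab_eq f p da db da' db' : da = da' -> db = db' -> has_ab f p da db -> has_ab f p da' db'.
Proof. by move=> -> ->. Qed.

Lemma has_ab_near f g p da db : (\forall q \near p, f q = g q) ->
  has_ab f p da db -> has_ab g p da db.
Proof. by move=> fg [h1 h2]; split; [exact: has_cpd_near h1|exact: has_cpd_near h2]. Qed.

Lemma has_ab_cst (k : R[i]) p : has_ab (fun=> k) p 0 0.
Proof.
by split; case: ifP => _; rewrite ?subrr ?addr0 ?mulr0; exact: has_cpd_cst.
Qed.

Lemma has_abD f g p fa fb ga gb : has_ab f p fa fb -> has_ab g p ga gb ->
  has_ab (fun q => f q + g q) p (fa + ga) (fb + gb).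
Proof.
move=> [f0 f1] [g0 g1]; split; [apply: has_cpd_eq (has_cpdD f0 g0)|apply: has_cpd_eq (has_cpdD f1 g1)];
  case: conformal => //; ring.
Qed.

Lemma has_abN f p fa fb : has_ab f p fa fb -> has_ab (fun q => - f q) p (- fa) (- fb).
Proof.
move=> [f0 f1]; split; [apply: has_cpd_eq (has_cpdN f0)|apply: has_cpd_eq (has_cpdN f1)];
  case: conformal => //; ring.
Qed.

Lemma has_abM f g p fa fb ga gb : has_ab f p fa fb -> has_ab g p ga gb ->
  has_ab (fun q => f q * g q) p (fa * g p + f p * ga) (fb * g p + f p * gb).
Proof.
move=> [f0 f1] [g0 g1]; split; [apply: has_cpd_eq (has_cpdM f0 g0)|apply: has_cpd_eq (has_cpdM f1 g1)];
  case: conformal => //; ring.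
Qed.

(** Conjugation exchanges z and zbar, but preserves the real coordinates u and v. All the reality
    properties of the frames rest on this. *)
Lemma has_abJ f p fa fb : has_ab f p fa fb -> has_ab (fun q => (f q)^*) p
  (if conformal c then fb^* else fa^*) (if conformal c then fa^* else fb^*).
Proof.
move=> [f0 f1]; split; [apply: has_cpd_eq (has_cpdJ f0)|apply: has_cpd_eq (has_cpdJ f1)];
  case: conformal => //.
  by rewrite -[LHS]/((_)^*) rmorphD addrC.
by rewrite -[LHS]/((_)^*) rmorphM rmorphB /= conjCi; ring.
Qed.

Lemma has_ab_sum (I : Type) (r : seq I) (F : I -> 'rV[R]_2 -> R[i]) p (Fa Fb : I -> R[i]) :
  (forall i, has_ab (F i) p (Fa i) (Fb i)) ->
  has_ab (fun q => \sum_(i <- r) F i q) p (\sum_(i <- r) Fa i) (\sum_(i <- r) Fb i).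
Proof.
move=> Fd; elim: r => [|i r IH].
  by rewrite !big_nil; under eq_fun do rewrite big_nil; exact: has_ab_cst.
by rewrite !big_cons; under eq_fun do rewrite big_cons; exact: has_abD.
Qed.

Lemma has_cpd_ab f p d0 d1 : has_cpd 0 f p d0 -> has_cpd 1 f p d1 ->
  has_ab f p (dela c f p) (delb c f p).
Proof.
move=> h0 h1; rewrite /dela /delb (has_cpd_val h0) (has_cpd_val h1) /has_ab.
have two : (2 : R[i]) != 0 by rewrite pnatr_eq0.
case: conformal; split => //.
  by apply: has_cpd_eq h0; field.
apply: has_cpd_eq h1; apply/esym.
have -> : 2^-1 * (d0 - 'i * d1) - 2^-1 * (d0 + 'i * d1) = - ('i * d1) by field.
by rewrite mulrN mulrA mulii mulN1r opprK.
Qed.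

Lemma csmooth_ab D f p : csmooth_on D f -> D p -> has_ab f p (dela c f p) (delb c f p).
Proof. by move=> fs Dp; apply: has_cpd_ab; exact: csmooth_has_cpd fs Dp. Qed.

Lemma csmooth_dela D f : open D -> csmooth_on D f -> csmooth_on D (dela c f).
Proof.
move=> oD fs; rewrite /dela; case: conformal; last exact: csmooth_cpd.
apply: csmoothZ => //; apply: csmoothB => //; first exact: csmooth_cpd.
by apply: csmoothZ => //; exact: csmooth_cpd.
Qed.

Lemma csmooth_delb D f : open D -> csmooth_on D f -> csmooth_on D (delb c f).
Proof.
move=> oD fs; rewrite /delb; case: conformal; last exact: csmooth_cpd.
apply: csmoothZ => //; apply: csmoothD => //; first exact: csmooth_cpd.
by apply: csmoothZ => //; exact: csmooth_cpd.
Qed.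

Lemma has_ab_expR (w : 'rV[R]_2 -> R) (k : R) p wa wb :
  has_ab (fun q => (w q)%:C) p wa wb ->
  has_ab (fun q => (expR (k * w q))%:C) p (k%:C * wa * (expR (k * w p))%:C)
    (k%:C * wb * (expR (k * w p))%:C).
Proof.
have K j d : has_cpd j (fun q => (w q)%:C) p d ->
    has_cpd j (fun q => (expR (k * w q))%:C) p (k%:C * d * (expR (k * w p))%:C).
  move=> [h1 h2]; have : is_derive p (delta_mx 0 j : 'rV[R]_2) (fun q => (k * w q)) (k * Re d).
    exact: (@is_deriveZ _ _ _ _ k p _ _ h1).
  move=> /is_derive_expR_comp h; have := has_cpd_real h; apply: has_cpd_eq.
  have Id : Im d = 0.
    by rewrite -[LHS](@derive_val _ _ _ _ _ _ _ h2) derive_cst.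
  case: d Id {h1 h2 h} => a b /= ->.
  by rewrite -[a +i* 0]/(a%:C) -!rmorphM.
move=> [h0 h1]; split; [apply: has_cpd_eq (K _ _ h0)|apply: has_cpd_eq (K _ _ h1)];
  case: conformal => //; ring.
Qed.

Definition has_mab m n (F : 'rV[R]_2 -> 'M[R[i]]_(m, n)) p (Fa Fb : 'M[R[i]]_(m, n)) :=
  forall i k, has_ab (fun q => F q i k) p (Fa i k) (Fb i k).

Lemma has_mab_mpd m n (F : 'rV[R]_2 -> 'M[R[i]]_(m, n)) p Fa Fb : has_mab F p Fa Fb ->
  has_mpd 0 F p (if conformal c then Fa + Fb else Fa) /\
  has_mpd 1 F p (if conformal c then 'i *: (Fa - Fb) else Fb).
Proof.
move=> h; split=> i k; have [h0 h1] := h i k.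
  by apply: has_cpd_eq h0; case: conformal; rewrite ?mxE.
by apply: has_cpd_eq h1; case: conformal; rewrite ?mxE.
Qed.

Lemma mpd_has_mab m n (F : 'rV[R]_2 -> 'M[R[i]]_(m, n)) p Fa Fb :
  has_mpd 0 F p (if conformal c then Fa + Fb else Fa) ->
  has_mpd 1 F p (if conformal c then 'i *: (Fa - Fb) else Fb) -> has_mab F p Fa Fb.
Proof.
move=> h0 h1 i k; split.
  by apply: has_cpd_eq (h0 i k); case: conformal; rewrite ?mxE.
by apply: has_cpd_eq (h1 i k); case: conformal; rewrite ?mxE.
Qed.

Lemma has_mab_dela m n (F : 'rV[R]_2 -> 'M[R[i]]_(m, n)) p Fa Fb :
  has_mab F p Fa Fb -> mxdela c F p = Fa.
Proof. by move=> h; apply/matrixP => i k; rewrite mxE; exact: has_ab_dela (h i k). Qed.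

Lemma has_mab_delb m n (F : 'rV[R]_2 -> 'M[R[i]]_(m, n)) p Fa Fb :
  has_mab F p Fa Fb -> mxdelb c F p = Fb.
Proof. by move=> h; apply/matrixP => i k; rewrite mxE; exact: has_ab_delb (h i k). Qed.

Lemma has_mab_eq m n (F : 'rV[R]_2 -> 'M[R[i]]_(m, n)) p Fa Fb Fa' Fb' : Fa = Fa' -> Fb = Fb' ->
  has_mab F p Fa Fb -> has_mab F p Fa' Fb'.
Proof. by move=> -> ->. Qed.

Lemma has_mab_near m n (F G : 'rV[R]_2 -> 'M[R[i]]_(m, n)) p Fa Fb : (\forall q \near p, F q = G q) ->
  has_mab F p Fa Fb -> has_mab G p Fa Fb.
Proof. by move=> FG h i k; apply: has_ab_near (h i k); apply: filterS FG => q ->. Qed.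

Lemma has_mab_cst m n (M : 'M[R[i]]_(m, n)) p : has_mab (fun=> M) p 0 0.
Proof. by move=> i k; rewrite !mxE; exact: has_ab_cst. Qed.

Lemma has_mabD m n (F G : 'rV[R]_2 -> 'M[R[i]]_(m, n)) p Fa Fb Ga Gb :
  has_mab F p Fa Fb -> has_mab G p Ga Gb -> has_mab (fun q => F q + G q) p (Fa + Ga) (Fb + Gb).
Proof.
by move=> Fd Gd i k; rewrite !mxE; under eq_fun do rewrite mxE; exact: has_abD.
Qed.

Lemma has_mabM m n k (F : 'rV[R]_2 -> 'M[R[i]]_(m, n)) (G : 'rV[R]_2 -> 'M[R[i]]_(n, k)) p Fa Fb Ga Gb :
  has_mab F p Fa Fb -> has_mab G p Ga Gb ->
  has_mab (fun q => F q *m G q) p (Fa *m G p + F p *m Ga) (Fb *m G p + F p *m Gb).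
Proof.
move=> Fd Gd i l; rewrite !mxE -!big_split/=.
by under eq_fun do rewrite mxE; apply: has_ab_sum => s; exact: has_abM.
Qed.

Lemma has_mabZ m n f (F : 'rV[R]_2 -> 'M[R[i]]_(m, n)) p fa fb Fa Fb :
  has_ab f p fa fb -> has_mab F p Fa Fb ->
  has_mab (fun q => f q *: F q) p (fa *: F p + f p *: Fa) (fb *: F p + f p *: Fb).
Proof.
by move=> fd Fd i k; rewrite !mxE; under eq_fun do rewrite mxE; exact: has_abM.
Qed.

Lemma has_mab_tr m n (F : 'rV[R]_2 -> 'M[R[i]]_(m, n)) p Fa Fb :
  has_mab F p Fa Fb -> has_mab (fun q => (F q)^T) p Fa^T Fb^T.
Proof. by move=> Fd i k; rewrite !mxE; under eq_fun do rewrite mxE; exact: Fd. Qed.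

Definition cmx m n (M : 'M[R[i]]_(m, n)) : 'M[R[i]]_(m, n) := map_mx Num.conj M.

Lemma has_mabJ m n (F : 'rV[R]_2 -> 'M[R[i]]_(m, n)) p Fa Fb :
  has_mab F p Fa Fb -> has_mab (fun q => cmx (F q)) p
  (if conformal c then cmx Fb else cmx Fa) (if conformal c then cmx Fa else cmx Fb).
Proof.
move=> Fd i k; have -> : (fun q => cmx (F q) i k) = (fun q => (F q i k)^*).
  by apply/funext => q; rewrite mxE.
by apply: has_ab_eq (has_abJ (Fd i k)); case: conformal; rewrite mxE.
Qed.

Lemma has_mab_col m n (F : 'rV[R]_2 -> 'M[R[i]]_(m, n)) p Fa Fb k :
  has_mab F p Fa Fb -> has_mab (fun q => col k (F q)) p (col k Fa) (col k Fb).
Proof. by move=> Fd i j; rewrite !mxE; under eq_fun do rewrite mxE; exact: Fd. Qed.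

Lemma mxsmooth_mab m n D (F : 'rV[R]_2 -> 'M[R[i]]_(m, n)) p : mxsmooth_on D F -> D p ->
  has_mab F p (mxdela c F p) (mxdelb c F p).
Proof. by move=> Fs Dp i k; rewrite !mxE; exact: csmooth_ab (Fs i k) Dp. Qed.

Lemma mxsmooth_dela m n D (F : 'rV[R]_2 -> 'M[R[i]]_(m, n)) : open D -> mxsmooth_on D F ->
  mxsmooth_on D (mxdela c F).
Proof. by move=> oD Fs i k; under eq_fun do rewrite mxE; exact: csmooth_dela. Qed.

Lemma mxsmooth_delb m n D (F : 'rV[R]_2 -> 'M[R[i]]_(m, n)) : open D -> mxsmooth_on D F ->
  mxsmooth_on D (mxdelb c F).
Proof. by move=> oD Fs i k; under eq_fun do rewrite mxE; exact: csmooth_delb. Qed.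

Lemma has_mab0_const m n D (F : 'rV[R]_2 -> 'M[R[i]]_(m, n)) x y : open D ->
  simply_connected D -> (forall p, D p -> has_mab F p 0 0) -> D x -> D y -> F x = F y.
Proof.
move=> oD scD Fd; apply: has_mpd0_const => // p j Dp.
have [h0 h1] := has_mab_mpd (Fd p Dp).
by have [->|->] := ord2 j; move: h0 h1; case: conformal; rewrite ?subrr ?scaler0 ?addr0.
Qed.

End ComplexDerivatives.

(** * Frames of surfaces *)

Section ThreeByThree.
Context {K : nmodType}.

Lemma ord3 (i : 'I_3) : [\/ i = 0, i = 1 | i = 2].
Proof.
by case: i => -[|[|[|//]]] ilt; [constructor 1|constructor 2|constructor 3]; exact: val_inj.
Qed.

Lemma sum3 (F : 'I_3 -> K) : \sum_i F i = F 0 + F 1 + F 2.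
Proof.
by rewrite !big_ord_recl big_ord0 addr0 addrA; congr (F _ + F _ + F _); exact: val_inj.
Qed.

Lemma mx3E (a b c d e f g h k : K) : let M := mx3 [:: [:: a; b; c]; [:: d; e; f]; [:: g; h; k]] in
  ((M 0 0 = a) * (M 0 1 = b) * (M 0 2 = c) * (M 1 0 = d) * (M 1 1 = e) * (M 1 2 = f) *
   (M 2 0 = g) * (M 2 1 = h) * (M 2 2 = k))%type.
Proof. by do !split; rewrite mxE. Qed.

End ThreeByThree.

Lemma col3E (K : Type) (a b d : 'cV[K]_3) (i : 'I_3) :
  ((col3 a b d i 0 = a i 0) * (col3 a b d i 1 = b i 0) * (col3 a b d i 2 = d i 0))%type.
Proof. by do !split; rewrite mxE. Qed.

Lemma det2 (K : comRingType) (M : 'M[K]_2) : \det M = M 0 0 * M 1 1 - M 0 1 * M 1 0.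
Proof.
rewrite (expand_det_row _ 0) !big_ord_recl big_ord0 addr0 /cofactor !det_mx11 !mxE /=.
have -> : lift (0 : 'I_2) (0 : 'I_1) = 1 by exact: val_inj.
have -> : lift (1 : 'I_2) (0 : 'I_1) = 0 by exact: val_inj.
have -> : (ord0 : 'I_2) = 0 by exact: val_inj.
by rewrite /bump /= !addn0 expr0 expr1; ring.
Qed.

Lemma det3 (K : comRingType) (M : 'M[K]_3) : \det M =
  M 0 0 * (M 1 1 * M 2 2 - M 1 2 * M 2 1) - M 0 1 * (M 1 0 * M 2 2 - M 1 2 * M 2 0)
  + M 0 2 * (M 1 0 * M 2 1 - M 1 1 * M 2 0).
Proof.
rewrite (expand_det_row _ 0) sum3 /cofactor !det2 !mxE /=.
have E (i : 'I_3) (j : 'I_2) : lift i j = match val i, val j with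
  | 0%N, 0%N => 1 | 0%N, _ => 2 | 1%N, 0%N => 0 | 1%N, _ => 2 | _, 0%N => 0 | _, _ => 1 end.
  by case: (ord3 i) => ->; case: (ord2 j) => ->; exact: val_inj.
rewrite !E /=; ring.
Qed.

Section MatrixOps3.
Context {K : comNzRingType}.
Variables (a b c d e f g h k a' b' c' d' e' f' g' h' k' : K).
Local Notation M := (mx3 [:: [:: a; b; c]; [:: d; e; f]; [:: g; h; k]]).
Local Notation M' := (mx3 [:: [:: a'; b'; c']; [:: d'; e'; f']; [:: g'; h'; k']]).

Lemma mul_mx3 : M *m M' = mx3
  [:: [:: a * a' + b * d' + c * g'; a * b' + b * e' + c * h'; a * c' + b * f' + c * k'];
      [:: d * a' + e * d' + f * g'; d * b' + e * e' + f * h'; d * c' + e * f' + f * k'];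
      [:: g * a' + h * d' + k * g'; g * b' + h * e' + k * h'; g * c' + h * f' + k * k']].
Proof.
by apply/matrixP => i j; rewrite !mxE sum3; have [->|->|->] := ord3 i;
  have [->|->|->] := ord3 j; rewrite !mx3E.
Qed.

Lemma opp_mx3 : - M = mx3 [:: [:: - a; - b; - c]; [:: - d; - e; - f]; [:: - g; - h; - k]].
Proof.
by apply/matrixP => i j; rewrite [LHS]mxE; have [->|->|->] := ord3 i;
  have [->|->|->] := ord3 j; rewrite !mx3E.
Qed.

Lemma tr_mx3 : M^T = mx3 [:: [:: a; d; g]; [:: b; e; h]; [:: c; f; k]].
Proof.
by apply/matrixP => i j; rewrite [LHS]mxE; have [->|->|->] := ord3 i;
  have [->|->|->] := ord3 j; rewrite !mx3E.
Qed.

Lemma id_mx3 : 1%:M = mx3 [:: [:: 1; 0; 0]; [:: 0; 1; 0]; [:: 0; 0; 1]] :> 'M[K]_3.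
Proof.
by apply/matrixP => i j; rewrite [LHS]mxE; have [->|->|->] := ord3 i;
  have [->|->|->] := ord3 j; rewrite !mx3E.
Qed.

Lemma eq_mx3 : a = a' -> b = b' -> c = c' -> d = d' -> e = e' -> f = f' -> g = g' -> h = h' ->
  k = k' -> M = M'.
Proof. by do 9 move=> ->. Qed.

End MatrixOps3.

Lemma map_mx3 (K L : nmodType) (m : K -> L) (a b c d e f g h k : K) :
  map_mx m (mx3 [:: [:: a; b; c]; [:: d; e; f]; [:: g; h; k]]) =
  mx3 [:: [:: m a; m b; m c]; [:: m d; m e; m f]; [:: m g; m h; m k]].
Proof.
by apply/matrixP => i j; rewrite [LHS]mxE; have [->|->|->] := ord3 i;
  have [->|->|->] := ord3 j; rewrite !mx3E.
Qed.

(** * The equation of the frame and its solutions *)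

Section Frame.
Context {R : realType}.
Variables (c : surface_case) (D : set 'rV[R]_2) (omega : 'rV[R]_2 -> R) (Q Q2 : 'rV[R]_2 -> R[i]).
Hypotheses (oD : open D) (scD : simply_connected D) (omega_smooth : smooth_on D omega)
  (Q_coef : cubic_coefficients c D Q Q2).

Local Notation wa p := (dela c (fun y => (omega y)%:C) p).
Local Notation wb p := (delb c (fun y => (omega y)%:C) p).
Local Notation e_ p := ((expR (omega p / 2))%:C).
Local Notation e' p := ((expR (- omega p))%:C).
Local Notation q_ p := (coef_q c (Q p)).
Local Notation s_ p := (coef_s c (Q p) (Q2 p)).

Let wsmooth : csmooth_on D (fun y => (omega y)%:C).
Proof. exact: csmooth_real. Qed.

Lemma expR_smooth (k : R) : csmooth_on D (fun x => (expR (k * omega x))%:C).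
Proof.
by apply: csmooth_real => //; apply: smooth_expR => //; apply: smoothM => //; exact: smooth_cst.
Qed.

Let e1 : csmooth_on D (fun x => e_ x).
Proof. by under eq_fun do rewrite mulrC; exact: expR_smooth. Qed.
Let e2 : csmooth_on D (fun x => e' x).
Proof. by under eq_fun do rewrite -mulN1r; exact: expR_smooth. Qed.

Lemma q_smooth : csmooth_on D (fun x => q_ x).
Proof.
by move: Q_coef; rewrite /cubic_coefficients /coef_q; case: c => [h|h|[h _ _]|h|h|[h _ _]] //;
  exact: csmoothN.
Qed.

Lemma s_smooth : csmooth_on D (fun x => s_ x).
Proof.
move: Q_coef; rewrite /cubic_coefficients /coef_s; case: c => [h|h|[_ h _]|h|h|[_ h _]] //;
  by [exact: csmoothN|exact: csmoothJ].
Qed.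

Let z : csmooth_on D (fun=> 0 : R[i]). Proof. exact: csmooth_cst. Qed.
Let w2 : csmooth_on D (fun x => wa x / 2).
Proof.
have h := csmooth_dela c oD wsmooth.
by under eq_fun do rewrite mulrC; exact: csmoothZ.
Qed.
Let w2' : csmooth_on D (fun x => wb x / 2).
Proof.
have h := csmooth_delb c oD wsmooth.
by under eq_fun do rewrite mulrC; exact: csmoothZ.
Qed.

Lemma Umx_smooth lam : mxsmooth_on D (Umx c omega Q lam).
Proof.
move=> i j; rewrite /Umx; have qs := q_smooth.
have [->|->|->] := ord3 i; have [->|->|->] := ord3 j; under eq_fun do rewrite mx3E; try exact: z.
- exact: w2.
- exact: csmoothZ.
- by apply: csmoothM => //; exact: csmoothZ.
- exact: csmoothN.
- exact: csmoothZ.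
Qed.

Lemma Vmx_smooth lam : mxsmooth_on D (Vmx c omega Q Q2 lam).
Proof.
move=> i j; rewrite /Vmx; have ss := s_smooth.
have [->|->|->] := ord3 i; have [->|->|->] := ord3 j; under eq_fun do rewrite mx3E; try exact: z.
- exact: csmoothN.
- by apply: csmoothM => //; exact: csmoothZ.
- exact: w2'.
- exact: csmoothZ.
- exact: csmoothZ.
Qed.

Lemma alpha_smooth lam j : mxsmooth_on D (alpha c omega Q Q2 lam j).
Proof.
move=> i k; rewrite (_ : (fun q => _) = fun q => form_da R c j * Umx c omega Q lam q i k
   + form_db R c j * Vmx c omega Q Q2 lam q i k); last first.
  by apply/funext => q; rewrite mxE [X in X + _]mxE [X in _ + X]mxE.
by apply: csmoothD => //; apply: csmoothZ => //; first [exact: (Umx_smooth lam i k)|exact: (Vmx_smooth lam i k)].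
Qed.

(** The coefficients p and r after conjugation by [Gmx]. For A+ the additional factor ['i] turns p
    into [-1] and r into [1], so that all gauged constants are real. *)
Definition gauged_p : R[i] := match c with Aplus => -1 | _ => 1 end.
Definition gauged_r : R[i] := match c with CP => -1 | _ => 1 end.

(* The Maurer-Cartan form of the frame of the surface itself: the conjugates of
   [Umx] and [Vmx] by [Gmx]. *)
Definition gauged_U (lam : R[i]) p := mx3 [:: [:: wa p / 2; 0; gauged_p * e_ p];
  [:: lam ^- 3 * q_ p * e' p; - (wa p / 2); 0]; [:: 0; gauged_r * e_ p; 0]].
Definition gauged_V (lam : R[i]) p := mx3 [:: [:: - (wb p / 2); lam ^+ 3 * s_ p * e' p; 0];
  [:: 0; wb p / 2; gauged_p * e_ p]; [:: gauged_r * e_ p; 0; 0]].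

Definition gauge_coef : R[i] := match c with Aplus => 'i | _ => 1 end.

Lemma gauge_coef_neq0 : gauge_coef != 0.
Proof. by rewrite /gauge_coef; case: c; rewrite ?oner_neq0 ?neq0Ci. Qed.

Lemma gauged_pE : gauge_coef * coef_p R c = gauged_p.
Proof. by rewrite /gauge_coef /gauged_p /coef_p; case: c; rewrite ?mulr1// mulii. Qed.

Lemma gauged_rE : coef_r R c = gauged_r * gauge_coef.
Proof. by rewrite /gauge_coef /gauged_r /coef_r; case: c; rewrite ?mul1r ?mulr1. Qed.

Lemma Gmx_U lam p : lam != 0 -> Gmx c lam *m Umx c omega Q lam p = gauged_U lam p *m Gmx c lam.
Proof.
move=> l0; rewrite /Gmx -/gauge_coef /Umx /gauged_U -gauged_pE gauged_rE; have g0 := gauge_coef_neq0.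
apply/matrixP => i j; rewrite !mxE !sum3.
by have [->|->|->] := ord3 i; have [->|->|->] := ord3 j; rewrite !mx3E; field.
Qed.

Lemma Gmx_V lam p : lam != 0 -> Gmx c lam *m Vmx c omega Q Q2 lam p = gauged_V lam p *m Gmx c lam.
Proof.
move=> l0; rewrite /Gmx -/gauge_coef /Vmx /gauged_V -gauged_pE gauged_rE; have g0 := gauge_coef_neq0.
apply/matrixP => i j; rewrite !mxE !sum3.
by have [->|->|->] := ord3 i; have [->|->|->] := ord3 j; rewrite !mx3E; field.
Qed.

Lemma Gmx_unit lam : (lam : R[i]) != 0 -> Gmx c (lam : R[i]) \in unitmx.
Proof.
move=> l0; have g0 := gauge_coef_neq0; rewrite unitmxE det3 /Gmx -/gauge_coef !mx3E.
by rewrite unitfE !(mul0r, mulr0, subr0, addr0, mulr1) !mulf_neq0// invr_eq0.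
Qed.

Lemma alpha_mab m lam (F : 'rV[R]_2 -> 'M[R[i]]_(m, 3)) p :
  (forall j, has_mpd j F p (F p *m alpha c omega Q Q2 lam j p)) <->
  has_mab c F p (F p *m Umx c omega Q lam p) (F p *m Vmx c omega Q Q2 lam p).
Proof.
have E0 : F p *m alpha c omega Q Q2 lam 0 p = if conformal c then
    F p *m Umx c omega Q lam p + F p *m Vmx c omega Q Q2 lam p else F p *m Umx c omega Q lam p.
  rewrite /alpha /form_da /form_db; case: conformal; rewrite ?eqxx /= !scale1r ?mulmxDr//.
  by rewrite scale0r mulmx0 addr0.
have E1 : F p *m alpha c omega Q Q2 lam 1 p = if conformal c then
    'i *: (F p *m Umx c omega Q lam p - F p *m Vmx c omega Q Q2 lam p) else F p *m Vmx c omega Q Q2 lam p.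
  rewrite /alpha /form_da /form_db; case: conformal => /=.
    by rewrite mulmxDr scaleNr mulmxN -!scalemxAr scalerBr.
  by rewrite scale0r add0r scale1r.
split=> [h|/has_mab_mpd[h0 h1] j].
  by apply: mpd_has_mab; rewrite -?E0 -?E1.
by have [->|->] := ord2 j; rewrite ?E0 ?E1.
Qed.

Lemma alpha_mab_l m lam (G : 'rV[R]_2 -> 'M[R[i]]_(3, m)) p :
  (forall j, has_mpd j G p (- (alpha c omega Q Q2 lam j p *m G p))) <->
  has_mab c G p (- (Umx c omega Q lam p *m G p)) (- (Vmx c omega Q Q2 lam p *m G p)).
Proof.
have E0 : - (alpha c omega Q Q2 lam 0 p *m G p) = if conformal c then
    - (Umx c omega Q lam p *m G p) + - (Vmx c omega Q Q2 lam p *m G p) else - (Umx c omega Q lam p *m G p).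
  rewrite /alpha /form_da /form_db; case: conformal; rewrite ?eqxx /= !scale1r ?mulmxDl ?opprD//.
  by rewrite scale0r mul0mx subr0.
have E1 : - (alpha c omega Q Q2 lam 1 p *m G p) = if conformal c then
    'i *: (- (Umx c omega Q lam p *m G p) - - (Vmx c omega Q Q2 lam p *m G p))
    else - (Vmx c omega Q Q2 lam p *m G p).
  rewrite /alpha /form_da /form_db; case: conformal => /=.
    by rewrite mulmxDl scaleNr mulNmx -!scalemxAl scalerBr !scalerN opprB addrC opprK.
  by rewrite scale0r add0r scale1r.
split=> [h|/has_mab_mpd[h0 h1] j].
  by apply: mpd_has_mab; rewrite -?E0 -?E1.
by have [->|->] := ord2 j; rewrite ?E0 ?E1.
Qed.

(* [h] is the frame of a surface with cubic coefficients [lam ^- 3 * Q] and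
   [lam ^+ 3 * Q2]. *)
Definition frame_eq lam (h : 'rV[R]_2 -> 'M[R[i]]_3) := forall p, D p ->
  has_mab c h p (h p *m gauged_U lam p) (h p *m gauged_V lam p).

(** With a fundamental solution [F], the left factor [H *m A] fixes the initial value and the right
    factor [invmx A] passes to the gauged form. For uniqueness, [h' A G] is constant because [G]
    solves the equation of the inverse. *)
Lemma frame_exists lam x0 (H : 'M[R[i]]_3) : lam != 0 -> D x0 -> H \in unitmx ->
  flat_on D (alpha c omega Q Q2 lam) -> exists h, [/\ h x0 = H, mxsmooth_on D h, frame_eq lam h,
    maurer_cartan_form D (fun p => h p *m Gmx c lam) (alpha c omega Q Q2 lam) &
    forall h', h' x0 = H -> frame_eq lam h' -> forall p, D p -> h' p = h p].
Proof.
move=> l0 Dx0 Hu fl.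
have [F [G [F1 FG]]] := global_frame oD scD (alpha_smooth lam) fl Dx0.
have Gu := Gmx_unit l0.
pose A := Gmx c lam.
pose h p := H *m A *m F p *m invmx A.
have Fm p : D p -> has_mab c F p (F p *m Umx c omega Q lam p) (F p *m Vmx c omega Q Q2 lam p).
  by move=> /FG[_ _ Fd _]; apply/alpha_mab.
have hm p : D p -> has_mab c h p (h p *m gauged_U lam p) (h p *m gauged_V lam p).
  move=> Dp; have := has_mabM (has_mabM (has_mab_cst c (H *m A) p) (Fm p Dp)) (has_mab_cst c (invmx A) p).
  apply: has_mab_eq; rewrite mul0mx add0r mulmx0 addr0 /h -!mulmxA; do 3 congr (_ *m _).
    by rewrite -[LHS](mulKmx Gu) [X in _ *m X]mulmxA Gmx_U// mulmxK.
  by rewrite -[LHS](mulKmx Gu) [X in _ *m X]mulmxA Gmx_V// mulmxK.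
exists h; split.
- by rewrite /h F1 mulmx1 mulmxK.
- have Fs : mxsmooth_on D F.
    by apply: (solution_smooth oD (alpha_smooth lam)) => [p /FG[]|p j /FG[_ _ + _]].
  by apply: mxsmoothM => //; [apply: mxsmoothM => //|]; exact: mxsmooth_cst.
- exact: hm.
- move=> p Dp; have [FG1 _ Fd _] := FG p Dp; have [Fu _] := mulmx1_unit FG1.
  have E q : h q *m Gmx c lam = H *m A *m F q by rewrite /h mulmxKV.
  split; first by rewrite E !unitmx_mul Hu Gu.
  move=> j; have -> : (fun q => h q *m Gmx c lam) = (fun q => H *m A *m F q).
    by apply/funext => q; exact: E.
  have := has_mpdM (has_mpd_cst j (H *m A) p) (Fd j); rewrite mul0mx add0r => /has_mpd_val ->.
  by rewrite /= E [X in _ *m X]mulmxA mulKmx// !unitmx_mul Hu Gu.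
move=> h' h'0 h'm p Dp.
pose h'G q := h' q *m A *m G q.
have Gm q : D q -> has_mab c G q (- (Umx c omega Q lam q *m G q)) (- (Vmx c omega Q Q2 lam q *m G q)).
  move=> /FG[_ _ _ Gd]; have T := (alpha_mab_l lam G q).1.
  by apply: T => j; exact: Gd.
have K : h'G p = h'G x0.
  apply: (@has_mab0_const _ c _ _ D h'G) => // q Dq.
  have := has_mabM (has_mabM (h'm q Dq) (has_mab_cst c A q)) (Gm q Dq).
  apply: has_mab_eq; rewrite mulmx0 addr0.
    by rewrite -[h' q *m _ *m A]mulmxA -Gmx_U// mulmxN !mulmxA subrr.
  by rewrite -[h' q *m _ *m A]mulmxA -Gmx_V// mulmxN !mulmxA subrr.
have [FGx _ _ _] := FG x0 Dx0; rewrite F1 mul1mx in FGx.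
have [FGp _ _ _] := FG p Dp; have GFp := mulmx1C FGp.
rewrite /h -h'0 -[h' x0 *m A]mulmx1 -FGx -/(h'G x0) -K /h'G -[_ *m G p *m F p]mulmxA GFp mulmx1.
by rewrite mulmxK.
Qed.

End Frame.

(** * The surface and its derivatives in terms of the frame *)

Section Columns.
Context {R : realType}.
Variables (c : surface_case) (D : set 'rV[R]_2) (omega : 'rV[R]_2 -> R) (Q Q2 : 'rV[R]_2 -> R[i]).
Hypotheses (oD : open D) (scD : simply_connected D) (omega_smooth : smooth_on D omega)
  (Q_coef : cubic_coefficients c D Q Q2).
Variables (lam : R[i]) (h : 'rV[R]_2 -> 'M[R[i]]_3).
Hypotheses (lam0 : lam != 0) (h_smooth : mxsmooth_on D h) (h_eq : frame_eq c D omega Q Q2 lam h).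

Local Notation wa p := (dela c (fun y => (omega y)%:C) p).
Local Notation wb p := (delb c (fun y => (omega y)%:C) p).
Local Notation e_ p := ((expR (omega p / 2))%:C).
Local Notation e' p := ((expR (- omega p))%:C).
Local Notation ew p := ((expR (omega p))%:C).
Local Notation q_ p := (coef_q c (Q p)).
Local Notation s_ p := (coef_s c (Q p) (Q2 p)).
Local Notation h1 p := (col 0 (h p)).
Local Notation h2 p := (col 1 (h p)).
Local Notation h3 p := (col 2 (h p)).
Local Notation kap := (@gauged_p R c).
Local Notation rho := (@gauged_r R c).

Lemma col_mul3 (A M : 'M[R[i]]_3) k :
  col k (A *m M) = M 0 k *: col 0 A + M 1 k *: col 1 A + M 2 k *: col 2 A.
Proof.
by apply/matrixP => i j; rewrite !mxE sum3 !(mulrC (M _ k)).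
Qed.

Lemma e_e p : e_ p * e_ p = ew p :> R[i].
Proof. by rewrite -rmorphM /= -expRD -splitr. Qed.

Lemma ew_e' p : ew p * e' p = 1 :> R[i].
Proof. by rewrite -rmorphM /= -expRD subrr expR0. Qed.

Lemma e_inv p : (expR (- (omega p / 2)))%:C * e_ p = 1 :> R[i].
Proof. by rewrite -rmorphM /= -expRD addNr expR0. Qed.

Lemma e_ab p : D p -> has_ab c (fun p => e_ p) p (wa p / 2 * e_ p) (wb p / 2 * e_ p).
Proof.
move=> Dp; have := has_ab_expR 2^-1 (csmooth_ab c (csmooth_real oD omega_smooth) Dp).
have E q : 2^-1 * omega q = omega q / 2 by rewrite mulrC.
rewrite (_ : (fun q => (expR (2^-1 * omega q))%:C) = fun q => e_ q); last first.
  by apply/funext => q; rewrite E.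
have E2 : (2^-1 : R)%:C = 2^-1 :> R[i] by rewrite fmorphV rmorph_nat.
by apply: has_ab_eq; rewrite E E2 [2^-1 * _]mulrC.
Qed.

Lemma h1_ab p : D p -> has_mab c (fun p => h1 p) p
  ((wa p / 2) *: h1 p + (lam ^- 3 * q_ p * e' p) *: h2 p)
  (- (wb p / 2) *: h1 p + (rho * e_ p) *: h3 p).
Proof.
move=> Dp; apply: has_mab_eq (has_mab_col 0 (h_eq Dp)); rewrite col_mul3 !mx3E.
  by rewrite scale0r addr0.
by rewrite scale0r addr0.
Qed.

Lemma h2_ab p : D p -> has_mab c (fun p => h2 p) p
  (- (wa p / 2) *: h2 p + (rho * e_ p) *: h3 p)
  ((lam ^+ 3 * s_ p * e' p) *: h1 p + (wb p / 2) *: h2 p).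
Proof.
move=> Dp; apply: has_mab_eq (has_mab_col 1 (h_eq Dp)); rewrite col_mul3 !mx3E.
  by rewrite scale0r add0r.
by rewrite scale0r addr0.
Qed.

Lemma h3_ab p : D p -> has_mab c (fun p => h3 p) p ((kap * e_ p) *: h1 p) ((kap * e_ p) *: h2 p).
Proof.
move=> Dp; apply: has_mab_eq (has_mab_col 2 (h_eq Dp)); rewrite col_mul3 !mx3E.
  by rewrite !scale0r !addr0.
by rewrite !scale0r add0r addr0.
Qed.

Lemma gauged_pK : kap * kap = 1.
Proof. by rewrite /gauged_p; case: c; rewrite ?mulr1// mulrNN mulr1. Qed.

(** The sign comes from [xi = - H f]: the third column of an affine frame is the affine normal,
    which for A+ is the opposite of the surface. *)
Definition surface p := kap *: h3 p.

Lemma surface_ab p : D p -> has_mab c surface p (e_ p *: h1 p) (e_ p *: h2 p).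
Proof.
move=> Dp; apply: has_mab_eq (has_mabZ (has_ab_cst c kap p) (h3_ab Dp));
  by rewrite scale0r add0r scalerA mulrA gauged_pK mul1r.
Qed.

Lemma surface_smooth : mxsmooth_on D surface.
Proof.
move=> i j; rewrite (_ : (fun q => _) = fun q => kap * h q i 2).
  by apply: csmoothZ => //; exact: h_smooth.
by apply/funext => q; rewrite !mxE.
Qed.

Lemma dela_surface p : D p -> mxdela c surface p = e_ p *: h1 p.
Proof. by move=> Dp; exact: has_mab_dela (surface_ab Dp). Qed.

Lemma delb_surface p : D p -> mxdelb c surface p = e_ p *: h2 p.
Proof. by move=> Dp; exact: has_mab_delb (surface_ab Dp). Qed.

Lemma near_eq_on m n (F G : 'rV[R]_2 -> 'M[R[i]]_(m, n)) p :
  (forall q, D q -> F q = G q) -> D p -> \forall q \near p, F q = G q.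
Proof. by move=> FG Dp; apply: filterS (near_open oD Dp) => q /FG. Qed.

(** Differentiating the factor [e_] doubles the diagonal term of the frame equation in the
    a-direction and cancels it in the b-direction; hence [f_ab] is a pure multiple of the third
    column. *)
Lemma surface_aab p : D p -> has_mab c (mxdela c surface) p
  ((wa p * e_ p) *: h1 p + (lam ^- 3 * q_ p * (e_ p * e' p)) *: h2 p) ((rho * ew p) *: h3 p).
Proof.
move=> Dp.
have := has_mab_near (near_eq_on (fun q Dq => esym (dela_surface Dq)) Dp)
  (has_mabZ (e_ab Dp) (h1_ab Dp)).
have two : (2 : R[i]) != 0 by rewrite pnatr_eq0.
apply: has_mab_eq.
  by apply/matrixP => i j; rewrite !mxE; field.
rewrite -e_e; apply/matrixP => i j; rewrite !mxE; ring.
Qed.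

Lemma surface_abb p : D p -> has_mab c (mxdelb c surface) p
  ((rho * ew p) *: h3 p) ((wb p * e_ p) *: h2 p + (lam ^+ 3 * s_ p * (e_ p * e' p)) *: h1 p).
Proof.
move=> Dp.
have := has_mab_near (near_eq_on (fun q Dq => esym (delb_surface Dq)) Dp)
  (has_mabZ (e_ab Dp) (h2_ab Dp)).
have two : (2 : R[i]) != 0 by rewrite pnatr_eq0.
apply: has_mab_eq.
  by rewrite -e_e; apply/matrixP => i j; rewrite !mxE; ring.
by apply/matrixP => i j; rewrite !mxE; field.
Qed.

(** Liouville's formula: [gauged_U] and [gauged_V] have trace 0. It is checked on the expanded
    determinant, wrapped as a 1 by 1 matrix. *)
Lemma det_const x y : D x -> D y -> \det (h x) = \det (h y).
Proof.
move=> Dx Dy; pose F p : 'M[R[i]]_1 := (\det (h p))%:M.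
have K : F x = F y.
  apply: (@has_mab0_const _ c _ _ D F) => // p Dp i j; rewrite !ord1 !mxE.
  rewrite (_ : (fun q => _) = fun q => \det (h q)); last first.
    by apply/funext => q; rewrite mxE mulr1n.
  have H i' j' := h_eq Dp i' j'.
  rewrite (_ : (fun q => \det (h q)) = fun q => h q 0 0 * (h q 1 1 * h q 2 2 + - (h q 1 2 * h q 2 1))
     + - (h q 0 1 * (h q 1 0 * h q 2 2 + - (h q 1 2 * h q 2 0)))
     + h q 0 2 * (h q 1 0 * h q 2 1 + - (h q 1 1 * h q 2 0))); last first.
    by apply/funext => q; rewrite det3.
  have minor i1 j1 i2 j2 i3 j3 i4 j4 := has_abD (has_abM (H i1 j1) (H i2 j2)) (has_abN (has_abM (H i3 j3) (H i4 j4))).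
  apply: has_ab_eq (has_abD (has_abD (has_abM (H 0 0) (minor 1 1 2 2 1 2 2 1))
    (has_abN (has_abM (H 0 1) (minor 1 0 2 2 1 2 2 0)))) (has_abM (H 0 2) (minor 1 0 2 1 1 1 2 0))).
    rewrite !mxE !sum3 /gauged_U !mx3E; ring.
  rewrite !mxE !sum3 /gauged_V !mx3E; ring.
have := congr1 (fun M : 'M[R[i]]_1 => M 0 0) K.
by rewrite !mxE !mulr1n.
Qed.

End Columns.

(** * Symmetries of the Maurer-Cartan form *)

Section Conjugation.
Context {R : realType}.
Variables (c : surface_case) (D : set 'rV[R]_2) (omega : 'rV[R]_2 -> R) (Q Q2 : 'rV[R]_2 -> R[i]).
Hypotheses (oD : open D) (scD : simply_connected D) (omega_smooth : smooth_on D omega)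
  (Q_coef : cubic_coefficients c D Q Q2).
Variable (lam : R[i]).
Hypothesis Llam : Lambda0 c lam.

Local Notation wa p := (dela c (fun y => (omega y)%:C) p).
Local Notation wb p := (delb c (fun y => (omega y)%:C) p).
Local Notation e_ p := ((expR (omega p / 2))%:C).
Local Notation e' p := ((expR (- omega p))%:C).
Local Notation q_ p := (coef_q c (Q p)).
Local Notation s_ p := (coef_s c (Q p) (Q2 p)).
Local Notation kap := (@gauged_p R c).
Local Notation rho := (@gauged_r R c).

Lemma realJ (x : R) : (x%:C : R[i])^* = x%:C.
Proof. by rewrite -[LHS]/((x +i* 0)^*%C) /= oppr0. Qed.

Lemma Lambda0_neq0 : lam != 0.
Proof.
move: Llam; rewrite /Lambda0; case: conformal => /= l; last by rewrite gt_eqF.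
by apply: contra_eq_neq l => ->; rewrite normr0 eq_sym oner_neq0.
Qed.

(** This is how the choice of [Lambda0] enters: conjugation inverts [lam] on the circle, which
    matches the exchange of [lam ^- 3 * Q] with [lam ^+ 3] times the conjugate of [Q], and it fixes
    [lam] on the positive reals. *)
Lemma lamJ : lam^* = if conformal c then lam^-1 else lam.
Proof.
have l0 := Lambda0_neq0; move: Llam; rewrite /Lambda0; case: conformal => /= l.
  apply: (mulfI l0); rewrite mulfV// -normCK l expr1n.
  by [].
by apply: conj_Creal; exact: gtr0_real.
Qed.

Lemma wJ p : D p -> (wa p)^* = (if conformal c then wb p else wa p) /\
  (wb p)^* = (if conformal c then wa p else wb p).
Proof.
move=> Dp; have h := csmooth_ab c (csmooth_real oD omega_smooth) Dp.
have := has_abJ h; rewrite (_ : (fun q => _^*) = fun q => (omega q)%:C); last first.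
  by apply/funext => q; rewrite realJ.
move=> H; have Ea := has_ab_dela H; have Eb := has_ab_delb H.
move: Ea Eb; case: conformal => Ea Eb; last by split; [rewrite -Ea|rewrite -Eb].
by split; [rewrite Ea conjCK|rewrite Eb conjCK].
Qed.

Lemma gauged_pJ : kap^* = kap.
Proof. by rewrite /gauged_p; case: c; rewrite ?rmorphN rmorph1. Qed.

Lemma gauged_rJ : rho^* = rho.
Proof. by rewrite /gauged_r; case: c; rewrite ?rmorphN rmorph1. Qed.

Lemma imagJ (x : R[i]) : Re x = 0 -> x^* = - x.
Proof.
move=> h; rewrite -[LHS]/(x^*%C); apply: complex_eq; rewrite ?cReJ ?cImJ ?cReN ?cImN//.
by rewrite h oppr0.
Qed.

Lemma realCJ (x : R[i]) : Im x = 0 -> x^* = x.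
Proof. by case: x => a b /= ->; rewrite -[LHS]/((a +i* 0)^*%C) /= oppr0. Qed.

Definition lagrangian_case := match c with CP | CH | T => true | _ => false end.

(** The sign [-1] is what skew-Hermitian symmetry requires in the Lagrangian cases; the sign [1]
    expresses reality in the affine ones. *)
Lemma qsJ p : D p -> (q_ p)^* = (if lagrangian_case then -1 else 1) * (if conformal c then s_ p else q_ p) /\
  (s_ p)^* = (if lagrangian_case then -1 else 1) * (if conformal c then q_ p else s_ p).
Proof.
move=> Dp; move: Q_coef; rewrite /lagrangian_case /cubic_coefficients /coef_q /coef_s /conformal.
case: c => //; rewrite ?mul1r ?mulN1r ?rmorphN ?conjCK ?opprK //.
- by move=> [_ _ /(_ p Dp)[h1 h2]] /=; rewrite (imagJ h1) (imagJ h2) !opprK.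
- by move=> [_ _ /(_ p Dp)[h1 h2]]; rewrite !(realCJ h1) !(realCJ h2).
Qed.

(** The Gram matrix of [herm] in the standard basis, see [hermE]. It is also the Gram matrix
    prescribed for the frame, which is why the frame may start at 1. *)
Definition Jmx : 'M[R[i]]_3 := match c with
  | CP => 1%:M
  | T => mx3 [:: [:: 0; 1; 0]; [:: 1; 0; 0]; [:: 0; 0; -1]]
  | _ => mx3 [:: [:: 1; 0; 0]; [:: 0; 1; 0]; [:: 0; 0; -1]]
  end.

Lemma JmxK : Jmx *m Jmx = 1%:M.
Proof.
rewrite /Jmx; case: c; rewrite ?mulmx1// mul_mx3 id_mx3; apply: eq_mx3; ring.
Qed.

Lemma expJ n : (lam ^- n)^* = if conformal c then lam ^+ n else lam ^- n.
Proof. by rewrite fmorphV rmorphXn /= lamJ; case: conformal; rewrite // exprVn invrK. Qed.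

Lemma expJ' n : (lam ^+ n)^* = if conformal c then lam ^- n else lam ^+ n.
Proof. by rewrite rmorphXn /= lamJ; case: conformal; rewrite // exprVn. Qed.

Local Notation Ug := (gauged_U c omega Q lam).
Local Notation Vg := (gauged_V c omega Q Q2 lam).

Definition conj_sign : R[i] := if lagrangian_case then -1 else 1.

Lemma entriesJ p : D p ->
  [/\ (wa p / 2)^* = (if conformal c then wb p / 2 else wa p / 2),
     (wb p / 2)^* = (if conformal c then wa p / 2 else wb p / 2),
     (lam ^- 3 * q_ p * e' p)^* =
       conj_sign * (if conformal c then lam ^+ 3 * s_ p * e' p else lam ^- 3 * q_ p * e' p) &
     (lam ^+ 3 * s_ p * e' p)^* =
       conj_sign * (if conformal c then lam ^- 3 * q_ p * e' p else lam ^+ 3 * s_ p * e' p)].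
Proof.
move=> Dp; have [wJa wJb] := wJ Dp; have [qJ sJ] := qsJ Dp.
have two : (2 : R[i])^* = 2 by rewrite rmorph_nat.
have CD (x y : R[i]) : (x / y)^* = x^* / y^* by rewrite rmorphM fmorphV.
have C3 (x y z : R[i]) : (x * y * z)^* = x^* * y^* * z^* by rewrite !rmorphM.
rewrite !CD !C3 two wJa wJb expJ expJ' qJ sJ realJ /conj_sign.
by case: conformal; split => //; ring.
Qed.

Lemma scaleJ (k : R[i]) p : k^* = k -> (k * e_ p)^* = k * e_ p.
Proof. by move=> kJ; rewrite rmorphM /= kJ realJ. Qed.

(** As [Jmx] squares to 1, this places the form in the Lie algebra of the unitary group of [Jmx].
    Conjugation of dz and dzbar explains why U and V trade places in the conformal cases. *)
Lemma UVJ p : D p -> lagrangian_case ->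
  Jmx *m (cmx (if conformal c then Vg p else Ug p))^T *m Jmx = - Ug p /\
  Jmx *m (cmx (if conformal c then Ug p else Vg p))^T *m Jmx = - Vg p.
Proof.
move=> Dp lg; have [K1 K2 K3 K4] := entriesJ Dp.
have K5 := scaleJ p gauged_pJ; have K6 := scaleJ p gauged_rJ.
have K0 : (0 : R[i])^* = 0 by exact: rmorph0.
have N (x y : R[i]) : x^* = y -> (- x)^* = - y by move=> <-; rewrite rmorphN.
have N1 := N _ _ K1; have N2 := N _ _ K2.
pose U a q e := mx3 [:: [:: a; 0; kap * e]; [:: q; - a; 0]; [:: 0; rho * e; 0]] : 'M[R[i]]_3.
pose V b s e := mx3 [:: [:: - b; s; 0]; [:: 0; b; kap * e]; [:: rho * e; 0; 0]] : 'M[R[i]]_3.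
(* The entries are replaced by variables: beyond the shape of the matrices, only the conjugation
   rules of the entries matter. *)
suff gen a b q s e : a^* = (if conformal c then b else a) -> b^* = (if conformal c then a else b) ->
    q^* = conj_sign * (if conformal c then s else q) -> s^* = conj_sign * (if conformal c then q else s) ->
    (kap * e)^* = kap * e -> (rho * e)^* = rho * e ->
    (- a)^* = - (if conformal c then b else a) -> (- b)^* = - (if conformal c then a else b) ->
    Jmx *m (cmx (if conformal c then V b s e else U a q e))^T *m Jmx = - U a q e /\
    Jmx *m (cmx (if conformal c then U a q e else V b s e))^T *m Jmx = - V b s e.
  exact: (gen _ _ _ _ _ K1 K2 K3 K4 K5 K6 N1 N2).
move: {K1 K2 K3 K4 K5 K6 N1 N2} lg; rewrite /U /V /cmx /lagrangian_case /conj_sign /gauged_p /gauged_r /Jmx /lagrangian_case.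
case: c => // _ /= K1 K2 K3 K4 K5 K6 N1 N2; rewrite !map_mx3 !tr_mx3 ?id_mx3 !mul_mx3 !opp_mx3;
  split; apply: eq_mx3; rewrite ?K0 ?N1 ?N2 ?K1 ?K2 ?K3 ?K4 ?K5 ?K6; ring.
Qed.

(* [Pmx] exchanges the first two vectors of the frame, which are complex
   conjugate to each other in the cases A+ and A-. *)
Definition Pmx : 'M[R[i]]_3 := if conformal c
  then mx3 [:: [:: 0; 1; 0]; [:: 1; 0; 0]; [:: 0; 0; 1]] else 1%:M.

(** [Pmx] intertwines the form with its conjugate, so that [cmx (h p) *m Pmx] solves the same
    equation as [h]. *)
Lemma UVP p : D p -> ~~ lagrangian_case ->
  cmx (if conformal c then Vg p else Ug p) *m Pmx = Pmx *m Ug p /\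
  cmx (if conformal c then Ug p else Vg p) *m Pmx = Pmx *m Vg p.
Proof.
move=> Dp lg; have [K1 K2 K3 K4] := entriesJ Dp.
have K5 := scaleJ p gauged_pJ; have K6 := scaleJ p gauged_rJ.
have K0 : (0 : R[i])^* = 0 by exact: rmorph0.
have N (x y : R[i]) : x^* = y -> (- x)^* = - y by move=> <-; rewrite rmorphN.
have N1 := N _ _ K1; have N2 := N _ _ K2.
pose U a q e := mx3 [:: [:: a; 0; kap * e]; [:: q; - a; 0]; [:: 0; rho * e; 0]] : 'M[R[i]]_3.
pose V b s e := mx3 [:: [:: - b; s; 0]; [:: 0; b; kap * e]; [:: rho * e; 0; 0]] : 'M[R[i]]_3.
suff gen a b q s e : a^* = (if conformal c then b else a) -> b^* = (if conformal c then a else b) ->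
    q^* = conj_sign * (if conformal c then s else q) -> s^* = conj_sign * (if conformal c then q else s) ->
    (kap * e)^* = kap * e -> (rho * e)^* = rho * e ->
    (- a)^* = - (if conformal c then b else a) -> (- b)^* = - (if conformal c then a else b) ->
    cmx (if conformal c then V b s e else U a q e) *m Pmx = Pmx *m U a q e /\
    cmx (if conformal c then U a q e else V b s e) *m Pmx = Pmx *m V b s e.
  exact: (gen _ _ _ _ _ K1 K2 K3 K4 K5 K6 N1 N2).
move: {K1 K2 K3 K4 K5 K6 N1 N2} lg; rewrite /U /V /cmx /lagrangian_case /conj_sign /gauged_p /gauged_r /Pmx /lagrangian_case.
case: c => // _ /= K1 K2 K3 K4 K5 K6 N1 N2; rewrite !map_mx3 ?id_mx3 !mul_mx3;
  split; apply: eq_mx3; rewrite ?K0 ?N1 ?N2 ?K1 ?K2 ?K3 ?K4 ?K5 ?K6; ring.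
Qed.

End Conjugation.

Section Gram.
Context {R : realType}.
Variables (c : surface_case) (D : set 'rV[R]_2) (omega : 'rV[R]_2 -> R) (Q Q2 : 'rV[R]_2 -> R[i]).
Hypotheses (oD : open D) (scD : simply_connected D) (omega_smooth : smooth_on D omega)
  (Q_coef : cubic_coefficients c D Q Q2).
Variables (lam : R[i]) (h : 'rV[R]_2 -> 'M[R[i]]_3) (x0 : 'rV[R]_2).
Hypotheses (Llam : Lambda0 c lam) (h_eq : frame_eq c D omega Q Q2 lam h) (Dx0 : D x0).

Local Notation Ug := (gauged_U c omega Q lam).
Local Notation Vg := (gauged_V c omega Q Q2 lam).
Local Notation J := (@Jmx R c).

Lemma cmxM m n k (A : 'M[R[i]]_(m, n)) (B : 'M[R[i]]_(n, k)) : cmx (A *m B) = cmx A *m cmx B.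
Proof. exact: map_mxM. Qed.

(** By [UVJ] the matrix [K] solves the equation of the inverse frame, so [h K] is constantly 1. A
    right inverse being a left inverse, [K h = 1], which is the Gram identity multiplied by [J]. *)
Lemma gram p : lagrangian_case c -> h x0 = 1%:M -> D p -> (cmx (h p))^T *m J *m h p = J.
Proof.
move=> lg h0 Dp.
pose K q := J *m (cmx (h q))^T *m J.
have Km q : D q -> has_mab c K q (- (Ug q *m K q)) (- (Vg q *m K q)).
  move=> Dq; have [UJ VJ] := UVJ oD omega_smooth Q_coef Llam Dq lg.
  have := has_mabM (has_mabM (has_mab_cst c J q) (has_mab_tr (has_mabJ (h_eq Dq)))) (has_mab_cst c J q).
  have JJ := JmxK c (R := R).
  apply: has_mab_eq; rewrite !mul0mx !mulmx0 !addr0 add0r -mulNmx.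
    rewrite -UJ /K -!mulmxA (mulmxA J J) JJ mul1mx !mulmxA; congr (_ *m J).
    by rewrite -[RHS]mulmxA -trmx_mul -cmxM; case: conformal.
  rewrite -VJ /K -!mulmxA (mulmxA J J) JJ mul1mx !mulmxA; congr (_ *m J).
  by rewrite -[RHS]mulmxA -trmx_mul -cmxM; case: conformal.
pose F q := h q *m K q.
have FE : F p = F x0.
  apply: (@has_mab0_const _ c _ _ D F) => // q Dq.
  apply: has_mab_eq (has_mabM (h_eq Dq) (Km q Dq)); rewrite mulmxN.
    by rewrite -[h q *m Ug q *m K q]mulmxA subrr.
  by rewrite -[h q *m Vg q *m K q]mulmxA subrr.
have hK : h p *m K p = 1%:M.
  rewrite -/(F p) FE /F /K h0 mul1mx.
  have -> : cmx (1%:M : 'M[R[i]]_3) = 1%:M by exact: map_mx1.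
  by rewrite trmx1 mulmx1 JmxK.
have := congr1 (mulmx J) (mulmx1C hK); rewrite /K !mulmxA JmxK mul1mx mulmx1.
by [].
Qed.

Lemma reality p : ~~ lagrangian_case c -> cmx (h x0) *m Pmx c = h x0 ->
  (forall h', h' x0 = h x0 -> frame_eq c D omega Q Q2 lam h' -> forall p, D p -> h' p = h p) ->
  D p -> cmx (h p) *m Pmx c = h p.
Proof.
move=> lg h0 uniq Dp; apply: (uniq (fun q => cmx (h q) *m Pmx c)) => // q Dq.
have [UP VP] := UVP oD omega_smooth Q_coef Llam Dq lg.
have := has_mabM (has_mabJ (h_eq Dq)) (has_mab_cst c (@Pmx R c) q).
apply: has_mab_eq; rewrite !mulmx0 !addr0 -mulmxA -?UP -?VP mulmxA.
  by case: conformal; rewrite cmxM.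
by case: conformal; rewrite cmxM.
Qed.

End Gram.

(** * Minimal Lagrangian surfaces *)

Section Hermitian.
Context {R : realType}.
Variable c : surface_case.
Implicit Types (a b d : 'cV[R[i]]_3) (k : R[i]).

Lemma hermE a b : herm c a b = ((cmx b)^T *m Jmx c *m a) 0 0.
Proof.
have -> : (cmx b)^T *m Jmx c *m a = \matrix_(i, j) herm c a b; last by rewrite mxE.
apply/matrixP => i j; rewrite !ord1 [RHS]mxE mxE sum3 !mxE !sum3 /cmx !mxE /herm /Jmx.
by case: c; rewrite ?mx3E ?mxE /=; ring.
Qed.

Lemma hermDl a b d : herm c (a + b) d = herm c a d + herm c b d.
Proof. by rewrite !hermE mulmxDr mxE. Qed.

Lemma hermZl k a d : herm c (k *: a) d = k * herm c a d.
Proof. by rewrite !hermE -scalemxAr mxE. Qed.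

Lemma hermJ a b : (herm c a b)^* = herm c b a.
Proof.
have X x1 x2 x3 y1 y2 y3 :
    ((x1 * y1^* + x2 * y2^* + x3 * y3^*)^* = y1 * x1^* + y2 * x2^* + y3 * x3^* :> R[i]) /\
    ((x1 * y1^* + x2 * y2^* - x3 * y3^*)^* = y1 * x1^* + y2 * x2^* - y3 * x3^* :> R[i]).
  by rewrite rmorphB !rmorphD !rmorphM /= !conjCK; split; ring.
by rewrite /herm; case: c; rewrite ?(X _ _ _ _ _ _).1 ?(X _ _ _ _ _ _).2 //; ring.
Qed.

Lemma hermDr a b d : herm c d (a + b) = herm c d a + herm c d b.
Proof. by rewrite -hermJ hermDl rmorphD /= !hermJ. Qed.

Lemma hermZr k a d : herm c d (k *: a) = k^* * herm c d a.
Proof. by rewrite -hermJ hermZl rmorphM /= !hermJ. Qed.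

Lemma herm_col (M : 'M[R[i]]_3) i j : (cmx M)^T *m Jmx c *m M = Jmx c ->
  herm c (col j M) (col i M) = Jmx c i j.
Proof.
move=> <-; rewrite hermE !mxE; apply: eq_bigr => k _; rewrite !mxE; congr (_ * _).
by apply: eq_bigr => l _; rewrite !mxE.
Qed.

Lemma hermNl a d : herm c (- a) d = - herm c a d.
Proof. by rewrite -scaleN1r hermZl mulN1r. Qed.

Lemma hermNr a d : herm c d (- a) = - herm c d a.
Proof. by rewrite -hermJ hermNl rmorphN /= hermJ. Qed.

(* [u + v] and ['i *: (u - v)] are the real and imaginary coordinate vectors
   when [u] and [v] are the z- and zbar-derivatives. *)
Lemma herm_xy u v (E : R[i]) : herm c u u = E -> herm c v v = E -> herm c u v = 0 -> herm c v u = 0 ->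
  [/\ herm c (u + v) (u + v) = E + E, herm c ('i *: (u - v)) ('i *: (u - v)) = E + E,
      herm c (u + v) ('i *: (u - v)) = 0 & herm c ('i *: (u - v)) (u + v) = 0].
Proof.
move=> uu vv uv vu.
have P : herm c (u + v) (u + v) = E + E by rewrite hermDl !hermDr uu vv uv vu addr0 add0r.
have M : herm c (u - v) (u - v) = E + E.
  by rewrite hermDl !hermDr !hermNl !hermNr uu vv uv vu oppr0 opprK addr0 add0r.
have PM : herm c (u + v) (u - v) = 0.
  by rewrite hermDl !hermDr !hermNr uu vv uv vu oppr0 addr0 add0r subrr.
have MP : herm c (u - v) (u + v) = 0.
  by rewrite hermDl !hermDr !hermNl uu vv uv vu oppr0 addr0 add0r subrr.
have iJ : ('i : R[i])^* = - 'i by exact: conjCi.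
split; rewrite ?hermZl ?hermZr ?PM ?MP ?mulr0 //.
by rewrite M iJ mulrA mulrN mulii opprK mul1r.
Qed.

End Hermitian.

Lemma mxtrace2 (K : pzRingType) (M : 'M[K]_2) : \tr M = M 0 0 + M 1 1.
Proof. by rewrite /mxtrace !big_ord_recl big_ord0 addr0; congr (_ + M _ _); exact: val_inj. Qed.

Lemma invmx_right (K : comUnitRingType) n (A B : 'M[K]_n) : A *m B = 1%:M -> invmx A = B.
Proof. by move=> AB; have [Au _] := mulmx1_unit AB; rewrite -[B](mulKmx Au) AB mulmx1. Qed.

Section SecondDerivatives.
Context {R : realType}.
Variable c : surface_case.

(** [A], [B], [C] are the second derivatives [F_aa], [F_bb], [F_ab]; in the conformal cases the
    x-derivative is the sum of the z- and zbar-derivatives and the y-derivative is ['i] times their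
    difference. *)
Lemma second_mpd m n D (F : 'rV[R]_2 -> 'M[R[i]]_(m, n)) p A B C : open D -> mxsmooth_on D F -> D p ->
  has_mab c (mxdela c F) p A C -> has_mab c (mxdelb c F) p C B ->
  [/\ mxpd 0 (mxpd 0 F) p = if conformal c then A + C + (C + B) else A,
      mxpd 1 (mxpd 1 F) p = if conformal c then - (A - C) + (C - B) else B,
      mxpd 0 (mxpd 1 F) p = if conformal c then 'i *: (A - B) else C &
      mxpd 1 (mxpd 0 F) p = if conformal c then 'i *: (A - B) else C].
Proof.
move=> oD Fs Dp /has_mab_mpd aa /has_mab_mpd bb.
have E q : D q ->
  (if conformal c then mxdela c F q + mxdelb c F q else mxdela c F q) = mxpd 0 F q /\
  (if conformal c then 'i *: (mxdela c F q - mxdelb c F q) else mxdelb c F q) = mxpd 1 F q.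
  by move=> Dq; have [/has_mpd_val -> /has_mpd_val ->] := has_mab_mpd (mxsmooth_mab c Fs Dq).
have N0 := near_eq_on oD (fun q Dq => (E q Dq).1) Dp.
have N1 := near_eq_on oD (fun q Dq => (E q Dq).2) Dp.
case: conformal N0 N1 aa bb => N0 N1 [a0 a1] [b0 b1]; last first.
  by split; [exact: has_mpd_val (has_mpd_near N0 a0)|exact: has_mpd_val (has_mpd_near N1 b1)
    |exact: has_mpd_val (has_mpd_near N1 b0)|exact: has_mpd_val (has_mpd_near N0 a1)].
have Z j := has_cpd_cst j ('i : R[i]) p.
have Z0 (u v : 'M[R[i]]_(m, n)) : 0 *: u + 'i *: v = 'i *: v by rewrite scale0r add0r.
have iiB (u v : 'M[R[i]]_(m, n)) : 'i *: ('i *: u + - ('i *: v)) = v - u.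
  by rewrite -scalerBr scalerA mulii scaleN1r opprB.
split.
- exact: has_mpd_val (has_mpd_near N0 (has_mpdD a0 b0)).
- rewrite (has_mpd_val (has_mpd_near N1 (has_mpdZ (Z 1) (has_mpdD a1 (has_mpdN b1))))) Z0 iiB opprB.
  by rewrite addrC.
- rewrite (has_mpd_val (has_mpd_near N1 (has_mpdZ (Z 0) (has_mpdD a0 (has_mpdN b0))))) Z0.
  by congr (_ *: _); rewrite opprD addrA addrK.
- rewrite (has_mpd_val (has_mpd_near N0 (has_mpdD a1 b1))) -scalerDr.
  by congr (_ *: _); rewrite addrA subrK.
Qed.

End SecondDerivatives.

Section LagrangianSurface.
Context {R : realType}.
Variables (c : surface_case) (D : set 'rV[R]_2) (omega : 'rV[R]_2 -> R) (Q Q2 : 'rV[R]_2 -> R[i]).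
Hypotheses (oD : open D) (omega_smooth : smooth_on D omega)
  (Q_coef : cubic_coefficients c D Q Q2).
Variables (lam : R[i]) (h : 'rV[R]_2 -> 'M[R[i]]_3).
Hypotheses (lagr : lagrangian_case c) (lam0 : lam != 0) (h_smooth : mxsmooth_on D h)
  (h_eq : frame_eq c D omega Q Q2 lam h)
  (h_gram : forall p, D p -> (cmx (h p))^T *m Jmx c *m h p = Jmx c)
  (h_det : forall p, D p -> \det (h p) = 1).

Local Notation wa p := (dela c (fun y => (omega y)%:C) p).
Local Notation wb p := (delb c (fun y => (omega y)%:C) p).
Local Notation e_ p := ((expR (omega p / 2))%:C).
Local Notation e' p := ((expR (- omega p))%:C).
Local Notation ew p := ((expR (omega p))%:C).
Local Notation q_ p := (coef_q c (Q p)).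
Local Notation s_ p := (coef_s c (Q p) (Q2 p)).
Local Notation h1 p := (col 0 (h p)).
Local Notation h2 p := (col 1 (h p)).
Local Notation h3 p := (col 2 (h p)).
Local Notation rho := (@gauged_r R c).
Local Notation f := (surface c h).

Lemma lagr_surface p : f p = h3 p.
Proof. by move: lagr; rewrite /surface /gauged_p; case: c => // _; rewrite scale1r. Qed.

Lemma herm_frame p : D p ->
  [/\ herm c (h1 p) (h1 p) = (conformal c)%:R, herm c (h2 p) (h2 p) = (conformal c)%:R,
     herm c (h1 p) (h2 p) = (~~ conformal c)%:R & herm c (h2 p) (h1 p) = (~~ conformal c)%:R] /\
  [/\ herm c (h3 p) (h3 p) = quadric_level R c, herm c (h1 p) (h3 p) = 0, herm c (h2 p) (h3 p) = 0,
     herm c (h3 p) (h1 p) = 0 & herm c (h3 p) (h2 p) = 0].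
Proof.
move=> Dp; have G := h_gram Dp; rewrite !(herm_col _ _ G) /Jmx.
by move: lagr; case: c => // _; rewrite ?mx3E ?mxE.
Qed.

Lemma lift_frameE p : D p -> lift_frame c omega f p = h p.
Proof.
move=> Dp; rewrite /lift_frame (dela_surface h_eq)// (delb_surface h_eq)// lagr_surface.
rewrite !scalerA e_inv !scale1r; apply/matrixP => i j.
by have [->|->|->] := ord3 j; rewrite col3E mxE.
Qed.

Lemma surface_mpd p : D p ->
  mxpd 0 f p = (if conformal c then e_ p *: h1 p + e_ p *: h2 p else e_ p *: h1 p) /\
  mxpd 1 f p = (if conformal c then 'i *: (e_ p *: h1 p - e_ p *: h2 p) else e_ p *: h2 p).
Proof.
move=> Dp; have [d0 d1] := has_mab_mpd (surface_ab h_eq Dp).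
by rewrite (has_mpd_val d0) (has_mpd_val d1).
Qed.

Lemma surface_horizontal p j : D p -> herm c (mxpd j f p) (f p) = 0.
Proof.
move=> Dp; have [_ [_ H1 H2 _ _]] := herm_frame Dp; have [E0 E1] := surface_mpd Dp.
rewrite lagr_surface; have [->|->] := ord2 j; rewrite ?E0 ?E1; case: conformal.
- by rewrite hermDl !hermZl H1 H2 !mulr0 addr0.
- by rewrite hermZl H1 mulr0.
- by rewrite hermZl -scaleN1r hermDl !hermZl H1 H2 !mulr0 addr0 mulr0.
- by rewrite hermZl H2 mulr0.
Qed.

Lemma surface_lift : horizontal_lift c D (fun p => <[f p]>%VS) f.
Proof.
split; last by move=> p j; exact: surface_horizontal.
split; first exact: surface_smooth.
by move=> p Dp; rewrite lagr_surface; have [_ []] := herm_frame Dp.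
Qed.

Lemma surface_metric : lift_metric_function c D f omega.
Proof.
move=> p Dp; have [[H11 H22 H12 H21] _] := herm_frame Dp.
have ee : e_ p * e_ p = ew p := e_e omega p.
rewrite (dela_surface h_eq)// (delb_surface h_eq)//; move: H11 H22 H12.
by case: conformal => H11 H22 H12; split; rewrite hermZl hermZr realJ ?H11 ?H22 ?H12 ?mulr1 ?mulr0 ?ee.
Qed.

Lemma tangentE p j : D p -> tangent c f j p = mxpd j f p.
Proof. by move=> Dp; rewrite /tangent /hor surface_horizontal// mul0r scale0r subr0. Qed.

(** The matrix of [2 e^omega dz dzbar], resp. [2 e^omega du dv]. It serves both as the induced
    metric here and as the Blaschke metric of affine spheres. *)
Definition metric_mx p : 'M[R]_2 := if conformal c then (2 * expR (omega p))%:M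
  else expR (omega p) *: \matrix_(i, j) (i != j)%:R.

Lemma herm_mpd p i j : D p -> herm c (mxpd i f p) (mxpd j f p) = (metric_mx p i j)%:C.
Proof.
move=> Dp; have [[H11 H22 H12 H21] _] := herm_frame Dp; have [E0 E1] := surface_mpd Dp.
have ee : e_ p * e_ p = ew p := e_e omega p.
have two : (2 * expR (omega p))%:C = ew p + ew p :> R[i].
  by apply: complex_eq; rewrite ?cReD ?cImD /=; ring.
have cJ (x : R) : (x%:C : R[i])^* = x%:C := realJ x.
have hh u v : herm c (e_ p *: u) (e_ p *: v) = ew p * herm c u v.
  by rewrite hermZl hermZr cJ mulrA ee.
have F11 := hh (h1 p) (h1 p); have F22 := hh (h2 p) (h2 p).
have F12 := hh (h1 p) (h2 p); have F21 := hh (h2 p) (h1 p).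
rewrite /metric_mx; move: F11 F22 F12 F21 E0 E1; rewrite H11 H22 H12 H21.
case: conformal; rewrite ?mulr1 ?mulr0 => F11 F22 F12 F21 E0 E1.
  have [K1 K2 K3 K4] := herm_xy F11 F22 F12 F21.
  by have [->|->] := ord2 i; have [->|->] := ord2 j; rewrite ?E0 ?E1 mxE ?K1 ?K2 ?K3 ?K4 ?mulr1n ?mulr0n.
by have [->|->] := ord2 i; have [->|->] := ord2 j;
  rewrite ?E0 ?E1 2!mxE ?F11 ?F12 ?F21 ?F22 /= ?mulr0 ?mulr1.
Qed.

Lemma induced_metricE p : D p -> induced_metric c f p = metric_mx p.
Proof. by move=> Dp; apply/matrixP => i j; rewrite mxE !tangentE// herm_mpd. Qed.

Lemma surface_special p : D p -> special_coordinates_at c f p.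
Proof.
move=> Dp; rewrite /special_coordinates_at induced_metricE// /metric_mx.
case: conformal; rewrite !mxE /= ?mulr1n ?mulr0n ?mulr0 ?mulr1; split => //; last exact: expR_gt0.
by rewrite mulr_gt0// expR_gt0.
Qed.

Lemma surface_lagrangian p : D p -> lagrangian_at c f p.
Proof. by move=> Dp; rewrite /lagrangian_at !tangentE// herm_mpd. Qed.

(** In these coordinates the trace with respect to the metric retains only the mixed derivative
    [f_ab], which is a multiple of [f], and normal vectors are orthogonal to [f]. *)
Lemma surface_minimal p : D p -> minimal_at c f p.
Proof.
move=> Dp w [wf _]; rewrite induced_metricE//.
have [S SD] : exists S : 'I_2 -> 'I_2 -> 'cV_3, forall i j, S i j = mxpd i (mxpd j f) p.
  by exists (fun i j => mxpd i (mxpd j f) p).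
have fw : herm c (f p) w = 0 by rewrite -hermJ wf rmorph0.
have SE : second_form c f p w = \matrix_(i, j) Re (herm c (S i j) w).
  apply/matrixP => i j; rewrite [LHS]mxE [RHS]mxE /covd surface_horizontal// mul0r scale0r subr0.
  have -> : mxpd i (tangent c f j) p = S i j.
    have N : \forall q \near p, mxpd j f q = tangent c f j q.
      by apply: (near_eq_on oD _ Dp) => q Dq; rewrite tangentE.
    have sj := mxsmooth_mxpd j (surface_smooth c oD h_smooth).
    by rewrite SD; exact: has_mpd_val (has_mpd_near N (mxsmooth_has_mpd i sj Dp)).
  by rewrite /hor -scaleNr hermDl hermZl fw mulr0 addr0.
have [A [B [C [aa bb h3w]]]] : exists A B C, [/\ has_mab c (mxdela c f) p A C,
    has_mab c (mxdelb c f) p C B & herm c C w = 0].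
  exists ((wa p * e_ p) *: h1 p + (lam ^- 3 * q_ p * (e_ p * e' p)) *: h2 p).
  exists ((wb p * e_ p) *: h2 p + (lam ^+ 3 * s_ p * (e_ p * e' p)) *: h1 p).
  exists ((rho * ew p) *: h3 p); split.
  - exact: (surface_aab oD omega_smooth lam0 h_eq Dp).
  - exact: (surface_abb oD omega_smooth h_eq Dp).
  - by rewrite hermZl -lagr_surface fw mulr0.
have [/(etrans (SD _ _)) S00 /(etrans (SD _ _)) S11 /(etrans (SD _ _)) S01 /(etrans (SD _ _)) S10] :=
  second_mpd oD (surface_smooth c oD h_smooth) Dp aa bb.
move: S00 S11 S01 S10.
rewrite SE /metric_mx; case: conformal => S00 S11 S01 S10.
  rewrite invmx_scalar mul_scalar_mx mxtraceZ mxtrace2 mxE [X in _ + X]mxE -cReD -hermDl S00 S11.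
  have -> : A + C + (C + B) + (- (A - C) + (C - B)) = C + C + (C + C).
    by apply/matrixP => i j; rewrite !mxE; ring.
  by rewrite !hermDl h3w !addr0 mulr0.
set P := \matrix_(i, j) (i != j)%:R.
have PP : P *m P = 1%:M.
  apply/matrixP => i j; rewrite !mxE !big_ord_recl big_ord0 !mxE.
  by have [->|->] := ord2 i; have [->|->] := ord2 j; rewrite /= ?(mulr0, mulr1, addr0, add0r).
rewrite (@invmx_right _ _ _ ((expR (omega p))^-1 *: P)); last first.
  by rewrite -scalemxAl -scalemxAr PP scalerA mulfV ?scale1r// gt_eqF// expR_gt0.
rewrite -scalemxAl mxtraceZ mxtrace2 !mxE !big_ord_recl !big_ord0 !mxE /=.
have -> : lift ord0 ord0 = 1 :> 'I_2 by exact: val_inj.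
by rewrite !S10 !S01 !h3w /= !mulr0 !mul0r !addr0 mulr0.
Qed.

Let e_smooth : csmooth_on D (fun p => e_ p : R[i]).
Proof. by under eq_fun do rewrite mulrC; exact: expR_smooth. Qed.
Let e'_smooth : csmooth_on D (fun p => e' p : R[i]).
Proof. by under eq_fun do rewrite -mulN1r; exact: expR_smooth. Qed.

(* Only the [h2]-component of [f_aa] has a derivative along [h3]. *)
Lemma surface_cubic :
  lift_cubic c D f (fun p => lam ^- 3 * Q p) (fun p => lam ^+ 3 * Q2 p).
Proof.
have es := e_smooth; have es' := e'_smooth.
have vs (k : R[i]) g : csmooth_on D g -> csmooth_on D (fun p => k * g p * (e_ p * e' p)).
  by move=> gs; apply: csmoothM => //; [exact: csmoothZ|exact: csmoothM].
have eee p : e_ p * e' p * e_ p = 1 :> R[i] by rewrite mulrAC e_e ew_e'.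
have wsm := csmooth_real oD omega_smooth.
(* The three signs, of the cubic entry, of [gauged_r] and of the quadric, have product 1 in each of
   the Lagrangian cases. *)
have lev_q p : q_ p * rho * quadric_level R c = Q p.
  by move: lagr; rewrite /coef_q /gauged_r /quadric_level; case: c => // _; ring.
have lev_s p : ~~ conformal c -> s_ p * rho * quadric_level R c = Q2 p.
  by move: lagr; rewrite /coef_s /gauged_r /quadric_level; case: c => // _ _; ring.
move=> p Dp; have [_ [H33 H13 H23 _ _]] := herm_frame Dp; rewrite lagr_surface; split.
  have N : \forall q \near p, (wa q * e_ q) *: h1 q + (lam ^- 3 * q_ q * (e_ q * e' q)) *: h2 q
      = mxdela c (mxdela c f) q.
    by apply: (near_eq_on oD _ Dp) => q Dq; rewrite (has_mab_dela (surface_aab oD omega_smooth lam0 h_eq Dq)).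
  have us : csmooth_on D (fun q => wa q * e_ q).
    by apply: csmoothM => //; exact: csmooth_dela.
  have vs1 := vs (lam ^- 3) _ (q_smooth oD Q_coef).
  have d1 := has_mabZ (csmooth_ab c us Dp) (h1_ab h_eq Dp).
  have d2 := has_mabZ (csmooth_ab c vs1 Dp) (h2_ab h_eq Dp).
  have d := has_mab_dela (has_mab_near N (has_mabD d1 d2)).
  have lin x1 x2 x3 x4 y1 y2 y3 y4 : herm c (x1 *: h1 p + x2 *: (x3 *: h1 p + x4 *: h2 p) +
      (y1 *: h2 p + y2 *: (y3 *: h2 p + y4 *: h3 p))) (h3 p) = y2 * y4 * quadric_level R c.
    by rewrite !hermDl !hermZl !hermDl !hermZl H13 H23 H33 !mulr0 !add0r mulr0 add0r mulrA.
  rewrite [iter 3 _ _ _]d lin -[RHS]mulr1 -[X in _ = _ * X * _](lev_q p) -[X in _ = _ * X](eee p).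
  ring.
move=> nc.
have N : \forall q \near p, (wb q * e_ q) *: h2 q + (lam ^+ 3 * s_ q * (e_ q * e' q)) *: h1 q
    = mxdelb c (mxdelb c f) q.
  by apply: (near_eq_on oD _ Dp) => q Dq; rewrite (has_mab_delb (surface_abb oD omega_smooth h_eq Dq)).
have us : csmooth_on D (fun q => wb q * e_ q).
  by apply: csmoothM => //; exact: csmooth_delb.
have vs1 := vs (lam ^+ 3) _ (s_smooth oD Q_coef).
have d1 := has_mabZ (csmooth_ab c us Dp) (h2_ab h_eq Dp).
have d2 := has_mabZ (csmooth_ab c vs1 Dp) (h1_ab h_eq Dp).
have d := has_mab_delb (has_mab_near N (has_mabD d1 d2)).
have lin x1 x2 x3 x4 y1 y2 y3 y4 : herm c (x1 *: h2 p + x2 *: (x3 *: h1 p + x4 *: h2 p) +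
    (y1 *: h1 p + y2 *: (y3 *: h1 p + y4 *: h3 p))) (h3 p) = y2 * y4 * quadric_level R c.
  by rewrite !hermDl !hermZl !hermDl !hermZl H13 H23 H33 !mulr0 !add0r mulr0 add0r mulrA.
rewrite [iter 3 _ _ _]d lin -[RHS]mulr1 -[X in _ = _ * X * _](lev_s p nc) -[X in _ = _ * X](eee p).
ring.
Qed.

Lemma surface_minimal_lagrangian : minimal_lagrangian c D (fun p => <[f p]>%VS).
Proof.
move=> p Dp; exists D, f; split=> // [|q Dq]; first by have [] := surface_lift.
by split; [exact: surface_special|exact: surface_lagrangian|exact: surface_minimal].
Qed.

End LagrangianSurface.

(** The frame computed from the constructed surface equals the solution only on [D]; openness of [D]
    carries the equality over to the derivatives. *)
Lemma maurer_cartan_ext (R : realType) (D : set 'rV[R]_2) (F G : 'rV[R]_2 -> 'M[R[i]]_3) A :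
  open D -> mxsmooth_on D F -> (forall p, D p -> F p = G p) ->
  maurer_cartan_form D F A -> maurer_cartan_form D G A.
Proof.
move=> oD Fs FG H p Dp; have [Fu FA] := H p Dp; rewrite -FG//; split=> // j.
by rewrite (has_mpd_val (has_mpd_near (near_eq_on oD FG Dp) (mxsmooth_has_mpd j Fs Dp))).
Qed.

Section LagrangianFamily.
Context {R : realType}.
Variables (c : surface_case) (D : set 'rV[R]_2) (omega : 'rV[R]_2 -> R) (Q Q2 : 'rV[R]_2 -> R[i]).
Hypotheses (oD : open D) (scD : simply_connected D) (omega_smooth : smooth_on D omega)
  (Q_coef : cubic_coefficients c D Q Q2) (lagr : lagrangian_case c).

Lemma lagrangian_of_flat lam : Lambda0 c lam -> flat_on D (alpha c omega Q Q2 lam) ->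
  exists f : 'rV[R]_2 -> {vspace 'cV[R[i]]_3}, minimal_lagrangian c D f /\
      exists F : 'rV[R]_2 -> 'cV[R[i]]_3,
        [/\ horizontal_lift c D f F,
            lift_metric_function c D F omega,
            lift_cubic c D F (fun p => lam ^- 3 * Q p) (fun p => lam ^+ 3 * Q2 p),
            forall p, D p -> \det (lift_frame c omega F p) = 1
          & maurer_cartan_form D (fun p => lift_frame c omega F p *m Gmx c lam)
              (alpha c omega Q Q2 lam)].
Proof.
move=> Llam fl; have l0 := Lambda0_neq0 Llam; have [[x0 Dx0] _ _] := scD.
(* The initial frame 1 has determinant 1 and Gram matrix [Jmx c]; [det_const] and [gram] spread both
   properties over [D]. *)
have [h [h0 hs he mc _]] := frame_exists oD scD omega_smooth Q_coef l0 Dx0 (unitmx1 _ _) fl.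
have G p (Dp : D p) := gram oD scD omega_smooth Q_coef Llam he Dx0 lagr h0 Dp.
have d1 p (Dp : D p) : \det (h p) = 1 by rewrite (det_const oD scD he Dp Dx0) h0 det1.
exists (fun p => <[surface c h p]>%VS); split.
  exact: (surface_minimal_lagrangian oD omega_smooth lagr l0 hs he G).
exists (surface c h); split.
- exact: (surface_lift oD lagr hs he G).
- exact: (surface_metric lagr he G).
- exact: (surface_cubic oD omega_smooth Q_coef lagr l0 he G).
- by move=> p Dp; rewrite (lift_frameE lagr he Dp) d1.
- apply: maurer_cartan_ext mc => //; first by apply: mxsmoothM => //; exact: mxsmooth_cst.
  by move=> p Dp; rewrite (lift_frameE lagr he Dp).
Qed.

End LagrangianFamily.

(** * Affine spheres *)

Section Complexification.
Context {R : realType}.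
Implicit Types (F : 'rV[R]_2 -> 'cV[R]_3).

Lemma complexify_mpd F j : complexify (rmxpd j F) = mxpd j (complexify F).
Proof.
apply/funext => p; apply/matrixP => i k; rewrite [LHS]mxE [X in X%:C]mxE [RHS]mxpdE /cpd.
rewrite (_ : (fun q => Re _) = fun q => F q i k); last by apply/funext => q; rewrite mxE.
rewrite (_ : (fun q => Im _) = fun=> 0); last by apply/funext => q; rewrite mxE.
by rewrite [X in _ = _ +i* X]/pd derive_cst.
Qed.

Lemma complexifyZ (k : R) (u : 'cV[R]_3) :
  map_mx (real_complex R) (k *: u) = k%:C *: map_mx (real_complex R) u.
Proof. exact: map_mxZ. Qed.

Lemma det_complexify (a b d : 'cV[R]_3) : (\det (col3 a b d))%:C =
  \det (col3 (map_mx (real_complex R) a) (map_mx (real_complex R) b) (map_mx (real_complex R) d)).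
Proof.
rewrite -[LHS]det_map_mx; congr (\det _); apply/matrixP => i j; rewrite mxE.
by have [->|->|->] := ord3 j; rewrite !col3E mxE.
Qed.

Lemma det_col3D (K : comRingType) (a b u v : 'cV[K]_3) :
  \det (col3 a b (u + v)) = \det (col3 a b u) + \det (col3 a b v).
Proof. by rewrite !det3 !col3E !mxE; ring. Qed.

Lemma det_col3Z (K : comRingType) (a b u : 'cV[K]_3) (x : K) :
  \det (col3 a b (x *: u)) = x * \det (col3 a b u).
Proof. by rewrite !det3 !col3E !mxE; ring. Qed.

Lemma det_col3N (K : comRingType) (a b u : 'cV[K]_3) :
  \det (col3 a b (- u)) = - \det (col3 a b u).
Proof. by rewrite -scaleN1r det_col3Z mulN1r. Qed.

Lemma det_col3_l (K : comRingType) (a b : 'cV[K]_3) : \det (col3 a b a) = 0.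
Proof. by rewrite !det3 !col3E; ring. Qed.

Lemma det_col3_r (K : comRingType) (a b : 'cV[K]_3) : \det (col3 a b b) = 0.
Proof. by rewrite !det3 !col3E; ring. Qed.

Lemma det_col3_scale (K : comRingType) (a b d : 'cV[K]_3) (x : K) :
  \det (col3 (x *: a) (x *: b) d) = x * x * \det (col3 a b d).
Proof. by rewrite !det3 !col3E !mxE; ring. Qed.

(** With [x = 'i] it passes from the determinant with [f_z], [f_zbar] to the one with [f_x],
    [f_y]. *)
Lemma det_col3_xy (K : comRingType) (a b d : 'cV[K]_3) (x : K) :
  \det (col3 (a + b) (x *: (a - b)) d) = - (2 * x) * \det (col3 a b d).
Proof. by rewrite !det3 !col3E !mxE; ring. Qed.

End Complexification.

Section AffineSurface.
Context {R : realType}.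
Variables (c : surface_case) (D : set 'rV[R]_2) (omega : 'rV[R]_2 -> R) (Q Q2 : 'rV[R]_2 -> R[i]).
Hypotheses (oD : open D) (omega_smooth : smooth_on D omega).
Variables (lam : R[i]) (h : 'rV[R]_2 -> 'M[R[i]]_3).
Hypotheses (aff : ~~ lagrangian_case c) (lam0 : lam != 0) (h_smooth : mxsmooth_on D h)
  (h_eq : frame_eq c D omega Q Q2 lam h)
  (h_real : forall p, D p -> cmx (h p) *m Pmx c = h p)
  (h_det : forall p, D p -> \det (h p) = if conformal c then 'i else 1).

Local Notation wa p := (dela c (fun y => (omega y)%:C) p).
Local Notation wb p := (delb c (fun y => (omega y)%:C) p).
Local Notation e_ p := ((expR (omega p / 2))%:C).
Local Notation e' p := ((expR (- omega p))%:C).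
Local Notation ew p := ((expR (omega p))%:C).
Local Notation h1 p := (col 0 (h p)).
Local Notation h2 p := (col 1 (h p)).
Local Notation h3 p := (col 2 (h p)).

Definition real_surface p : 'cV[R]_3 := map_mx (@complex.Re R) (surface c h p).
Local Notation f := real_surface.
Local Notation g := (complexify f).

Lemma gauged_p_curvature : @gauged_p R c = - (mean_curvature R c)%:C.
Proof.
by move: aff; rewrite /gauged_p; case: c => //= _; apply: complex_eq; rewrite ?cReN ?cImN /= ?opprK ?oppr0.
Qed.

Lemma affine_gauged_r : @gauged_r R c = 1.
Proof. by move: aff; rewrite /gauged_r; case: c. Qed.

(** [Pmx] fixes the third basis vector, so the reality condition makes the third column its own
    conjugate; the factor in [surface] is a sign. *)
Lemma complexify_real_surface p : D p -> g p = surface c h p.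
Proof.
move=> Dp; apply/matrixP => i j; rewrite 2!mxE.
have r3 : (h p i 2)^* = h p i 2.
  rewrite -[in RHS](h_real Dp) mxE sum3 /Pmx /cmx !mxE.
  by case: conformal; rewrite ?mx3E ?mxE /= !mulr0 !add0r mulr1.
have sr : (surface c h p i j)^* = surface c h p i j.
  by rewrite !mxE rmorphM /= gauged_pJ r3.
by move: sr; case: (surface c h p i j) => a b /(congr1 (@complex.Im R)) /= E;
   apply: complex_eq => //=; lra.
Qed.

Lemma g_ab p : D p -> has_mab c g p (e_ p *: h1 p) (e_ p *: h2 p).
Proof.
move=> Dp; apply: has_mab_near (surface_ab h_eq Dp).
by apply: (near_eq_on oD _ Dp) => q Dq; rewrite complexify_real_surface.
Qed.

Lemma g_dela p : D p -> mxdela c g p = e_ p *: h1 p.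
Proof. by move=> Dp; rewrite (has_mab_dela (g_ab Dp)). Qed.

Lemma g_delb p : D p -> mxdelb c g p = e_ p *: h2 p.
Proof. by move=> Dp; rewrite (has_mab_delb (g_ab Dp)). Qed.

Lemma g_aab p : D p -> has_mab c (mxdela c g) p
  (wa p *: (e_ p *: h1 p) + (lam ^- 3 * coef_q c (Q p) * e' p) *: (e_ p *: h2 p)) (ew p *: h3 p).
Proof.
move=> Dp; have N : \forall q \near p, mxdela c (surface c h) q = mxdela c g q.
  by apply: (near_eq_on oD _ Dp) => q Dq; rewrite g_dela// (dela_surface h_eq).
apply: has_mab_eq (has_mab_near N (surface_aab oD omega_smooth lam0 h_eq Dp)).
  by rewrite !scalerA; congr (_ *: _ + _ *: _); ring.
by rewrite affine_gauged_r mul1r.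
Qed.

Lemma g_abb p : D p -> has_mab c (mxdelb c g) p (ew p *: h3 p)
  (wb p *: (e_ p *: h2 p) + (lam ^+ 3 * coef_s c (Q p) (Q2 p) * e' p) *: (e_ p *: h1 p)).
Proof.
move=> Dp; have N : \forall q \near p, mxdelb c (surface c h) q = mxdelb c g q.
  by apply: (near_eq_on oD _ Dp) => q Dq; rewrite g_delb// (delb_surface h_eq).
apply: has_mab_eq (has_mab_near N (surface_abb oD omega_smooth h_eq Dp)).
  by rewrite affine_gauged_r mul1r.
by rewrite !scalerA; congr (_ *: _ + _ *: _); ring.
Qed.

Lemma col_normal p : D p -> (- (mean_curvature R c)%:C) *: g p = h3 p.
Proof.
move=> Dp; rewrite complexify_real_surface// /surface scalerA -gauged_p_curvature gauged_pK.
by rewrite scale1r.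
Qed.

Lemma real_surface_cubic :
  affine_cubic c D f omega (fun p => lam ^- 3 * Q p) (fun p => lam ^+ 3 * Q2 p).
Proof.
move=> p Dp; rewrite (has_mab_dela (g_aab Dp)) (has_mab_delb (g_abb Dp)) !g_dela// !g_delb//.
by move: aff; rewrite /coef_q /coef_s; case: c => //= _; split.
Qed.

Lemma scale_h3 p : e' p *: (ew p *: h3 p) = h3 p.
Proof. by rewrite scalerA mulrC ew_e' scale1r. Qed.

Lemma col3_h p : col3 (h1 p) (h2 p) (h3 p) = h p.
Proof. by apply/matrixP => i j; have [->|->|->] := ord3 j; rewrite col3E mxE. Qed.

Lemma affine_frameE p : D p -> affine_frame c omega f p = h p.
Proof.
move=> Dp; rewrite /affine_frame (has_mab_delb (g_aab Dp)) g_dela// g_delb// scale_h3.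
by rewrite !scalerA e_inv !scale1r col3_h.
Qed.

Lemma real_surface_metric : affine_metric_function c D f omega.
Proof.
move=> p Dp; have X fa fb faa fbb fab : fa = e_ p *: h1 p -> fb = e_ p *: h2 p ->
    faa = wa p *: (e_ p *: h1 p) + (lam ^- 3 * coef_q c (Q p) * e' p) *: (e_ p *: h2 p) ->
    fbb = wb p *: (e_ p *: h2 p) + (lam ^+ 3 * coef_s c (Q p) (Q2 p) * e' p) *: (e_ p *: h1 p) ->
    fab = ew p *: h3 p -> [/\ \det (col3 fa fb faa) = 0, \det (col3 fa fb fbb) = 0,
      \det (col3 fa fb fab) = (if conformal c then 'i else 1) * (expR (2 * omega p))%:C &
      e' p *: fab = - (mean_curvature R c)%:C *: g p].
  move=> -> -> -> -> ->; split.
  - by rewrite det_col3D !det_col3Z !det_col3_scale det_col3_l det_col3_r !mulr0 addr0.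
  - by rewrite det_col3D !det_col3Z !det_col3_scale det_col3_l det_col3_r !mulr0 addr0.
  - rewrite [\det _]det_col3Z [\det _]det_col3_scale col3_h h_det// e_e mulrA -rmorphM /= mulrC.
    by congr (_ * (_ )%:C); rewrite -expRD; congr expR; ring.
  - by rewrite scale_h3 col_normal.
exact: (X _ _ _ _ _ (g_dela Dp) (g_delb Dp) (has_mab_dela (g_aab Dp)) (has_mab_delb (g_abb Dp))
  (has_mab_delb (g_aab Dp))).
Qed.

Lemma real_surface_smooth : rmxsmooth_on D f.
Proof.
move=> i j; rewrite (_ : (fun q => _) = fun q => Re (surface c h q i j)).
  by have [] := surface_smooth c oD h_smooth i j.
by apply/funext => q; rewrite mxE.
Qed.

Lemma complexify_smooth : mxsmooth_on D g.
Proof.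
move=> i j; rewrite (_ : (fun q => _) = fun q => (f q i j)%:C); last by apply/funext => q; rewrite mxE.
exact: csmooth_real (real_surface_smooth i j).
Qed.

Local Notation L v p := (\det (col3 (h1 p) (h2 p) v)).

Lemma det_tangent p v : D p -> \det (col3 (mxpd 0 g p) (mxpd 1 g p) v) =
  (if conformal c then - (2 * 'i) else 1) * ew p * L v p.
Proof.
move=> Dp; have [] := has_mab_mpd (g_ab Dp) => /has_mpd_val -> /has_mpd_val ->.
by case: conformal; rewrite ?det_col3_xy det_col3_scale e_e ?mulrA ?mul1r.
Qed.

(** Tangency is tested by the linear form [L], which kills the first two columns of the frame. In
    the conformal cases the volume of the affine normal is [(- 2 'i) * 'i * e^omega = 2 e^omega],
    whose square is the determinant of [metric_mx]; in the null case it is [e^omega], and that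
    determinant is [- e^(2 omega)]. *)
Lemma real_surface_affine_sphere : affine_sphere c D f.
Proof.
split=> [|p Dp]; first exact: real_surface_smooth.
have L1 : L (h1 p) p = 0 by exact: det_col3_l.
have L2 : L (h2 p) p = 0 by exact: det_col3_r.
have L3 : L (h3 p) p = if conformal c then 'i else 1 by rewrite col3_h h_det.
have LC x y : L (x *: h1 p + y *: h2 p) p = 0 by rewrite det_col3D !det_col3Z L1 L2 !mulr0 addr0.
pose xi q := - mean_curvature R c *: f q.
have xiE q : D q -> map_mx (real_complex R) (xi q) = h3 q.
  move=> Dq; rewrite complexifyZ -(col_normal Dq); congr (_ *: _).
  by apply: complex_eq; rewrite ?cReN ?cImN /= ?oppr0.
have C0 j : map_mx (real_complex R) (rmxpd j f p) = mxpd j g p.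
  by rewrite -complexify_mpd.
have detC v : (\det (col3 (rmxpd 0 f p) (rmxpd 1 f p) v))%:C =
    (if conformal c then - (2 * 'i) else 1) * ew p * L (map_mx (real_complex R) v) p.
  have E := det_tangent (map_mx (real_complex R) v) Dp; rewrite -(C0 0) -(C0 1) in E.
  exact: etrans (det_complexify _ _ _) E.
have det_xi : \det (col3 (rmxpd 0 f p) (rmxpd 1 f p) (xi p)) =
    if conformal c then 2 * expR (omega p) else expR (omega p).
  apply: (@complexI R); rewrite [LHS]detC xiE// L3; case: conformal; last by rewrite mul1r mulr1.
  by rewrite mulrAC mulNr -mulrA mulii; apply: complex_eq; rewrite /= ; ring.
have det0 v : L (map_mx (real_complex R) v) p = 0 -> \det (col3 (rmxpd 0 f p) (rmxpd 1 f p) v) = 0.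
  by move=> v0; apply: (@complexI R); rewrite [LHS]detC v0 mulr0.
have ew0 := expR_gt0 (omega p).
have [A [B [aa bb LA LB]]] : exists A B, [/\ has_mab c (mxdela c g) p A (ew p *: h3 p),
    has_mab c (mxdelb c g) p (ew p *: h3 p) B, L A p = 0 & L B p = 0].
  have := g_aab Dp; have := g_abb Dp; rewrite !scalerA => bb aa.
  by do 2 eexists; split; [exact: aa|exact: bb|exact: LC|rewrite addrC; exact: LC].
have [S SD] : exists S : 'I_2 -> 'I_2 -> 'cV_3, forall i j, S i j = mxpd i (mxpd j g) p.
  by exists (fun i j => mxpd i (mxpd j g) p).
have [/(etrans (SD _ _)) S00 /(etrans (SD _ _)) S11 /(etrans (SD _ _)) S01 /(etrans (SD _ _)) S10] :=
  second_mpd oD complexify_smooth Dp aa bb.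
exists (metric_mx c omega p); split; last first.
  rewrite /metric_mx det2; case: conformal.
    by rewrite !mxE /= !mulr1n !mulr0n mul0r subr0 !mulr_gt0.
  by rewrite !mxE /= !mulr0 !mulr1 sub0r oppr_lt0 mulr_gt0.
(* From here on only the linearity of [L] counts, so the determinant is hidden behind a linear
   form. *)
have [l [lE lD lZ lN]] : exists l : 'cV[R[i]]_3 -> R[i], [/\ forall v, L v p = l v,
    forall u v, l (u + v) = l u + l v, forall x u, l (x *: u) = x * l u & forall u, l (- u) = - l u].
  by exists (fun v => L v p); split => *; [|exact: det_col3D|exact: det_col3Z|exact: det_col3N].
rewrite !lE in LA LB L1 L2.
split.
- by rewrite det_xi; case: conformal; rewrite gt_eqF// mulr_gt0.
- move=> i j; apply: det0; rewrite map_mxB complexifyZ xiE//.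
  have -> : map_mx (real_complex R) (rmxpd i (rmxpd j f) p) = S i j.
    by rewrite SD -!complexify_mpd.
  have two : (2 * expR (omega p))%:C = ew p + ew p :> R[i].
    by apply: complex_eq; rewrite ?cReD ?cImD /=; ring.
  rewrite lE; move: S00 S11 S01 S10; rewrite /metric_mx; move: (h3 p) => w.
  case: conformal => S00 S11 S01 S10.
    by have [->|->] := ord2 i; have [->|->] := ord2 j; rewrite ?S00 ?S11 ?S01 ?S10 mxE /= ?mulr1n ?mulr0n
      ?two !(lD, lN, lZ) LA LB; ring.
  by have [->|->] := ord2 i; have [->|->] := ord2 j; rewrite ?S00 ?S11 ?S01 ?S10 2!mxE /= ?mulr1 ?mulr0
      !(lD, lN, lZ) ?LA ?LB; ring.
- move=> j; apply: det0; rewrite (_ : map_mx _ _ = mxpd j (complexify xi) p); last by rewrite -complexify_mpd.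
  have N : \forall q \near p, h3 q = complexify xi q.
    by apply: (near_eq_on oD _ Dp) => q Dq; rewrite -xiE.
  have [/has_mpd_val d0 /has_mpd_val d1] := has_mab_mpd (has_mab_near N (h3_ab h_eq Dp)).
  rewrite lE; move: d0 d1 L1 L2; move: (h1 p) (h2 p) => u v d0 d1 L1 L2.
  have [->|->] := ord2 j; rewrite ?d0 ?d1; case: conformal;
    by rewrite !(lD, lN, lZ) ?L1 ?L2; ring.
- rewrite det_xi det2 /metric_mx; case: conformal.
    by rewrite !mxE /= !mulr1n !mulr0n mul0r subr0 ger0_norm ?expr2// !mulr_ge0// ltW.
  by rewrite !mxE /= !mulr0 !mulr1 sub0r normrN ger0_norm ?expr2// mulr_ge0// ltW.
Qed.

End AffineSurface.

Section AffineFamily.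
Context {R : realType}.
Variables (c : surface_case) (D : set 'rV[R]_2) (omega : 'rV[R]_2 -> R) (Q Q2 : 'rV[R]_2 -> R[i]).
Hypotheses (oD : open D) (scD : simply_connected D) (omega_smooth : smooth_on D omega)
  (Q_coef : cubic_coefficients c D Q Q2) (aff : ~~ lagrangian_case c).

(** In the conformal cases the first two columns must be conjugate, the third real, and the
    determinant ['i], as prescribed by [det[f_z, f_zbar, f_zzbar] = i e^(2 omega)]; in null
    coordinates a real frame of determinant 1 is wanted. *)
Definition initial_frame : 'M[R[i]]_3 := if conformal c
  then mx3 [:: [:: 1; 1; 0]; [:: - 'i / 2; 'i / 2; 0]; [:: 0; 0; 1]] else 1%:M.

Lemma initial_frame_real : cmx initial_frame *m Pmx c = initial_frame.
Proof.
have iJ : ('i : R[i])^* = - 'i by exact: conjCi.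
have hJ : ('i / 2 : R[i])^* = - 'i / 2 by rewrite rmorphM /= fmorphV rmorph_nat iJ.
have hJ' : (- 'i / 2 : R[i])^* = 'i / 2 by rewrite mulNr rmorphN /= hJ mulNr opprK.
rewrite /initial_frame /Pmx; case: conformal; last by rewrite mulmx1; exact: map_mx1.
rewrite /cmx map_mx3 hJ hJ' rmorph1 rmorph0 mul_mx3.
by apply: eq_mx3; rewrite ?(mulr0, mulr1, addr0, add0r).
Qed.

Lemma initial_frame_det : \det initial_frame = if conformal c then 'i else 1.
Proof.
have two : (2 : R[i]) != 0 by rewrite pnatr_eq0.
by rewrite /initial_frame; case: conformal; rewrite ?det1// det3 !mx3E; field.
Qed.

Lemma affine_of_flat lam : Lambda0 c lam -> flat_on D (alpha c omega Q Q2 lam) ->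
  exists f : 'rV[R]_2 -> 'cV[R]_3,
      [/\ affine_sphere c D f,
          affine_metric_function c D f omega,
          affine_cubic c D f omega
            (fun p => lam ^- 3 * Q p) (fun p => lam ^+ 3 * Q2 p)
        & maurer_cartan_form D (fun p => affine_frame c omega f p *m Gmx c lam)
            (alpha c omega Q Q2 lam)].
Proof.
move=> Llam fl; have l0 := Lambda0_neq0 Llam; have [[x0 Dx0] _ _] := scD.
have Hu : initial_frame \in unitmx.
  by rewrite unitmxE initial_frame_det unitfE; case: conformal; rewrite ?neq0Ci ?oner_neq0.
have [h [h0 hs he mc uniq]] := frame_exists oD scD omega_smooth Q_coef l0 Dx0 Hu fl.
have hr p (Dp : D p) : cmx (h p) *m Pmx c = h p.
  apply: (reality oD omega_smooth Q_coef Llam he (x0 := x0)) => //; rewrite h0//.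
  exact: initial_frame_real.
have hd p (Dp : D p) : \det (h p) = if conformal c then 'i else 1.
  by rewrite (det_const oD scD he Dp Dx0) h0 initial_frame_det.
exists (real_surface c h); split.
- exact: (real_surface_affine_sphere oD omega_smooth aff l0 hs he hr hd).
- exact: (real_surface_metric oD omega_smooth aff l0 he hr hd).
- exact: (real_surface_cubic oD omega_smooth aff l0 he hr).
- apply: maurer_cartan_ext mc => //; first by apply: mxsmoothM => //; exact: mxsmooth_cst.
  by move=> p Dp; rewrite (affine_frameE oD omega_smooth aff l0 he hr Dp).
Qed.

End AffineFamily.

(** * From surfaces back to flatness *)

Section Flatness.
Context {R : realType}.
Variables (D : set 'rV[R]_2) (oD : open D).

(** The mixed derivatives of [F] are [F] times [A i *m A j + mxpd i (A j)]; their symmetry gives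
    flatness after cancelling the invertible [F p]. *)
Lemma maurer_cartan_flat (F : 'rV[R]_2 -> 'M[R[i]]_3) (A : mx_form R) : mxsmooth_on D F ->
  (forall j, mxsmooth_on D (A j)) -> maurer_cartan_form D F A -> flat_on D A.
Proof.
move=> Fs As mc p Dp; have [Fu _] := mc p Dp.
have E j q : D q -> F q *m A j q = mxpd j F q.
  by move=> Dq; have [Fqu <-] := mc q Dq; rewrite mulKVmx.
have dE i j : mxpd i (mxpd j F) p = F p *m (A i p *m A j p) + F p *m mxpd i (A j) p.
  have h := has_mpdM (mxsmooth_has_mpd i Fs Dp) (mxsmooth_has_mpd i (As j) Dp).
  by rewrite (has_mpd_val (has_mpd_near (near_eq_on oD (E j) Dp) h)) -(E i p Dp) mulmxA.
have := mxpd_comm oD Fs Dp; rewrite !dE -!mulmxDr => /(can_inj (mulKmx Fu))/eqP.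
by rewrite -subr_eq0 opprD addrACA addrC => /eqP.
Qed.

Lemma mxsmoothZ m n f (F : 'rV[R]_2 -> 'M[R[i]]_(m, n)) : csmooth_on D f -> mxsmooth_on D F ->
  mxsmooth_on D (fun q => f q *: F q).
Proof. by move=> fs Fs i j; under eq_fun do rewrite mxE; exact: csmoothM. Qed.

Lemma col3_smooth (a b d : 'rV[R]_2 -> 'cV[R[i]]_3) : mxsmooth_on D a -> mxsmooth_on D b ->
  mxsmooth_on D d -> mxsmooth_on D (fun q => col3 (a q) (b q) (d q)).
Proof.
by move=> sa sb sd i j; have [->|->|->] := ord3 j; under eq_fun do rewrite col3E.
Qed.

Variables (c : surface_case) (omega : 'rV[R]_2 -> R).
Hypothesis (omega_smooth : smooth_on D omega).

Let e_smooth : csmooth_on D (fun p => (expR (- (omega p / 2)))%:C : R[i]).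
Proof.
rewrite (_ : (fun p => _) = fun p => (expR (- 2^-1 * omega p))%:C); first exact: expR_smooth.
by apply/funext => p; rewrite mulNr mulrC.
Qed.

Let e'_smooth : csmooth_on D (fun p => (expR (- omega p))%:C : R[i]).
Proof. by under eq_fun do rewrite -mulN1r; exact: expR_smooth. Qed.

Lemma lift_frame_smooth F : mxsmooth_on D F -> mxsmooth_on D (lift_frame c omega F).
Proof.
move=> Fs; apply: col3_smooth => //; apply: mxsmoothZ => //.
  exact: mxsmooth_dela.
exact: mxsmooth_delb.
Qed.

Lemma affine_frame_smooth f : rmxsmooth_on D f -> mxsmooth_on D (affine_frame c omega f).
Proof.
move=> fs; have gs : mxsmooth_on D (complexify f).
  move=> i j; rewrite (_ : (fun q => _) = fun q => (f q i j)%:C); first exact: csmooth_real (fs i j).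
  by apply/funext => q; rewrite mxE.
have ga := mxsmooth_dela c oD gs; have gb := mxsmooth_delb c oD gs.
by apply: col3_smooth; apply: mxsmoothZ => //; exact: mxsmooth_delb.
Qed.

End Flatness.

Theorem theorem6p1 (R : realType) (c : surface_case) (D : set 'rV[R]_2)
    (omega : 'rV[R]_2 -> R) (Q Q2 : 'rV[R]_2 -> R[i])
    (D_open : open D) (D_sc : simply_connected D)
    (omega_smooth : smooth_on D omega)
    (Q_coef : cubic_coefficients c D Q Q2) :
  extended_maurer_cartan c D omega Q Q2 <->
  (forall lam : R[i], Lambda0 c lam -> flat_on D (alpha c omega Q Q2 lam)).
Proof.
have As lam j := alpha_smooth D_open omega_smooth Q_coef lam j.
have mcf lam F : mxsmooth_on D F ->
    maurer_cartan_form D (fun p => F p *m Gmx c lam) (alpha c omega Q Q2 lam) ->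
    flat_on D (alpha c omega Q Q2 lam).
  move=> Fs; apply: maurer_cartan_flat => //.
  by apply: mxsmoothM => //; exact: mxsmooth_cst.
have -> : extended_maurer_cartan c D omega Q Q2 = if lagrangian_case c
    then exists f, lagrangian_associated_family c D omega Q Q2 f
    else exists f, affine_associated_family c D omega Q Q2 f by case: (c).
case: ifPn => lg; split.
- move=> [f [fam [_ H]]] lam /H[_ [F [[[Fs _] _] _ _ _]]].
  by apply: mcf; exact: lift_frame_smooth.
- move=> fl; have [|fam famP] := @choice _ _ (fun lam f => Lambda0 c lam -> minimal_lagrangian c D f /\
      exists F : 'rV[R]_2 -> 'cV[R[i]]_3,
        [/\ horizontal_lift c D f F,
            lift_metric_function c D F omega,
            lift_cubic c D F (fun p => lam ^- 3 * Q p) (fun p => lam ^+ 3 * Q2 p),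
            forall p, D p -> \det (lift_frame c omega F p) = 1
          & maurer_cartan_form D (fun p => lift_frame c omega F p *m Gmx c lam)
              (alpha c omega Q Q2 lam)]).
    (* Outside [Lambda0] nothing is asked of the family, and an arbitrary value completes the
       choice. *)
    move=> lam; have [Llam|nL] := pselect (Lambda0 c lam).
      have [f fP] := lagrangian_of_flat D_open D_sc omega_smooth Q_coef lg Llam (fl lam Llam).
      by exists f.
    by exists (fun=> 0%VS).
  by exists (fam 1), fam.
- move=> [f [fam [_ H]]] lam /H[[fs _] _ _].
  by apply: mcf; exact: affine_frame_smooth.
- move=> fl; have [|fam famP] := @choice _ _ (fun lam f => Lambda0 c lam ->
      [/\ affine_sphere c D f,
          affine_metric_function c D f omega,
          affine_cubic c D f omega
            (fun p => lam ^- 3 * Q p) (fun p => lam ^+ 3 * Q2 p)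
        & maurer_cartan_form D (fun p => affine_frame c omega f p *m Gmx c lam)
            (alpha c omega Q Q2 lam)]).
    move=> lam; have [Llam|nL] := pselect (Lambda0 c lam).
      have [f fP] := affine_of_flat D_open D_sc omega_smooth Q_coef lg Llam (fl lam Llam).
      by exists f.
    by exists (fun=> 0).
  by exists (fam 1), fam.
Qed.
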